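(* Define the Banach space $$D^\alpha_{\min}=\{u\in L^2(\mathbb{R}^n)\mid Pu\in L^2(\mathbb{R}^n),\ \exists\,(u_k)_{k\ge1}\subset C_c^\infty(\mathbb{R}^n):\ u_k\to u,\ Pu_k\to Pu \text{ in } L^2(\mathbb{R}^n)\}$$ equipped with its graph norm $\|u\|_{L^2}+\|Pu\|_{L^2}$. Then the inclusion $D^\alpha_{\min}\hookrightarrow L^2(\mathbb{R}^n)$ is compact.
   Context: $n\ge 1$, $\alpha>1$ is real, $\langle y\rangle=(1+|y|^2)^{1/2}$. $V(x,\xi)=\sum_{j,k=1}^n a_{jk}(x)\xi_j\xi_k+\sum_{j=1}^n b_j(x)\xi_j+c(x)$, where $a_{jk}=a_{kj}$, $b_j$, $c$ are real-valued smooth functions on $\mathbb{R}^n$ such that, for some $0<\mu<1/2$ and all multi-indices $\beta$ (with constants $C_\beta>0$), $|\partial_x^\beta a_{jk}(x)|\le C_\beta(1+|x|)^{-\mu-|\beta|}$, $|\partial_x^\beta b_j(x)|\le C_\beta(1+|x|)^{\alpha-\mu-|\beta|}$, $|\partial_x^\beta c(x)|\le C_\beta(1+|x|)^{2\alpha-\mu-|\beta|}$. $\mathrm{Op}(a)$ is the Weyl quantization, $\mathrm{Op}(a)u(x)=(2\pi)^{-n}\int\int e^{i(x-y)\cdot\xi}a(\frac{x+y}{2},\xi)u(y)\,dy\,d\xi$. $P=-\Delta-\langle x\rangle^{2\alpha}+\mathrm{Op}(V)$ is a differential operator acting in the distributional sense, and $p(x,\xi)=|\xi|^2-\langle x\rangle^{2\alpha}+V(x,\xi)$.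 It is assumed that for any $M>0$ there are $C>0$ and $R_M>0$ with $|p(x,\xi)|\ge C\langle\xi\rangle^2$ whenever $|x|\le M$, $|\xi|\ge R_M$. *)

(* Defs.v *)
From HB Require Import structures.
From mathcomp Require Import all_boot all_order all_algebra.
From mathcomp Require Import all_classical all_reals all_analysis.
From mathcomp Require Import complex.

Set Implicit Arguments.
Unset Strict Implicit.
Unset Printing Implicit Defensive.

Import Order.TTheory GRing.Theory Num.Theory.
Import numFieldNormedType.Exports.

Local Open Scope classical_set_scope.
Local Open Scope ring_scope.
Local Open Scope complex_scope.

(* Row vectors carry the sigma-algebra generated by the coordinate maps (the
   Borel sigma-algebra), as n.-tuple R does in the library. *)
Section measurable_rV.
Context {R : realType} (n : nat).

Let coord (i : 'I_n) (x : 'rV[R]_n) : measurableTypeR R := x 0 i.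

Let rV_set0 : g_sigma_preimage coord set0.
Proof. exact: sigma_algebra0. Qed.

Let rV_setC A : g_sigma_preimage coord A -> g_sigma_preimage coord (~` A).
Proof. exact: sigma_algebraC. Qed.

Let rV_bigcup (F : _^nat) : (forall i, g_sigma_preimage coord (F i)) ->
  g_sigma_preimage coord (\bigcup_i (F i)).
Proof. exact: sigma_algebra_bigcup. Qed.

HB.instance Definition _ := @isMeasurable.Build default_measure_display
  'rV[R]_n (g_sigma_preimage coord) rV_set0 rV_setC rV_bigcup.

Lemma measurable_coord_rV (i : 'I_n) :
  measurable_fun [set: 'rV[R]_n] (fun x : 'rV[R]_n => x 0 i : measurableTypeR R).
Proof.
move=> _ Y mY; rewrite setTI; apply: sub_sigma_algebra => /=.
rewrite -bigcup_seq/=; exists i => /=; first by rewrite mem_index_enum.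
by exists Y => //; rewrite setTI.
Qed.

Lemma measurable_fun_rV d (T : measurableType d) (f : T -> 'rV[R]_n) :
  (forall i, measurable_fun [set: T] (fun t => f t 0 i : measurableTypeR R)) ->
  measurable_fun [set: T] f.
Proof.
move=> mf _ Y mY; rewrite setTI.
suff: g_sigma_preimage coord `<=` [set A | measurable (f @^-1` A)] by apply.
apply: smallest_sub.
  split => [|A mA|F mF] /=; first by rewrite preimage_set0; exact: measurable0.
    by rewrite setTD preimage_setC; exact: measurableC.
  by rewrite preimage_bigcup; apply: bigcup_measurable => k _; exact: mF.
rewrite -bigcup_seq => A [i _ [B mB <-]] /=.
rewrite setTI -comp_preimage -[X in measurable X]setTI; exact: mf.
Qed.

End measurable_rV.

(* Lebesgue measure on 'rV[R]_n.+1 is the image of lebesgue_measure \x mu_n by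
   (t, x) |-> [t, x]. *)
Section rV_cons_measure.
Context {R : realType} {n : nat}.

Definition rV_cons (p : measurableTypeR R * 'rV[R]_n) : 'rV[R]_n.+1 :=
  \row_i oapp (p.2 0) p.1 (unlift ord0 i).

Definition rV_uncons (x : 'rV[R]_n.+1) : measurableTypeR R * 'rV[R]_n :=
  (x 0 ord0, \row_i x 0 (lift ord0 i)).

Lemma rV_consK : cancel rV_cons rV_uncons.
Proof.
case=> t x; rewrite /rV_uncons !mxE unlift_none/=; congr (_, _).
by apply/rowP => i; rewrite !mxE liftK.
Qed.

Lemma rV_unconsK : cancel rV_uncons rV_cons.
Proof.
move=> x; apply/rowP => i; rewrite !mxE.
by case: unliftP => [j|] ->//=; rewrite mxE.
Qed.

Lemma measurable_rV_cons : measurable_fun setT rV_cons.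
Proof.
apply: measurable_fun_rV => i.
under eq_fun do rewrite mxE.
case: (unlift ord0 i) => [j|] /=; last exact: measurable_fst.
apply: (measurableT_comp (measurable_coord_rV j)); exact: measurable_snd.
Qed.

Lemma measurable_rV_uncons : measurable_fun setT rV_uncons.
Proof.
apply: measurable_fun_pair; first exact: measurable_coord_rV.
apply: measurable_fun_rV => i.
by under eq_fun do rewrite mxE; exact: measurable_coord_rV.
Qed.

Variable mu : {sigma_finite_measure set 'rV[R]_n -> \bar R}.

Definition cons_measure : set 'rV[R]_n.+1 -> \bar R :=
  pushforward (@lebesgue_measure R \x mu)%E rV_cons.

Let measurable_preimage_cons A : measurable A -> measurable (rV_cons @^-1` A).
Proof. by move=> mA; rewrite -[X in measurable X]setTI; exact: measurable_rV_cons. Qed.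

Let cons_measure0 : cons_measure set0 = 0%E.
Proof. by rewrite /cons_measure /pushforward preimage_set0 measure0. Qed.

Let cons_measure_ge0 A : (0 <= cons_measure A)%E.
Proof. by rewrite /cons_measure /pushforward measure_ge0. Qed.

Let cons_measure_sigma_additive : semi_sigma_additive cons_measure.
Proof.
move=> F mF tF mUF; rewrite /cons_measure /pushforward preimage_bigcup.
apply: measure_semi_sigma_additive.
- by move=> k; exact: measurable_preimage_cons.
- apply/trivIsetP => /= i j _ _ ij; rewrite -preimage_setI.
  by move/trivIsetP : tF => /(_ _ _ _ _ ij) ->//; rewrite preimage_set0.
- by rewrite -preimage_bigcup; exact: measurable_preimage_cons.
Qed.

HB.instance Definition _ := isMeasure.Build _ _ _ cons_measure
  cons_measure0 cons_measure_ge0 cons_measure_sigma_additive.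

Let cons_measure_sigma_finite : sigma_finite setT cons_measure.
Proof.
have /sigma_finiteP[F [UF ndF Foo]] := sigma_finiteT (@lebesgue_measure R).
have /sigma_finiteP[G [UG ndG Goo]] := sigma_finiteT mu.
exists (fun k => rV_uncons @^-1` (F k `*` G k)).
  rewrite -preimage_bigcup -(preimage_setT rV_uncons); congr (_ @^-1` _).
  rewrite -setXTT UF UG predeqE => -[x y]; split.
    move=> [/= [k _ Fkx] [l _ Gly]]; exists (maxn k l) => //; split.
    - by move: x Fkx; exact/subsetPset/ndF/leq_maxl.
    - by move: y Gly; exact/subsetPset/ndG/leq_maxr.
  by move=> [k _ []/= ? ?]; split; exists k.
move=> k; have [mF Fk] := Foo k; have [mG Gk] := Goo k; split.
  rewrite -[X in measurable X]setTI; apply: measurable_rV_uncons => //.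
  exact: measurableX.
rewrite /cons_measure /pushforward -comp_preimage.
rewrite (_ : _ \o _ = id) ?preimage_id; last by apply/funext; exact: rV_consK.
by rewrite product_measure1E// lte_mul_pinfty// ge0_fin_numE.
Qed.

HB.instance Definition _ := Measure_isSigmaFinite.Build _ _ _ cons_measure
  cons_measure_sigma_finite.

End rV_cons_measure.

Fixpoint lebesgue_rV (R : realType) (n : nat) :
    {sigma_finite_measure set 'rV[R]_n -> \bar R} :=
  match n with
  | 0 => dirac (0 : 'rV[R]_0)
  | m.+1 => cons_measure (lebesgue_rV R m)
  end.

Lemma lebesgue_rV_box (R : realType) (n : nat) (A : 'I_n -> set R) :
  (forall i, measurable (A i)) ->
  lebesgue_rV R n [set x | forall i, A i (x 0 i)] =
  (\prod_(i < n) lebesgue_measure (A i))%E.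
Proof.
elim: n A => [|n IHn] A mA.
  rewrite big_ord0 /= diracE mem_set//=; last by case.
rewrite big_ord_recl -IHn//.
pose B := [set x : 'rV[R]_n | forall i, A (lift ord0 i) (x 0 i)].
have mB : measurable B.
  rewrite (_ : B = \bigcap_(i in [set: 'I_n]) [set x | A (lift ord0 i) (x 0 i)]).
    apply: fin_bigcap_measurable => [|i _]; first exact: finite_finset.
    rewrite -[X in measurable X]setTI.
    by apply: (@measurable_coord_rV R n i) => //; exact: mA.
  by apply/seteqP; split => x /= Bx i; [move=> _; exact: Bx|exact: Bx].
rewrite -/B -product_measure1E//; last exact: mA.
transitivity ((lebesgue_measure \x lebesgue_rV R n)%E
    (rV_cons @^-1` [set x | forall i, A i (x 0 i)])) => //.
congr (_ _); apply/seteqP; split => [[t x] /= H|[t x] /= [H0 H] i].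
  split=> [|i]; first by have := H ord0; rewrite mxE unlift_none.
  by have := H (lift ord0 i); rewrite mxE liftK.
by rewrite mxE; case: unliftP => [j|] -> //=; exact: H.
Qed.

Section euclidean.
Context {R : realType} {n : nat}.
Implicit Types x y : 'rV[R]_n.

Definition dotp x y : R := \sum_i x 0 i * y 0 i.

(* The library norm `|x| on 'rV[R]_n is the sup norm. *)
Definition enorm x : R := Num.sqrt (dotp x x).

Definition japanese x : R := Num.sqrt (1 + enorm x ^+ 2).

End euclidean.

Section smooth_functions.
Context {R : realType} {n : nat}.

Definition partial (i : 'I_n) (f : 'rV[R]_n -> R) : 'rV[R]_n -> R :=
  fun x => 'D_(delta_mx 0 i) f x.

Definition multi_index : Type := 'I_n -> nat.

Definition mabs (beta : multi_index) : nat := (\sum_i beta i)%N.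

Definition mpartial (beta : multi_index) (f : 'rV[R]_n -> R) :=
  foldr (fun i g => iter (beta i) (partial i) g) f (enum 'I_n).

Definition smooth (f : 'rV[R]_n -> R) : Prop := forall s : seq 'I_n,
  continuous (foldr partial f s) /\
  forall i x, derivable (foldr partial f s) x (delta_mx 0 i).

Definition symbol_bound (m : R) (f : 'rV[R]_n -> R) : Prop :=
  forall beta : multi_index, exists2 C : R, 0 < C &
    forall x, `|mpartial beta f x| <= C * (1 + enorm x) `^ (m - (mabs beta)%:R).

Definition csmooth (u : 'rV[R]_n -> R[i]) : Prop :=
  smooth (fun x => complex.Re (u x)) /\ smooth (fun x => complex.Im (u x)).

Definition test_function (u : 'rV[R]_n -> R[i]) : Prop :=
  csmooth u /\ compact (closure [set x | u x != 0]).

Definition claplacian (u : 'rV[R]_n -> R[i]) : 'rV[R]_n -> R[i] := fun x =>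
  \sum_i (partial i (partial i (fun y => complex.Re (u y))) x
          +i* partial i (partial i (fun y => complex.Im (u y))) x).

End smooth_functions.

Section L2.
Context {R : realType} {n : nat}.
Local Notation mu := (lebesgue_rV R n).
Implicit Types u : 'rV[R]_n -> R[i].

Definition cintegral u : R[i] :=
  (\int[mu]_x complex.Re (u x)) +i* (\int[mu]_x complex.Im (u x)).

Definition L2norm u : \bar R :=
  Lnorm mu 2%:E (fun x => (ComplexField.Normc.normc (u x))%:E).

(* Elements of L^2 are handled through representatives. *)
Definition L2 : set ('rV[R]_n -> R[i]) := [set u |
  [/\ measurable_fun setT (fun x => complex.Re (u x)),
      measurable_fun setT (fun x => complex.Im (u x)) & (L2norm u < +oo)%E]].

Definition L2_cvg (u_ : nat -> 'rV[R]_n -> R[i]) u : Prop :=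
  (fun k => L2norm (fun x => u_ k x - u x)) @ \oo --> 0%E.

(* Compactness of the inclusion of a subspace E of L^2, normed by N, into L^2:
   every N-bounded sequence of E has a subsequence converging in L^2. *)
Definition compact_inclusion_L2 (E : set ('rV[R]_n -> R[i]))
    (N : ('rV[R]_n -> R[i]) -> \bar R) : Prop :=
  forall u_ : nat -> 'rV[R]_n -> R[i],
    (forall k, E (u_ k)) -> (exists M : R, forall k, (N (u_ k) <= M%:E)%E) ->
  exists2 s : nat -> nat, {homo s : i j / (i < j)%N} &
  exists2 v, L2 v & L2_cvg (fun k => u_ (s k)) v.

End L2.

Section operator.
Context {R : realType} {n : nat}.
Implicit Types (u f phi : 'rV[R]_n -> R[i]) (V : 'rV[R]_n -> 'rV[R]_n -> R).

Definition cis (t : R) : R[i] := cos t +i* sin t.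

(* The y-integral is computed first: for u in C_c^oo and a polynomial in xi
   with smooth coefficients it converges absolutely and is rapidly decreasing
   in xi, so that the xi-integral converges absolutely too. *)
Definition weyl (a : 'rV[R]_n -> 'rV[R]_n -> R[i]) u : 'rV[R]_n -> R[i] :=
  fun x => ((2 * pi) ^- n)%:C * cintegral (fun xi => cintegral (fun y =>
    cis (dotp (x - y) xi) * a (2^-1 *: (x + y)) xi * u y)).

Definition perturbation (a : 'I_n -> 'I_n -> 'rV[R]_n -> R)
    (b : 'I_n -> 'rV[R]_n -> R) (c : 'rV[R]_n -> R) (x xi : 'rV[R]_n) : R :=
  \sum_j \sum_k a j k x * xi 0 j * xi 0 k + \sum_j b j x * xi 0 j + c x.

Variable alpha : R.

(* P on C_c^oo *)
Definition repulsive V u : 'rV[R]_n -> R[i] := fun x =>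
  - claplacian u x - (japanese x `^ (2 * alpha))%:C * u x
  + weyl (fun y xi => (V y xi)%:C) u x.

Definition repulsive_symbol V (x xi : 'rV[R]_n) : R :=
  enorm xi ^+ 2 - japanese x `^ (2 * alpha) + V x xi.

(* P u = f in the sense of distributions.  The transpose of Op(a) for the
   bilinear pairing is Op(a'), with a'(x, xi) = a(x, - xi): exchange x and y
   and change xi into - xi in the Weyl formula. *)
Definition distr_repulsive V u f : Prop := forall phi, test_function phi ->
  cintegral (fun x => u x * repulsive (fun y xi => V y (- xi)) phi x) =
  cintegral (fun x => f x * phi x).

(* The L^2 representative of P u; a dummy value if P u is not in L^2. *)
Definition repulsive_L2 V u : 'rV[R]_n -> R[i] :=
  xget (fun=> 0) [set f | L2 f /\ distr_repulsive V u f].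

Definition Dmin V : set ('rV[R]_n -> R[i]) := [set u |
  [/\ L2 u,
      exists2 f, L2 f & distr_repulsive V u f &
      exists u_ : nat -> 'rV[R]_n -> R[i],
        [/\ forall k, test_function (u_ k), L2_cvg u_ u &
            L2_cvg (fun k => repulsive V (u_ k)) (repulsive_L2 V u)]]].

Definition graph_norm V u : \bar R := (L2norm u + L2norm (repulsive_L2 V u))%E.

End operator.

(* Main.v *)
Require Import Defs.
From mathcomp Require Import all_boot all_order all_algebra.
From mathcomp Require Import all_classical all_reals all_analysis.
From mathcomp Require Import measurable_realfun complex ring lra.

(** The operator acts on test functions as a real second order differential operator: splitting
    w = u + i v, the real and imaginary parts of P w are L u + B v and L v - B u, where
    L = - d_j (g_jk d_k) + q with g = 1 + a and q close to - <x>^(2 alpha), and B is the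
    symmetrised first order part ([repulsiveE]).  The Weyl formula is turned into this form by
    Fourier inversion ([weylE]), since multiplication by xi is a derivative in y.

    Compactness comes from two a priori estimates on test functions, in terms of the integral
    of |w|^2 + |P w|^2.
    - The gradient is controlled with the weight <x>^(-2 alpha) ([gradient_estimate]): pairing P w
      with <x>^(-2 alpha) w makes the potential a bounded term, and the principal part is
      coercive.  Coercivity everywhere is deduced from the nondegeneracy at each point by going
      to infinity, where the metric tends to the Euclidean one ([princ_elliptic]).
    - The mass is controlled with the growing weight <x>^(alpha - 1 - delta)
      ([decay_estimate]).  A classical particle in the potential - <x>^(2 alpha) reaches infinity
      in finite time because alpha > 1, and x.xi <x>^(-1-alpha) (2 - <x>^(-delta)) is a symbol
      that is bounded on the energy surface and, up to lower order terms, grows along the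
      trajectories at a rate of at least delta <x>^(alpha - 1 - delta).  Pairing P w with the
      corresponding first order operator applied to w, corrected by a zeroth order one, gives an
      identity of Rellich type whose main terms have a sign; all the others are of lower order,
      because the perturbation is smaller by <x>^(-mu) with 2 delta <= mu.

    Choosing delta so that alpha - 1 - delta > 0, these bounds give compactness: the second one
    excludes escape of mass to infinity, and the first one gives local H^1 bounds, to
    which the Rellich argument applies.  The latter rests on a Poincare inequality with finitely
    many functionals ([cube_poincare]), and an ultrafilter makes all these functionals converge
    at once ([ultra_L2_cauchy]).  Finally a bounded sequence of the minimal domain is
    replaced by test functions that are closer and closer in graph norm, and the limit is found by
    completeness of L^2 ([rapidly_cauchy_cvg]). *)

Set Implicit Arguments.
Unset Strict Implicit.
Unset Printing Implicit Defensive.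

Import Order.TTheory GRing.Theory Num.Theory.
Import numFieldNormedType.Exports.
Local Open Scope classical_set_scope.
Local Open Scope ring_scope.

(** * Smooth functions of several variables *)

Section line.
Context {R : realType} {V : normedModType R}.
Implicit Types (f : V -> R) (x v : V).

(** A directional derivative is an ordinary derivative along the line, so that the one-variable
    calculus, in particular the chain rule and the mean value theorem, applies. *)
Lemma is_derive_lineP f x v d :
  is_derive x v f d <-> is_derive (0:R) (1:R) (fun h : R => f (h *: v + x)) d.
Proof.
have E : (fun h : R => h^-1 *: ((f \o shift x) (h *: v) - f x)) =
  (fun h : R => h^-1 *: (((fun h : R => f (h *: v + x)) \o shift 0) (h *: 1) -
     (fun h : R => f (h *: v + x)) 0)).
  by apply/funext => h /=; rewrite addr0 scale0r add0r /GRing.scale /= mulr1.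
by split=> -[]; rewrite /derivable /derive ?E -?E => h1 h2; split;
  rewrite /derivable /derive ?E -?E.
Qed.

Lemma is_derive_toline f x v d :
  is_derive x v f d -> is_derive (0:R) (1:R) (fun h : R => f (h *: v + x)) d.
Proof. by move/is_derive_lineP. Qed.

Lemma is_derive_line f y v (s : R) : derivable f (s *: v + y) v ->
  is_derive s (1:R) (fun t : R => f (t *: v + y)) ('D_v f (s *: v + y)).
Proof.
move=> df.
have /is_derive_lineP : is_derive (s *: v + y) v f ('D_v f (s *: v + y)) by split.
rewrite (_ : (fun h : R => _) = (fun h : R => f ((h *: (1 : R) + s) *: v + y))); last first.
  by apply/funext => h; rewrite addrA -scalerDl /GRing.scale/= mulr1.
move=> H; have [h1 h2] := H; rewrite /derivable /derive in h1 h2.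
rewrite /= in h1 h2.
have E : (fun h : R => h^-1 *: (f (((h *: 1 + 0) *: 1 + s) *: v + y) - f ((0 *: 1 + s) *: v + y))) =
  (fun h : R => h^-1 *: (f ((h *: 1 + s) *: v + y) - f (s *: v + y))).
  by apply/funext => h; rewrite scale0r !addr0 add0r /GRing.scale/= !mulr1.
rewrite E in h1 h2; split; rewrite /derivable /derive /=; first exact: h1.
exact: h2.
Qed.
End line.

Section Ck.
Context {R : realType} {n : nat}.
Implicit Types (f g : 'rV[R]_n -> R).
Local Notation e_ i := (delta_mx 0 i : 'rV[R]_n).

(** Smoothness quantifies over sequences of directions; differentiability up to a finite order
    is the form on which products and compositions are handled by induction. *)
Fixpoint Ck (k : nat) f : Prop := continuous f /\
  if k is k'.+1 then
    forall i, (forall x, derivable f x (e_ i)) /\ Ck k' (partial i f)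
  else True.

Lemma smooth_partial f i : smooth f -> smooth (partial i f).
Proof. by move=> sf s; rewrite -foldr_rcons; exact: sf. Qed.

Lemma smooth_continuous f : smooth f -> continuous f.
Proof. by move=> /(_ [::]) []. Qed.

Lemma smooth_derivable f i x : smooth f -> derivable f x (e_ i).
Proof. by move=> /(_ [::]) []. Qed.

Lemma smoothP f : smooth f <-> forall k, Ck k f.
Proof.
split=> [sf k|Cf s].
  elim: k f sf => [|k IH] f sf /=; split=> //; try exact: smooth_continuous.
  move=> i; split=> [x|]; first exact: smooth_derivable.
  by apply: IH; exact: smooth_partial.
elim/last_ind: s f Cf => [|s i IH] f Cf /=.
  by have [? d] := Cf 1%N; split=> // i x; have [+ _] := d i; exact.
rewrite foldr_rcons; apply: IH => k.
by have [_ /(_ i)[]] := Cf k.+1.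
Qed.

Lemma CkW k f : Ck k.+1 f -> Ck k f.
Proof.
elim: k f => [|k IH] f [cf df]; split=> // i.
by have [d c] := df i; split=> //; exact: IH.
Qed.

Lemma partial_derive f i x d : is_derive x (e_ i) f d -> partial i f x = d.
Proof. by move=> h; exact: derive_val. Qed.

Lemma partialD_at f g i x : derivable f x (e_ i) -> derivable g x (e_ i) ->
  partial i (fun x => f x + g x) x = partial i f x + partial i g x.
Proof. by move=> df dg; apply: partial_derive; exact: is_deriveD. Qed.

Lemma partialM_at f g i x : derivable f x (e_ i) -> derivable g x (e_ i) ->
  partial i (fun x => f x * g x) x = partial i f x * g x + f x * partial i g x.
Proof.
move=> df dg; rewrite addrC [_ * g x]mulrC; apply: partial_derive; exact: is_deriveM.
Qed.

Lemma CkD k f g : Ck k f -> Ck k g -> Ck k (fun x => f x + g x).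
Proof.
elim: k f g => [|k IH] f g [cf df] [cg dg].
  by split=> // x; exact: (continuousD (cf x) (cg x)).
split=> [x|i]; first by exact: (continuousD (cf x) (cg x)).
have [df1 df2] := df i; have [dg1 dg2] := dg i; split=> [x|].
  by apply: derivableD.
have -> : partial i (fun x => f x + g x) = fun x => partial i f x + partial i g x.
  by apply/funext => x; rewrite partialD_at.
exact: IH.
Qed.

Lemma CkM k f g : Ck k f -> Ck k g -> Ck k (fun x => f x * g x).
Proof.
elim: k f g => [|k IH] f g Cf Cg; have [cf df] := Cf; have [cg dg] := Cg.
  by split=> // x; exact: (continuousM (cf x) (cg x)).
split=> [x|i]; first by exact: (continuousM (cf x) (cg x)).
have [df1 df2] := df i; have [dg1 dg2] := dg i; split=> [x|].
  by apply: derivableM.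
have -> : partial i (fun x => f x * g x) = fun x => partial i f x * g x + f x * partial i g x.
  by apply/funext => x; rewrite partialM_at.
by apply: CkD; apply: IH => //; exact: CkW.
Qed.

Lemma smoothD f g : smooth f -> smooth g -> smooth (fun x => f x + g x).
Proof. by move=> /smoothP sf /smoothP sg; apply/smoothP => k; exact: CkD. Qed.

Lemma smoothM f g : smooth f -> smooth g -> smooth (fun x => f x * g x).
Proof. by move=> /smoothP sf /smoothP sg; apply/smoothP => k; exact: CkM. Qed.

Lemma partial_cst (c : R) i : partial i (fun _ : 'rV[R]_n => c) = fun=> 0.
Proof. by apply/funext => x; apply: partial_derive; exact: is_derive_cst. Qed.

Lemma smooth_cst (c : R) : smooth (fun _ : 'rV[R]_n => c).
Proof.
apply/smoothP => k; elim: k c => [|k IH] c; split=> //; try exact: cst_continuous.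
move=> i; split=> [x|]; first exact: derivable_cst.
rewrite partial_cst; exact: IH.
Qed.

Lemma is_derive_coord x i j : is_derive x (e_ j) (fun x : 'rV[R]_n => x 0 i) (i == j)%:R.
Proof.
apply/is_derive_lineP.
rewrite (_ : (fun h : R => _) = (fun h : R => h * (i == j)%:R + x 0 i)); last first.
  by apply/funext => h; rewrite !mxE/= .
by apply: is_derive_eq; rewrite /GRing.scale/= ?(mulr0,addr0,mulr1,mul1r,add0r).
Qed.

Lemma partial_coord i j : partial j (fun x : 'rV[R]_n => x 0 i) = fun=> (i == j)%:R.
Proof. by apply/funext => x; apply: partial_derive; exact: is_derive_coord. Qed.

Lemma smooth_coord i : smooth (fun x : 'rV[R]_n => x 0 i).
Proof.
apply/smoothP => -[|k]; split=> //; try exact: coord_continuous.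
move=> j; split=> [x|]; first by have [] := is_derive_coord x i j.
by rewrite partial_coord; move: k; apply/smoothP; exact: smooth_cst.
Qed.

Lemma partialD f g i : smooth f -> smooth g ->
  partial i (fun x => f x + g x) = fun x => partial i f x + partial i g x.
Proof. by move=> sf sg; apply/funext => x; rewrite partialD_at//; exact: smooth_derivable. Qed.

Lemma partialM f g i : smooth f -> smooth g ->
  partial i (fun x => f x * g x) = fun x => partial i f x * g x + f x * partial i g x.
Proof. by move=> sf sg; apply/funext => x; rewrite partialM_at//; exact: smooth_derivable. Qed.

Lemma smoothZ (c : R) f : smooth f -> smooth (fun x => c * f x).
Proof. by apply: smoothM; exact: smooth_cst. Qed.

Lemma partialZ (c : R) f i : smooth f -> partial i (fun x => c * f x) = fun x => c * partial i f x.
Proof.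
move=> sf; rewrite partialM//; last exact: smooth_cst.
by rewrite partial_cst; apply/funext => x; rewrite mul0r add0r.
Qed.

Lemma smoothN f : smooth f -> smooth (fun x => - f x).
Proof.
move=> sf; rewrite (_ : (fun x => - f x) = (fun x => -1 * f x)); first exact: smoothZ.
by apply/funext => x; rewrite mulN1r.
Qed.

Lemma partialN f i : smooth f -> partial i (fun x => - f x) = fun x => - partial i f x.
Proof.
move=> sf; rewrite (_ : (fun x => - f x) = (fun x => -1 * f x)) ?partialZ//.
  by apply/funext => x; rewrite mulN1r.
by apply/funext => x; rewrite mulN1r.
Qed.

Lemma smoothB f g : smooth f -> smooth g -> smooth (fun x => f x - g x).
Proof. by move=> sf sg; apply: smoothD => //; exact: smoothN. Qed.

Lemma partialB f g i : smooth f -> smooth g ->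
  partial i (fun x => f x - g x) = fun x => partial i f x - partial i g x.
Proof. by move=> sf sg; rewrite partialD ?partialN//; exact: smoothN. Qed.

Lemma smooth_sum (I : Type) (r : seq I) (P : pred I) (F : I -> 'rV[R]_n -> R) :
  (forall i, smooth (F i)) -> smooth (fun x => \sum_(i <- r | P i) F i x).
Proof.
move=> sF; elim: r => [|a r IH].
  by under eq_fun do rewrite big_nil; exact: smooth_cst.
under eq_fun do rewrite big_cons; case: (P a) => //; exact: smoothD.
Qed.

Lemma partial_sum (I : Type) (r : seq I) (P : pred I) (F : I -> 'rV[R]_n -> R) i :
  (forall i, smooth (F i)) -> partial i (fun x => \sum_(j <- r | P j) F j x) =
  fun x => \sum_(j <- r | P j) partial i (F j) x.
Proof.
move=> sF; elim: r => [|a r IH].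
  under eq_fun do rewrite big_nil; rewrite partial_cst.
  by apply/funext => x; rewrite big_nil.
under eq_fun do rewrite big_cons; under [RHS]eq_fun do rewrite big_cons.
case: (P a) => //; rewrite partialD//; last exact: smooth_sum.
by rewrite IH.
Qed.

(** The chain rule for a class D of one-variable functions stable under differentiation: powers on
    one hand, combinations of sine and cosine on the other hand. *)
Lemma smooth_comp (D : set (R -> R)) f : smooth f ->
  (forall phi, D phi -> exists2 psi, D psi &
     forall x, is_derive (f x) 1 phi (psi (f x))) ->
  forall phi, D phi -> smooth (fun x => phi (f x)) /\
  forall (psi : R -> R) i, (forall x, is_derive (f x) 1 phi (psi (f x))) ->
   partial i (fun x => phi (f x)) = fun x => psi (f x) * partial i f x.
Proof.
move=> sf DD phi Dphi.
have dcomp (p q : R -> R) : (forall x, is_derive (f x) 1 p (q (f x))) ->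
  forall i x, is_derive x (e_ i) (fun x => p (f x)) (q (f x) * partial i f x).
  move=> h i x; apply/is_derive_lineP.
  have H : is_derive (0:R) 1 (fun h : R => f (h *: e_ i + x)) (partial i f x).
    by apply: is_derive_toline; apply: derivableP; exact: smooth_derivable.
  have := @is_derive1_comp R p (fun h : R => f (h *: e_ i + x)) 0 (q (f x)) (partial i f x) _ H.
  by apply; rewrite scale0r add0r.
split=> [|psi i h]; last by apply/funext => x; exact: (partial_derive (dcomp _ _ h i x)).
apply/smoothP => k; elim: k phi Dphi => [|k IH] phi Dphi; have [psi Dpsi hpsi] := DD _ Dphi.
  split=> // x; apply: continuous_comp; first exact: smooth_continuous.
  by apply/differentiable_continuous/derivable1_diffP; have [] := hpsi x.
split=> [x|i].
  apply: continuous_comp; first exact: smooth_continuous.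
  by apply/differentiable_continuous/derivable1_diffP; have [] := hpsi x.
have hd := dcomp _ _ hpsi.
split=> [x|]; first by have [] := hd i x.
have -> : partial i (fun x => phi (f x)) = fun x => psi (f x) * partial i f x.
  by apply/funext => x; exact: (partial_derive (hd i x)).
apply: CkM; first exact: IH.
by move: k {IH}; apply/smoothP; exact: smooth_partial.
Qed.

Lemma is_derive_affine f (c : R) (z : 'rV[R]_n) i x : derivable f (c *: x + z) (e_ i) ->
  is_derive x (e_ i) (fun x => f (c *: x + z)) (c * partial i f (c *: x + z)).
Proof.
move=> df; apply/is_derive_lineP.
have H := is_derive_line (_ : derivable f (0 *: e_ i + (c *: x + z)) (e_ i)).
have {}H : is_derive (0:R) 1 (fun h : R => f (h *: e_ i + (c *: x + z))) (partial i f (c *: x + z)).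
  by apply: is_derive_toline.
have K : is_derive (0:R) 1 (fun h : R => c * h) c.
  by apply: is_derive_eq; rewrite /GRing.scale/= ?(mulr0,addr0,mulr1,mul1r,add0r).
have := @is_derive1_comp R (fun h : R => f (h *: e_ i + (c *: x + z))) (fun h => c * h) 0 (partial i f (c *: x + z)) c _ K.
rewrite mulr0 mulrC => /(_ H); congr is_derive.
by apply/funext => h /=; rewrite scalerDr scalerA addrA.
Qed.

Lemma affine_continuous (c : R) (z : 'rV[R]_n) : continuous (fun x : 'rV[R]_n => c *: x + z).
Proof. move=> x; apply: continuousD; [exact: scaler_continuous|exact: cst_continuous]. Qed.

Lemma smooth_affine f c z : smooth f -> smooth (fun x => f (c *: x + z)).
Proof.
have ct (g : 'rV[R]_n -> R) : continuous g -> continuous (fun x : 'rV[R]_n => g (c *: x + z)).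
  move=> cg x; apply: (@continuous_comp _ _ _ (fun x : 'rV[R]_n => c *: x + z) g); last exact: cg.
  exact: affine_continuous.
move=> /smoothP sf; apply/smoothP => k; move: f {sf}(sf k); elim: k => [|k IH] f [cf df].
  by split=> //; exact: ct.
split=> [|i]; first exact: ct.
have [d1 d2] := df i; split=> [x|]; first by have [] := is_derive_affine (d1 (c *: x + z)).
have -> : partial i (fun x => f (c *: x + z)) = fun x => c * partial i f (c *: x + z).
  by apply/funext => x; exact: (partial_derive (is_derive_affine (d1 _))).
apply: CkM; last exact: IH.
exact: ((smoothP _).1 (smooth_cst _) k).
Qed.

Lemma partial_affine f c z i : smooth f ->
  partial i (fun x => f (c *: x + z)) = fun x => c * partial i f (c *: x + z).
Proof.
by move=> sf; apply/funext => x; apply: (partial_derive (is_derive_affine _)); exact: smooth_derivable.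
Qed.

End Ck.

(** * Mixed derivatives, weights and slices *)

Section mvt.
Context {R : realType}.

Lemma MVT_line (f df : R -> R) (h : R) : 0 <= h -> (forall x : R, is_derive x 1 f (df x)) ->
  exists c : R, [/\ 0 <= c, c <= h & f h - f 0 = df c * h].
Proof.
move=> h0 dF.
have cf : {within `[0, h], continuous f}.
  apply: continuous_subspaceT => x; apply: differentiable_continuous; apply/derivable1_diffP.
  by have [] := dF x.
have [c + E] := @MVT_segment R f df 0 h h0 (fun x _ => dF x) cf.
rewrite in_itv/= => /andP[c0 ch]; exists c; split=> //.
by rewrite E subr0.
Qed.
End mvt.

Section clairaut.
Context {R : realType} {n : nat}.
Implicit Types (f g : 'rV[R]_n -> R).
Local Notation e_ i := (delta_mx 0 i : 'rV[R]_n).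

Lemma is_derive_dir f i y (s : R) : smooth f ->
  is_derive s 1 (fun t : R => f (t *: e_ i + y)) (partial i f (s *: e_ i + y)).
Proof. by move=> sf; apply: is_derive_line; exact: smooth_derivable. Qed.

(** Two applications of the mean value theorem. *)
Lemma second_difference f x i j (h : R) : smooth f -> 0 <= h ->
  exists s t : R, [/\ 0 <= s <= h, 0 <= t <= h &
  f (h *: e_ i + (h *: e_ j + x)) - f (h *: e_ i + x) - (f (h *: e_ j + x) - f x) =
  h ^+ 2 * partial j (partial i f) (t *: e_ j + (s *: e_ i + x))].
Proof.
move=> sf h0.
have d1 y := fun s => is_derive_dir i y s sf.
have [s [s0 sh E]] := @MVT_line R
  (fun s => f (s *: e_ i + (h *: e_ j + x)) - f (s *: e_ i + x))
  (fun s => partial i f (s *: e_ i + (h *: e_ j + x)) - partial i f (s *: e_ i + x))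
  h h0 (fun s => is_deriveB _ _).
rewrite !scale0r !add0r in E; rewrite E.
have [t [t0 th E2]] := @MVT_line R (fun t => partial i f (t *: e_ j + (s *: e_ i + x)))
  (fun t => partial j (partial i f) (t *: e_ j + (s *: e_ i + x))) h h0
  (fun t => is_derive_dir j _ t (smooth_partial i sf)).
exists s, t; split; rewrite ?s0 ?t0//.
move: E2; rewrite scale0r add0r (addrCA (h *: e_ j)) => ->; ring.
Qed.

(** Both mixed derivatives are limits of the same second difference quotient. *)
Lemma partialC f i j : smooth f -> partial i (partial j f) = partial j (partial i f).
Proof.
move=> sf; apply/funext => x; apply/eqP; rewrite -subr_eq0 -normr_le0.
apply/ler_addgt0Pr => e e0; rewrite add0r.
have near_x g : smooth g -> exists2 d : R, 0 < d & forall s t : R, 0 <= s <= d ->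
    0 <= t <= d -> forall i j, `|g x - g (t *: e_ j + (s *: e_ i + x))| < e / 2.
  move=> /smooth_continuous /(_ x) /cvgrPdist_lt /(_ (e / 2)).
  rewrite divr_gt0// => /(_ isT) /nbhs_ballP[d /= d0 H].
  exists (d / 3) => [|s t /andP[s0 sd] /andP[t0 td] k l]; first by rewrite divr_gt0.
  apply: H; split=> // p q; rewrite /ball/= !mxE !ord1 eqxx /=.
  rewrite addrA opprD addrCA subrr addr0 normrN.
  rewrite (le_lt_trans (ler_normD _ _))// !normrM !(@ger0_norm _ s, @ger0_norm _ t)//.
  have b (b : bool) : `|b%:R : R| <= 1 by case: b; rewrite ?normr1 ?normr0.
  apply: (@le_lt_trans _ _ (d / 3 + d / 3)); last lra.
  by apply: lerD; rewrite -[leRHS]mulr1; apply: ler_pM.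
have [d1 d10 H1] := near_x _ (smooth_partial i (smooth_partial j sf)).
have [d2 d20 H2] := near_x _ (smooth_partial j (smooth_partial i sf)).
pose h := Num.min d1 d2.
have h0 : 0 < h by rewrite lt_min d10 d20.
have hd1 : h <= d1 by rewrite ge_min lexx.
have hd2 : h <= d2 by rewrite ge_min lexx orbT.
have [s [t [/andP[s0 sh] /andP[t0 th] E]]] := second_difference x i j sf (ltW h0).
have [s' [t' [/andP[s0' sh'] /andP[t0' th'] E']]] := second_difference x j i sf (ltW h0).
move: E'; rewrite (addrCA (h *: e_ j)).
have sw (p q r z : R) : p - q - (r - z) = p - r - (q - z) by ring.
rewrite sw E => /mulfI E'.
have {}E' := E' (lt0r_neq0 (exprn_gt0 _ h0)).
have A1 : `|partial i (partial j f) x - partial i (partial j f) (t' *: e_ i + (s' *: e_ j + x))| < e / 2.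
  by apply: H1; rewrite ?s0' ?t0'/=; [exact: le_trans sh' hd1|exact: le_trans th' hd1].
have A2 : `|partial j (partial i f) x - partial j (partial i f) (t *: e_ j + (s *: e_ i + x))| < e / 2.
  by apply: H2; rewrite ?s0 ?t0/=; [exact: le_trans sh hd2|exact: le_trans th hd2].
rewrite -E' in A1; apply: ltW.
rewrite (splitr e); apply: le_lt_trans (ler_distD _ _ _) (ltrD A1 _).
rewrite distrC; exact: A2.
Qed.

Lemma smooth_cos f : smooth f -> smooth (fun x => cos (f x)) /\
  forall i, partial i (fun x => cos (f x)) = fun x => - sin (f x) * partial i f x.
Proof.
move=> sf.
pose D := [set phi : R -> R | exists a b, phi = fun t => a * cos t + b * sin t].
have DD phi : D phi -> exists2 psi, D psi & forall x, is_derive (f x) 1 phi (psi (f x)).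
  move=> [a [b ->]]; exists (fun t => b * cos t + - a * sin t); first by exists b, (- a).
  by move=> x; apply: is_derive_eq; rewrite /GRing.scale/=; ring.
have [|S dS] := smooth_comp sf DD (phi := cos).
  by exists 1, 0; apply/funext => t; ring.
split=> // i; exact: (dS (fun t => - sin t) i (fun x => is_derive_cos _)).
Qed.

End clairaut.

Section weight.
Context {R : realType} {n : nat}.
Implicit Types (x : 'rV[R]_n) (m : R).
Local Notation e_ i := (delta_mx 0 i : 'rV[R]_n).

Definition jap2 x : R := 1 + dotp x x.
(** This is <x>^m; the power of a polynomial, rather than of a square root, makes smoothness
    immediate. *)
Definition wgt m x : R := jap2 x `^ (m / 2).

Lemma dotp_ge0 x : 0 <= dotp x x.
Proof. by rewrite /dotp; apply: sumr_ge0 => i _; rewrite -expr2 sqr_ge0. Qed.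

Lemma jap2_ge1 x : 1 <= jap2 x. Proof. by rewrite lerDl dotp_ge0. Qed.
Lemma jap2_gt0 x : 0 < jap2 x. Proof. exact: lt_le_trans (jap2_ge1 x). Qed.
Lemma wgt_gt0 m x : 0 < wgt m x. Proof. exact: powR_gt0 (jap2_gt0 x). Qed.
Lemma wgt_ge0 m x : 0 <= wgt m x. Proof. exact: powR_ge0. Qed.
Lemma wgt0 x : wgt 0 x = 1. Proof. by rewrite /wgt mul0r powRr0. Qed.
Lemma wgtD m p x : wgt (m + p) x = wgt m x * wgt p x.
Proof.
by rewrite /wgt mulrDl powRD//; apply/implyP => _; rewrite gt_eqF// jap2_gt0.
Qed.
Lemma wgt2 x : wgt 2 x = jap2 x.
Proof. by rewrite /wgt divff// powRr1// ltW// jap2_gt0. Qed.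
Lemma ler_wgt m p x : m <= p -> wgt m x <= wgt p x.
Proof. by move=> mp; apply: ler_powR; rewrite ?jap2_ge1// ler_pM2r. Qed.
Lemma wgt_le1 m x : m <= 0 -> wgt m x <= 1.
Proof. by move/(ler_wgt x); rewrite wgt0. Qed.
Lemma japanese_wgt m x : japanese x `^ m = wgt m x.
Proof.
rewrite /japanese /enorm sqr_sqrtr ?dotp_ge0// -powR12_sqrt ?ltW ?jap2_gt0//.
by rewrite -powRrM mulrC.
Qed.
Lemma wgt1_sqr x : wgt 1 x ^+ 2 = jap2 x.
Proof. by rewrite expr2 -wgtD -wgt2. Qed.
Lemma coord_le_wgt x i : `|x 0 i| <= wgt 1 x.
Proof.
rewrite -(@ler_pXn2r _ 2) ?nnegrE ?wgt_ge0// wgt1_sqr real_normK ?num_real//.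
rewrite /jap2 /dotp (bigD1 i)//= addrCA lerDl addr_ge0// sumr_ge0// => j _.
by rewrite -expr2 sqr_ge0.
Qed.

Lemma smooth_dotp (x : 'rV[R]_n) : smooth (fun y => dotp x y).
Proof. by apply: smooth_sum => i; apply: smoothZ; exact: smooth_coord. Qed.

Lemma partial_dotp (x : 'rV[R]_n) i : partial i (fun y => dotp x y) = fun=> x 0 i.
Proof.
rewrite partial_sum => [|j]; last by apply: smoothZ; exact: smooth_coord.
apply/funext => y; rewrite (bigD1 i)//= big1 => [|j /negbTE ji].
  by rewrite partialZ ?partial_coord ?eqxx ?mulr1 ?addr0//; exact: smooth_coord.
by rewrite partialZ ?partial_coord ?ji ?mulr0//; exact: smooth_coord.
Qed.

Lemma smooth_jap2 : smooth jap2.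
Proof.
apply: smoothD; first exact: smooth_cst.
by apply: smooth_sum => i; apply: smoothM; exact: smooth_coord.
Qed.

Lemma partial_jap2 i : partial i jap2 = fun x => 2 * x 0 i.
Proof.
have sc j : smooth (fun x : 'rV[R]_n => x 0 j * x 0 j).
  by apply: smoothM; exact: smooth_coord.
rewrite partialD; [|exact: smooth_cst|exact: smooth_sum].
rewrite partial_cst partial_sum//; apply/funext => x; rewrite add0r (bigD1 i)//= big1 => [|j /negbTE ji].
  by rewrite partialM; [rewrite partial_coord eqxx mul1r mulr1 addr0 mulr_natl mulr2n|exact: smooth_coord..].
by rewrite partialM; [rewrite partial_coord ji mul0r mulr0 addr0|exact: smooth_coord..].
Qed.

Lemma smooth_wgt_partial m : smooth (wgt m) /\
  forall i, partial i (wgt m) = fun x => m * x 0 i * wgt (m - 2) x.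
Proof.
pose D := [set phi : R -> R | exists a p, phi = fun t => a * t `^ p].
have dp (a p : R) x : is_derive (jap2 x) 1 (fun t => a * t `^ p) (a * p * jap2 x `^ (p - 1)).
  have H := is_derive1_powR p (jap2_gt0 x).
  by apply: is_derive_eq; rewrite /GRing.scale/=; ring.
have DD phi : D phi -> exists2 psi, D psi & forall x, is_derive (jap2 x) 1 phi (psi (jap2 x)).
  move=> [a [p ->]].
  by exists (fun t => a * p * t `^ (p - 1)); [exists (a * p), (p - 1)|move=> x; exact: dp].
have [|S dS] := smooth_comp smooth_jap2 DD (phi := fun t => 1 * t `^ (m / 2)).
  by exists 1, (m / 2).
have E : (fun x => 1 * jap2 x `^ (m / 2)) = wgt m by apply/funext => x; rewrite mul1r.
rewrite E in S dS; split=> // i.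
rewrite (dS (fun t => 1 * (m / 2) * t `^ (m / 2 - 1)) i (fun x => dp _ _ x)).
apply/funext => x; rewrite partial_jap2 /wgt mulrBl divff// mul1r; lra.
Qed.
Lemma smooth_wgt m : smooth (wgt m). Proof. by have [] := smooth_wgt_partial m. Qed.
Lemma partial_wgt m i : partial i (wgt m) = fun x => m * x 0 i * wgt (m - 2) x.
Proof. by have [_] := smooth_wgt_partial m; exact. Qed.
End weight.

Section slices.
Context {R : realType} {n : nat}.
Implicit Types (F : 'rV[R]_n.+1 -> R) (t : R) (y : 'rV[R]_n).

Lemma rV_cons0 t y : rV_cons (t, y) = t *: delta_mx 0 ord0 + rV_cons (0, y).
Proof.
apply/rowP => k; rewrite !mxE eqxx/=.
by case: unliftP => [j|] -> /=; rewrite ?mulr0 ?add0r ?mulr1 ?addr0 ?eqxx// (negbTE (neq_lift _ _)) mulr0 add0r.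
Qed.

Lemma rV_cons_shift t h j y :
  rV_cons (t, h *: delta_mx 0 j + y) = h *: delta_mx 0 (lift ord0 j) + rV_cons (t, y).
Proof.
apply/rowP => k; rewrite !mxE eqxx/=.
case: unliftP => [i|] -> /=; rewrite ?mxE ?eqxx/=; last by rewrite mulr0 add0r.
by rewrite (inj_eq lift_inj).
Qed.

Lemma rV_cons_affine_continuous t : continuous (fun y : 'rV[R]_n => rV_cons (t, y)).
Proof.
move=> y A /nbhs_ballP[e /= e0 HA]; apply/nbhs_ballP; exists e => //= z [_ H].
apply: HA; split=> // i j; rewrite /ball/= !mxE.
case: unliftP => [k|] _ /=; last by rewrite subrr normr0.
by have := H 0 k; rewrite /ball/=.
Qed.

(** Slices in the first variable have literally the same difference quotients, so that derivability
    transfers without any computation. *)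
Lemma quotient_slice F t y j :
  (fun h : R => h^-1 *: (((fun y => F (rV_cons (t, y))) \o shift y) (h *: delta_mx 0 j)
     - F (rV_cons (t, y)))) =
  (fun h : R => h^-1 *: ((F \o shift (rV_cons (t, y))) (h *: delta_mx 0 (lift ord0 j))
     - F (rV_cons (t, y)))).
Proof. by apply/funext => h /=; rewrite rV_cons_shift. Qed.

Lemma partial_slice F t j :
  partial j (fun y => F (rV_cons (t, y))) = fun y => partial (lift ord0 j) F (rV_cons (t, y)).
Proof.
by apply/funext => y; rewrite /partial /derive quotient_slice.
Qed.

Lemma smooth_slice F t : smooth F -> smooth (fun y => F (rV_cons (t, y))).
Proof.
move=> sF s.
have -> : foldr partial (fun y => F (rV_cons (t, y))) s =
   fun y => foldr partial F (map (lift ord0) s) (rV_cons (t, y)).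
  by elim: s => //= i s ->; rewrite partial_slice.
have sG : smooth (foldr partial F (map (lift ord0) s)).
  elim: s => [|a s IH] //=; exact: smooth_partial.
move: {s} (foldr _ _ _) sG => G sG; split=> [y|i y].
  by apply: continuous_comp; [exact: rV_cons_affine_continuous|exact: smooth_continuous].
have := smooth_derivable (i := lift ord0 i) (x := rV_cons (t, y)) sG.
by rewrite /derivable quotient_slice.
Qed.

Lemma is_derive_slice F t y : smooth F ->
  is_derive t 1 (fun t => F (rV_cons (t, y))) (partial ord0 F (rV_cons (t, y))).
Proof.
move=> sF; rewrite rV_cons0.
have -> : (fun t => F (rV_cons (t, y))) =
  (fun t => F (t *: delta_mx 0 ord0 + rV_cons (0, y))).
  by apply/funext => s; rewrite rV_cons0.
exact: is_derive_dir.
Qed.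
End slices.

(** * Real-valued integrals *)

Opaque partial.

Section real_integral.
Context d (T : measurableType d) (R : realType) (mu : {measure set T -> \bar R}).
Implicit Types F G : T -> R.

(** Integrability phrased for real-valued functions, matching the real-valued integral. *)
Definition Rsummable F := mu.-integrable [set: T] (EFin \o F).

Lemma Rsummable_measurable F : Rsummable F -> measurable_fun setT F.
Proof. by move=> /measurable_int/measurable_EFinP. Qed.

Lemma eq_Rsummable F G : F =1 G -> Rsummable F -> Rsummable G.
Proof. by move=> /funext ->. Qed.

Lemma Rsummable_dom G F : measurable_fun setT F -> Rsummable G ->
  (forall x, `|F x| <= G x) -> Rsummable F.
Proof.
move=> mF iG FG; apply: (le_integrable measurableT) iG; first exact/measurable_EFinP.
by move=> x _ /=; rewrite lee_fin (le_trans (FG x))// ler_norm.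
Qed.

Lemma RsummableD F G : Rsummable F -> Rsummable G -> Rsummable (fun x => F x + G x).
Proof. by move=> iF iG; exact: (integrableD measurableT iF iG). Qed.

Lemma RsummableZ (c : R) F : Rsummable F -> Rsummable (fun x => c * F x).
Proof. by move=> iF; exact: (integrableZl measurableT c iF). Qed.

Lemma RsummableN F : Rsummable F -> Rsummable (fun x => - F x).
Proof. by move=> iF; exact: (integrableN iF). Qed.

Lemma RsummableB F G : Rsummable F -> Rsummable G -> Rsummable (fun x => F x - G x).
Proof. by move=> iF iG; apply: RsummableD => //; exact: RsummableN. Qed.

Lemma Rsummable0 : Rsummable (fun=> 0).
Proof. exact: integrable0. Qed.

Lemma Rsummable_sum (I : Type) (r : seq I) (P : pred I) (F : I -> T -> R) :
  (forall i, Rsummable (F i)) -> Rsummable (fun x => \sum_(i <- r | P i) F i x).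
Proof.
move=> iF; elim: r => [|a r IH].
  by apply: eq_Rsummable Rsummable0 => x; rewrite big_nil.
case Pa : (P a).
  by apply: eq_Rsummable (RsummableD (iF a) IH) => x; rewrite big_cons Pa.
by apply: eq_Rsummable IH => x; rewrite big_cons Pa.
Qed.

Lemma Rsummable_norm F : Rsummable F -> Rsummable (fun x => `|F x|).
Proof.
move=> iF; apply: (le_integrable measurableT _ _ iF) => [|x _ /=].
  apply/measurable_EFinP/measurableT_comp => //; exact: Rsummable_measurable.
by rewrite normr_id.
Qed.

Lemma RsummableM_bounded (K : R) F G : measurable_fun setT F -> (forall x, `|F x| <= K) ->
  Rsummable G -> Rsummable (fun x => F x * G x).
Proof.
move=> mF FK iG; apply: (@Rsummable_dom (fun x => K * `|G x|)).
- by apply: measurable_funM => //; exact: Rsummable_measurable.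
- exact/RsummableZ/Rsummable_norm.
- by move=> x; rewrite normrM ler_wpM2r.
Qed.

Lemma RintD F G : Rsummable F -> Rsummable G ->
  \int[mu]_x (F x + G x) = \int[mu]_x F x + \int[mu]_x G x.
Proof. by move=> iF iG; rewrite RintegralD. Qed.

Lemma RintZ (c : R) F : Rsummable F -> \int[mu]_x (c * F x) = c * \int[mu]_x F x.
Proof. by move=> iF; rewrite RintegralZl. Qed.

Lemma RintN F : Rsummable F -> \int[mu]_x (- F x) = - \int[mu]_x F x.
Proof.
by move=> iF; rewrite -mulN1r -RintZ//; apply: eq_Rintegral => x _; rewrite mulN1r.
Qed.

Lemma RintB F G : Rsummable F -> Rsummable G ->
  \int[mu]_x (F x - G x) = \int[mu]_x F x - \int[mu]_x G x.
Proof. by move=> iF iG; rewrite RintD ?RintN//; exact: RsummableN. Qed.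

Lemma Rint0 : \int[mu]_x (0 : R) = 0.
Proof. by rewrite /Rintegral integral0. Qed.

Lemma Rint_sum (I : Type) (r : seq I) (P : pred I) (F : I -> T -> R) :
  (forall i, Rsummable (F i)) ->
  \int[mu]_x (\sum_(i <- r | P i) F i x) = \sum_(i <- r | P i) \int[mu]_x F i x.
Proof.
move=> iF; elim: r => [|a r IH].
  by rewrite big_nil -[RHS]Rint0; apply: eq_Rintegral => x _; rewrite big_nil.
rewrite big_cons -IH; under eq_Rintegral do rewrite big_cons.
by case: (P a) => //; rewrite RintD//; exact: Rsummable_sum.
Qed.

Lemma Rint_le F G : Rsummable F -> Rsummable G -> (forall x, F x <= G x) ->
  \int[mu]_x F x <= \int[mu]_x G x.
Proof. by move=> iF iG FG; apply: le_Rintegral. Qed.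

Lemma Rint_ge0 F : (forall x, 0 <= F x) -> 0 <= \int[mu]_x F x.
Proof. by move=> F0; apply: Rintegral_ge0. Qed.

Lemma Rint_norm F : Rsummable F -> `|\int[mu]_x F x| <= \int[mu]_x `|F x|.
Proof. by move=> iF; apply: le_normr_Rintegral. Qed.

Lemma Rint_fine F : Rsummable F -> (\int[mu]_x (F x)%:E)%E = (\int[mu]_x F x)%:E.
Proof. by move=> iF; rewrite fineK//; exact: integrable_fin_num. Qed.

(** The integral of (F - t G)^2 is a nonnegative quadratic polynomial in t. *)
Lemma Rint_CS F G : measurable_fun setT F -> measurable_fun setT G ->
  Rsummable (fun x => F x ^+ 2) -> Rsummable (fun x => G x ^+ 2) ->
  Rsummable (fun x => F x * G x) /\
  (\int[mu]_x (F x * G x)) ^+ 2 <= (\int[mu]_x (F x ^+ 2)) * (\int[mu]_x (G x ^+ 2)).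
Proof.
move=> mF mG iF iG.
have iFG : Rsummable (fun x => F x * G x).
  apply: (@Rsummable_dom (fun x => F x ^+ 2 + G x ^+ 2)).
  - exact: measurable_funM.
  - exact: RsummableD.
  - move=> x; rewrite normrM -(real_normK (num_real (F x))) -(real_normK (num_real (G x))).
    have := sqr_ge0 (`|F x| - `|G x|); have := mulr_ge0 (normr_ge0 (F x)) (normr_ge0 (G x)).
    nra.
split=> //.
set a := \int[mu]_x (F x ^+ 2); set b := \int[mu]_x (F x * G x); set c := \int[mu]_x (G x ^+ 2).
have q (t : R) : 0 <= a - 2 * t * b + t ^+ 2 * c.
  rewrite -(RintZ (2 * t))// -(RintZ (t ^+ 2))// -RintB//; last exact: RsummableZ.
  rewrite -RintD//; [|apply: RsummableB => //; exact: RsummableZ|exact: RsummableZ].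
  apply: Rint_ge0 => x.
  by rewrite (_ : _ + _ = (F x - t * G x) ^+ 2) ?sqr_ge0//; ring.
have c0 : 0 <= c by apply: Rint_ge0 => x; exact: sqr_ge0.
have a0 : 0 <= a by apply: Rint_ge0 => x; exact: sqr_ge0.
move: c0; rewrite le_eqVlt => /predU1P[c0|c0].
  have [->|b0] := eqVneq b 0; first by rewrite expr0n/= -c0 mulr0.
  have := q ((a + 1) / (2 * b)); rewrite -c0 mulr0 addr0.
  have -> : 2 * ((a + 1) / (2 * b)) * b = a + 1 by field.
  lra.
have := q (b / c).
rewrite (_ : _ + _ = (a * c - b ^+ 2) / c); last by field; rewrite gt_eqF.
by rewrite pmulr_lge0 ?invr_gt0// subr_ge0.
Qed.
End real_integral.

Section measurable_rV_continuous.
Context {R : realType} {n : nat}.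

Lemma measurable_rV_box (A : 'I_n -> set R) : (forall i, measurable (A i)) ->
  measurable [set x : 'rV[R]_n | forall i, A i (x 0 i)].
Proof.
move=> mA; rewrite (_ : [set x | _] = \bigcap_(i in [set: 'I_n]) [set x : 'rV[R]_n | A i (x 0 i)]).
  apply: fin_bigcap_measurable => [|i _]; first exact: finite_finset.
  rewrite -[X in measurable X]setTI.
  by apply: (@measurable_coord_rV R n i) => //; exact: mA.
by apply/seteqP; split => x /= Bx i; [move=> _; exact: Bx|exact: Bx].
Qed.

(** The sigma-algebra is generated by the coordinates, and an open set is a countable union of boxes
    with rational centres and radii. *)
Lemma open_measurable_rV (U : set 'rV[R]_n) : open U -> measurable U.
Proof.
move=> oU.
pose B (p : 'rV[rat]_n * rat) := [set x : 'rV[R]_n | forall i, `|ratr (p.1 0 i) - x 0 i| < ratr p.2].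
pose F p := if `[< B p `<=` U >] then B p else set0.
have -> : U = \bigcup_p F p.
  apply/seteqP; split=> [x Ux|x [p _]]; last by rewrite /F; case: asboolP => // + Bx; exact.
  move: (oU) => /(_ x Ux)/nbhs_ballP[e /= e0 He].
  have [r /andP[r0 re]] := rat_in_itvoo (divr_gt0 e0 (ltr0n R 2)).
  have qx i : exists q : rat, `|ratr q - x 0 i| < ratr r.
    have [q] := @rat_in_itvoo R (x 0 i) (x 0 i + ratr r) ltac:(by rewrite ltrDl).
    rewrite in_itv/= => /andP[h1 h2]; exists q.
    by rewrite gtr0_norm ?subr_gt0// ltrBlDl.
  have [q Hq] := choice qx.
  pose c : 'rV[rat]_n := \row_i q i.
  exists (c, r) => //; rewrite /F; case: asboolP => [_|]; first by move=> i /=; rewrite mxE.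
  case=> y By; apply: He; split=> // i j; rewrite ord1 /ball/=.
  have := By j; rewrite /= mxE => H1; have H2 := Hq j.
  rewrite -(subrK (ratr (q j)) (x 0 j)) -addrA.
  rewrite (le_lt_trans (ler_normD _ _))// distrC.
  by rewrite (lt_le_trans (ltrD H2 H1))// (splitr e) lerD// ltW.
apply: countable_bigcupT_measurable => // p; rewrite /F; case: asboolP => // _.
apply: (@measurable_rV_box (fun i => [set y | `|ratr (p.1 0 i) - y| < ratr p.2])) => i.
rewrite -[X in measurable X]setTI.
have mf : measurable_fun setT (fun y : R => `|ratr (p.1 0 i) - y|).
  by apply: measurableT_comp => //; apply: measurable_funB.
have := mf measurableT `]-oo, (ratr p.2 : R)[%classic (measurable_itv _).
congr (measurable (_ `&` _)); apply/seteqP; split=> y /=; rewrite in_itv//=.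
Qed.

Lemma continuous_measurable_rV (f : 'rV[R]_n -> R) : continuous f -> measurable_fun setT f.
Proof.
move=> /continuousP cf; apply: (measurability _ (RGenOpens.measurableE R)).
move=> _ [_ [a [b ->] <-]]; rewrite setTI; apply: open_measurable_rV.
exact/cf/interval_open.
Qed.

End measurable_rV_continuous.

(** * Bounded supports and integration by parts *)

Section bounded_support.
Context {R : realType}.

Definition box n (r : R) : set 'rV[R]_n := [set x | forall i, x 0 i \in `[- r, r]].
Arguments box : clear implicits.

Lemma measurable_box n r : measurable (box n r).
Proof.
by apply: (@measurable_rV_box R n (fun=> [set` `[- r, r]])) => i; exact: measurable_itv.
Qed.

Lemma box_lty n r : (lebesgue_rV R n (box n r) < +oo)%E.
Proof.
rewrite (@lebesgue_rV_box R n (fun=> [set` `[- r, r]])) => [|i]; last exact: measurable_itv.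
have : (lebesgue_measure ([set` `[(- r)%R, r]] : set R) < +oo)%E.
  by rewrite lebesgue_measure_itv; case: ifP => _; rewrite ltry.
have : (0 <= lebesgue_measure ([set` `[(- r)%R, r]] : set R))%E by exact: measure_ge0.
move: (lebesgue_measure _) => v v0 vy.
rewrite big_const_ord; elim: n => [|n IH] /=; first by rewrite ltry.
by rewrite lte_mul_pinfty// ge0_fin_numE.
Qed.

(** Bounded measurable functions of bounded support: stable under products with
    bounded functions and under restriction to slices, and Rsummable. *)
Definition bms n (F : 'rV[R]_n -> R) := measurable_fun setT F /\
  exists K r : R, (forall x, `|F x| <= K) /\ (forall x, ~ box n r x -> F x = 0).

Lemma Rsummable_bms n (F : 'rV[R]_n -> R) : bms F -> Rsummable (lebesgue_rV R n) F.
Proof.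
move=> [mF [K [r [FK Fr]]]]; apply: (@Rsummable_dom _ _ _ _ (fun x => K * \1_(box n r) x)) => //.
- apply: RsummableZ; rewrite /Rsummable.
  apply/integrableP; split.
    by apply/measurable_EFinP/measurable_indic; exact: measurable_box.
  under eq_integral do rewrite /= ger0_norm//.
  by rewrite integral_indic// ?setIT; [exact: box_lty|exact: measurable_box].
- move=> x; have [xr|xr] := pselect (box n r x).
    by rewrite indicE mem_set// mulr1.
  by rewrite Fr// normr0 mulr_ge0// (le_trans _ (FK x)).
Qed.

Lemma Rsummable_bounded_itv (f : R -> R) (K r : R) : measurable_fun setT f ->
  (forall x, `|f x| <= K) -> (forall x, x \notin `[- r, r] -> f x = 0) ->
  Rsummable (@lebesgue_measure R) f.
Proof.
move=> mf fK fr; apply: (@Rsummable_dom _ _ R (@lebesgue_measure R) (fun x => K * \1_([set` `[- r, r]]) x)) => //.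
- by apply: RsummableZ; exact: integrable_indic_itv.
- move=> x; have [xr|xr] := boolP (x \in `[- r, r]).
    by rewrite indicE mem_set// mulr1.
  by rewrite fr// normr0 mulr_ge0// (le_trans _ (fK x)).
Qed.

Lemma bms_slice n (F : 'rV[R]_n.+1 -> R) t : bms F -> bms (fun y => F (rV_cons (t, y))).
Proof.
move=> [mF [K [r [FK Fr]]]]; split.
  apply: (measurableT_comp mF).
  apply: (measurableT_comp measurable_rV_cons).
  by apply: measurable_fun_pair => //; exact: measurable_cst.
exists K, r; split=> [y|y yr]; first exact: FK.
apply: Fr => H; apply: yr => i; have := H (lift ord0 i).
by rewrite !mxE liftK.
Qed.

(** The other slices, in the first variable. *)
Lemma bms_slice0 n (F : 'rV[R]_n.+1 -> R) y : bms F ->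
  Rsummable (@lebesgue_measure R) (fun t => F (rV_cons (t, y))).
Proof.
move=> [mF [K [r [FK Fr]]]]; apply: (@Rsummable_bounded_itv _ K r) => [|t|t tr].
- apply: (measurableT_comp mF).
  apply: (measurableT_comp measurable_rV_cons).
  by apply: measurable_fun_pair => //; exact: measurable_cst.
- exact: FK.
- by apply: Fr => /(_ ord0); rewrite mxE unlift_none/= (negbTE tr).
Qed.

Lemma Rsummable_cons n (F : 'rV[R]_n.+1 -> R) : measurable_fun setT F ->
  Rsummable (lebesgue_rV R n.+1) F ->
  Rsummable ((@lebesgue_measure R \x lebesgue_rV R n)%E) (F \o rV_cons).
Proof.
move=> mF /integrableP[_ iF]; apply/integrableP; split.
  by apply/measurable_EFinP/(measurableT_comp mF); exact: measurable_rV_cons.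
have := @ge0_integral_pushforward _ _ _ _ R _ measurable_rV_cons
  (@lebesgue_measure R \x lebesgue_rV R n)%E setT (fun x => `|(F x)%:E|%E) measurableT.
rewrite preimage_setT => H; move: iF; apply: le_lt_trans; rewrite le_eqVlt.
apply/orP; left; apply/eqP/esym; apply: H => //.
by apply: measurableT_comp => //; exact/measurable_EFinP.
Qed.

Lemma ge0_integral_cons n (F : 'rV[R]_n.+1 -> \bar R) : measurable_fun setT F ->
  (forall x, (0 <= F x)%E) ->
  (\int[lebesgue_rV R n.+1]_x F x =
   \int[lebesgue_measure]_t \int[lebesgue_rV R n]_y F (rV_cons (t, y)))%E.
Proof.
move=> mF F0.
have := @ge0_integral_pushforward _ _ _ _ R _ measurable_rV_cons
  (@lebesgue_measure R \x lebesgue_rV R n)%E setT F measurableT.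
rewrite preimage_setT => H; rewrite [LHS]H//.
rewrite (fubini_tonelli1 (F \o rV_cons))//; last by move=> x; exact: F0.
by apply: measurableT_comp => //; exact: measurable_rV_cons.
Qed.

Lemma Rint_cons n (F : 'rV[R]_n.+1 -> R) : measurable_fun setT F ->
  Rsummable (lebesgue_rV R n.+1) F ->
  (forall t, Rsummable (lebesgue_rV R n) (fun y => F (rV_cons (t, y)))) ->
  Rsummable (@lebesgue_measure R) (fun t => \int[lebesgue_rV R n]_y F (rV_cons (t, y))) /\
  \int[lebesgue_rV R n.+1]_x F x =
    \int[lebesgue_measure]_t \int[lebesgue_rV R n]_y F (rV_cons (t, y)).
Proof.
move=> mF iF sF; have iG := Rsummable_cons mF iF.
have E : fubini_F (lebesgue_rV R n) (EFin \o (F \o rV_cons)) =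
   (fun t => (\int[lebesgue_rV R n]_y F (rV_cons (t, y)))%:E).
  by apply/funext => t; rewrite /fubini_F -Rint_fine.
split; first by have := integrable_fubini_F iG; rewrite E.
have := @integral_pushforward _ _ _ _ R _ measurable_rV_cons
  (@lebesgue_measure R \x lebesgue_rV R n)%E setT (EFin \o F).
rewrite preimage_setT => H; rewrite /Rintegral; congr fine.
rewrite [LHS]H//; last exact/measurable_EFinP.
rewrite -(integral12_prod_meas1 iG) E.
by apply: eq_integral => t _; rewrite Rint_fine.
Qed.

Lemma Rint_cons_swap n (F : 'rV[R]_n.+1 -> R) : measurable_fun setT F ->
  Rsummable (lebesgue_rV R n.+1) F ->
  (forall y, Rsummable (@lebesgue_measure R) (fun t => F (rV_cons (t, y)))) ->
  \int[lebesgue_rV R n.+1]_x F x =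
    \int[lebesgue_rV R n]_y \int[lebesgue_measure]_t F (rV_cons (t, y)).
Proof.
move=> mF iF sF; have iG := Rsummable_cons mF iF.
have E : fubini_G (@lebesgue_measure R) (EFin \o (F \o rV_cons)) =
   (fun y => (\int[lebesgue_measure]_t F (rV_cons (t, y)))%:E).
  by apply/funext => t; rewrite /fubini_G -Rint_fine.
have := @integral_pushforward _ _ _ _ R _ measurable_rV_cons
  (@lebesgue_measure R \x lebesgue_rV R n)%E setT (EFin \o F).
rewrite preimage_setT => H; rewrite /Rintegral; congr fine.
rewrite [LHS]H//; last exact/measurable_EFinP.
rewrite -(integral21_prod_meas1 iG) E.
by apply: eq_integral => t _; rewrite Rint_fine.
Qed.

Lemma Rint_bms_cons n (F : 'rV[R]_n.+1 -> R) : bms F ->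
  Rsummable (@lebesgue_measure R) (fun t => \int[lebesgue_rV R n]_y F (rV_cons (t, y))) /\
  \int[lebesgue_rV R n.+1]_x F x =
    \int[lebesgue_measure]_t \int[lebesgue_rV R n]_y F (rV_cons (t, y)).
Proof.
move=> bF; have [mF _] := bF; apply: Rint_cons => //; first exact: Rsummable_bms.
by move=> t; apply/Rsummable_bms/bms_slice.
Qed.

Lemma bmsM n (F G : 'rV[R]_n -> R) (K : R) : measurable_fun setT F -> (forall x, `|F x| <= K) ->
  bms G -> bms (fun x => F x * G x).
Proof.
move=> mF FK [mG [L [s [GK Gs]]]]; split; first exact: measurable_funM.
exists (K * L), s; split=> [x|x xb]; first by rewrite normrM ler_pM.
by rewrite Gs ?mulr0.
Qed.

End bounded_support.

Arguments box {R} n r _.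

Section compact_support.
Context {R : realType}.

(** Compact support in a form that restricts to slices. *)
Definition csupp n (F : 'rV[R]_n -> R) := exists r : R, forall (x : 'rV[R]_n) i, r < `|x 0 i| -> F x = 0.
Definition csmooth1 n (F : 'rV[R]_n -> R) := smooth F /\ csupp F.

Lemma csupp_box n (F : 'rV[R]_n -> R) : csupp F ->
  exists2 r : R, 0 <= r & forall x, ~ box n r x -> F x = 0.
Proof.
move=> [r Fr]; exists (Num.max 0 r); rewrite ?le_max ?lexx// => x xb.
apply: contrapT => Fx; apply: xb => i; rewrite in_itv/= -ler_norml leNgt.
apply/negP => H; apply: Fx; apply: (Fr _ i); apply: le_lt_trans H.
by rewrite le_max lexx orbT.
Qed.

Lemma continuous_csupp_bms n (F : 'rV[R]_n -> R) : continuous F -> csupp F -> bms F.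
Proof.
move=> cF /csupp_box[r r0 Fr]; split; first exact: continuous_measurable_rV.
have cb : compact (box n r).
  exact: (@rV_compact R n (fun=> [set` `[- r, r]]) (fun i => @segment_compact _ _ _)).
have /compact_bounded[M [_ HM]] : compact (F @` box n r).
  by apply: continuous_compact => //; exact: continuous_subspaceT.
exists (Num.max 0 (M + 1)), r; split=> // x; have [xr|xr] := pselect (box n r x).
  by rewrite le_max (HM (M + 1)) ?orbT ?ltrDl//; exists x.
by rewrite Fr// normr0 le_max lexx.
Qed.

Lemma csmooth1_bms n (F : 'rV[R]_n -> R) : csmooth1 F -> bms F.
Proof. by move=> [/smooth_continuous cF sF]; exact: continuous_csupp_bms. Qed.

Lemma csmooth1_Rsummable n (F : 'rV[R]_n -> R) : csmooth1 F -> Rsummable (lebesgue_rV R n) F.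
Proof. by move/csmooth1_bms/Rsummable_bms. Qed.

Lemma csupp_partial n (F : 'rV[R]_n -> R) i : csupp F -> csupp (partial i F).
Proof.
move=> [r Fr]; exists r => x j rx.
have -> : partial i F x = partial i (fun=> 0) x; last by rewrite partial_cst.
apply: near_eq_derive; apply/nbhs_ballP; exists (`|x 0 j| - r); first by rewrite /= subr_gt0.
move=> y [_ /(_ 0 j)]; rewrite /ball/= => H; apply: (Fr _ j).
have := ler_normD (x 0 j - y 0 j) (y 0 j); rewrite subrK; lra.
Qed.

Lemma csmooth1_partial n (F : 'rV[R]_n -> R) i : csmooth1 F -> csmooth1 (partial i F).
Proof. by move=> [sF cF]; split; [exact: smooth_partial|exact: csupp_partial]. Qed.

Lemma csmooth1D n (F G : 'rV[R]_n -> R) : csmooth1 F -> csmooth1 G ->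
  csmooth1 (fun x => F x + G x).
Proof.
move=> [sF [r Fr]] [sG [s Gs]]; split; first exact: smoothD.
exists (Num.max r s) => x i; rewrite gt_max => /andP[h1 h2].
by rewrite (Fr _ i)// (Gs _ i)// addr0.
Qed.

Lemma csmooth1Ml n (F G : 'rV[R]_n -> R) : smooth F -> csmooth1 G ->
  csmooth1 (fun x => F x * G x).
Proof.
move=> sF [sG [s Gs]]; split; first exact: smoothM.
by exists s => x i h; rewrite (Gs _ i)// mulr0.
Qed.

Lemma csmooth1Mr n (F G : 'rV[R]_n -> R) : csmooth1 F -> smooth G ->
  csmooth1 (fun x => F x * G x).
Proof.
move=> [sF [s Gs]] sG; split; first exact: smoothM.
by exists s => x i h; rewrite (Gs _ i)// mul0r.
Qed.

Lemma csmooth1_0 n : csmooth1 (fun _ : 'rV[R]_n => 0).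
Proof. by split; [exact: smooth_cst|exists 0]. Qed.

Lemma csmooth1_sum n (I : Type) (s : seq I) (P : pred I) (F : I -> 'rV[R]_n -> R) :
  (forall i, csmooth1 (F i)) -> csmooth1 (fun x => \sum_(i <- s | P i) F i x).
Proof.
move=> sF; elim: s => [|a s IH].
  by under eq_fun do rewrite big_nil; exact: csmooth1_0.
under eq_fun do rewrite big_cons; case: (P a) => //; exact: csmooth1D.
Qed.

Lemma csmooth1N n (F : 'rV[R]_n -> R) : csmooth1 F -> csmooth1 (fun x => - F x).
Proof.
move=> cF; rewrite (_ : (fun x => - F x) = (fun x => -1 * F x)).
  by apply: csmooth1Ml => //; exact: smooth_cst.
by apply/funext => x; rewrite mulN1r.
Qed.

Lemma csmooth1B n (F G : 'rV[R]_n -> R) : csmooth1 F -> csmooth1 G ->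
  csmooth1 (fun x => F x - G x).
Proof. by move=> sF sG; apply: csmooth1D => //; exact: csmooth1N. Qed.

Lemma csmooth1_slice n (F : 'rV[R]_n.+1 -> R) t : csmooth1 F ->
  csmooth1 (fun y => F (rV_cons (t, y))).
Proof.
move=> [sF [r Fr]]; split; first exact: smooth_slice.
by exists r => y i h; apply: (Fr _ (lift ord0 i)); rewrite mxE liftK.
Qed.

Lemma slice0_continuous n (F : 'rV[R]_n.+1 -> R) y : smooth F ->
  continuous (fun t => F (rV_cons (t, y))).
Proof.
move=> sF t; apply: differentiable_continuous; apply/derivable1_diffP.
by have [] := is_derive_slice t y sF.
Qed.

Lemma Rint_derive0 (f df : R -> R) (r : R) : 0 < r -> (forall t : R, is_derive t 1 f (df t)) ->
  continuous df -> f r = 0 -> f (- r) = 0 -> (forall t, t \notin `[- r, r] -> df t = 0) ->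
  \int[lebesgue_measure]_t df t = 0.
Proof.
move=> r0 dF cdf fr fNr dfr.
have dfE : derive1 f = df by apply/funext => t; rewrite derive1E; have H := dF t; rewrite derive_val.
have cf : continuous f.
  by move=> t; apply: differentiable_continuous; apply/derivable1_diffP; have [] := dF t.
have := @continuous_FTC2 R df f (- r) r.
rewrite fr fNr subee// => H.
have E : (\int[@lebesgue_measure R]_t (df t)%:E =
    \int[lebesgue_measure]_(x in `[(- r)%R, r]) (df x)%:E)%E.
  rewrite [RHS]integral_mkcond; apply: eq_integral => t _; rewrite patchE.
  by case: ifPn => //; rewrite notin_setE/= => /negP/dfr ->.
rewrite /Rintegral E H//; first by lra.
- exact: continuous_subspaceT.
- split=> [t _||]; first by have [] := dF t.
    exact/cvg_at_right_filter/cf.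
  exact/cvg_at_left_filter/cf.
- by move=> t _; rewrite dfE.
Qed.

(** The fundamental theorem of calculus, one coordinate at a time. *)
Lemma Rint_partial n (F : 'rV[R]_n -> R) i : csmooth1 F ->
  \int[lebesgue_rV R n]_x partial i F x = 0.
Proof.
elim: n F i => [|n IH] F i sF; first by case: i.
have bF := csmooth1_bms (csmooth1_partial i sF).
case: (unliftP ord0 i) => [j|] E.
  have [_ ->] := Rint_bms_cons bF.
  rewrite -[RHS](@Rint0 _ _ R (@lebesgue_measure R)); apply: eq_Rintegral => t _.
  rewrite -[RHS](IH _ j (csmooth1_slice t sF)); apply: eq_Rintegral => y _.
  by rewrite partial_slice E.
have [mF _] := bF.
rewrite (Rint_cons_swap mF (Rsummable_bms bF) (fun y => bms_slice0 y bF)).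
rewrite -[RHS](@Rint0 _ _ R (lebesgue_rV R n)); apply: eq_Rintegral => y _.
have [smF [r Fr]] := sF; have [_ [s Fs]] := csmooth1_partial i sF.
pose q := Num.max 1 (Num.max (r + 1) s).
have q0 : 0 < q by rewrite lt_max ltr01.
have qr : r < q by rewrite !lt_max ltrDl ltr01 orbT.
apply: (@Rint_derive0 (fun t => F (rV_cons (t, y))) _ q) => //.
- by move=> t; rewrite E; exact: is_derive_slice.
- by apply: slice0_continuous; exact: smooth_partial.
- by apply: (Fr _ ord0); rewrite mxE unlift_none/= gtr0_norm.
- by apply: (Fr _ ord0); rewrite mxE unlift_none/= normrN gtr0_norm.
- move=> t tq; apply: (Fs _ ord0); rewrite mxE unlift_none/=.
  move: tq; rewrite in_itv/= -ler_norml -ltNge; apply: le_lt_trans.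
  by rewrite !le_max lexx !orbT.
Qed.

Lemma Rint_by_parts n (F G : 'rV[R]_n -> R) i : smooth F -> csmooth1 G ->
  \int[lebesgue_rV R n]_x (F x * partial i G x) =
  - \int[lebesgue_rV R n]_x (partial i F x * G x).
Proof.
move=> sF sG; apply/eqP; rewrite -addr_eq0 -RintD; [|apply: csmooth1_Rsummable..].
- rewrite -[X in _ == X](@Rint_partial _ (fun x => F x * G x) i); last exact: csmooth1Ml.
  have [sG1 _] := sG; apply/eqP; rewrite partialM//.
  by apply: eq_Rintegral => x _; exact: addrC.
- by apply: csmooth1Ml => //; exact: csmooth1_partial.
- by apply: csmooth1Ml => //; exact: smooth_partial.
Qed.

End compact_support.

(** * The Poisson kernel and the Fourier transform of exp (- e |x|) *)

Section two_sided.
Context {R : realType}.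
Notation leb := (@lebesgue_measure R).

(** Half-lines are treated separately because of the absolute value in the integrands below. *)
Lemma integral_two_sided (G G1 G2 F1 F2 : R -> R) (l1 l2 : R) :
  continuous G -> (forall x, 0 <= G x) -> continuous G1 -> continuous G2 ->
  (forall x, 0 <= x -> G x = G1 x) -> (forall x, 0 <= x -> G (- x) = G2 x) ->
  (forall x : R, is_derive x 1 F1 (G1 x)) -> (forall x : R, is_derive x 1 F2 (G2 x)) ->
  F1 x @[x --> +oo] --> l1 -> F2 x @[x --> +oo] --> l2 ->
  Rsummable leb G /\ \int[leb]_x G x = (l1 - F1 0) + (l2 - F2 0).
Proof.
move=> cG G0 cG1 cG2 E1 E2 d1 d2 lim1 lim2.
have mG : measurable_fun [set: R] G by exact: continuous_measurable_fun.
have half (g F : R -> R) (l : R) : continuous g -> (forall x, 0 <= x -> 0 <= g x) ->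
    (forall x : R, is_derive x 1 F (g x)) -> F x @[x --> +oo] --> l ->
    (\int[leb]_(x in `[0%R, +oo[) (g x)%:E = (l - F 0)%R%:E)%E.
  move=> cg g0 dF lF; rewrite (@ge0_continuous_FTC2y R g F 0 l)//.
  - exact: continuous_subspaceT.
  - apply: cvg_at_right_filter; apply: differentiable_continuous; apply/derivable1_diffP.
    by have [] := dF 0.
  - by move=> x _; rewrite derive1E; have H := dF x; rewrite derive_val.
have EG : (\int[leb]_x (G x)%:E = ((l1 - F1 0) + (l2 - F2 0))%R%:E)%E.
  rewrite -(setUv [set x : R | 0 <= x]%R) ge0_integral_setU//=; last 5 first.
  - by rewrite -set_itvcy.
  - by apply: measurableC; rewrite -set_itvcy.
  - by apply/measurable_EFinP; rewrite setUv.
  - by move=> x _; rewrite lee_fin.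
  - exact/disj_setPCl.
  rewrite EFinD; congr (_ + _)%E.
    rewrite -set_itvcy -(half G1)//; last by move=> x x0; rewrite -E1.
    apply: eq_integral => x; rewrite inE/= in_itv/= andbT => x0; by rewrite E1.
  rewrite -set_itvcy setCitvr.
  rewrite integral_itv_bndo_bndc; last exact/measurable_EFinP/measurable_funTS.
  rewrite -{1}oppr0 ge0_integration_by_substitutionNy//; last exact: continuous_subspaceT.
  rewrite -(half G2)//; last by move=> x x0; rewrite -E2.
  by apply: eq_integral => x; rewrite inE/= in_itv/= andbT => x0; rewrite E2.
split; last by rewrite /Rintegral EG.
apply/integrableP; split; first exact/measurable_EFinP.
under eq_integral do rewrite /= ger0_norm//.
by rewrite EG ltry.
Qed.

(** The primitive is an arctangent. *)
Lemma poisson_kernel (e a : R) : 0 < e ->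
  Rsummable leb (fun z => 2 * e / (e ^+ 2 + (a - z) ^+ 2)) /\
  \int[leb]_z (2 * e / (e ^+ 2 + (a - z) ^+ 2)) = 2 * pi.
Proof.
move=> e0.
have D0 z : 0 < e ^+ 2 + z ^+ 2 by rewrite ltr_pwDl ?exprn_gt0 ?sqr_ge0.
have cK b : continuous (fun z : R => 2 * e / (e ^+ 2 + (b - z) ^+ 2)).
  move=> z; apply: cvgM; first exact: cvg_cst.
  apply: cvgV; first by rewrite gt_eqF.
  apply: cvgD; first exact: cvg_cst.
  by apply: cvgM; apply: cvgB; [exact: cvg_cst|exact: cvg_id|exact: cvg_cst|exact: cvg_id].
have dA (b z : R) : is_derive z 1 (fun z : R => 2 * atan (e^-1 * (z - b)))
    (2 * e / (e ^+ 2 + (b - z) ^+ 2)).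
  have H := is_derive1_atan (e^-1 * (z - b)).
  apply: is_derive_eq; rewrite /GRing.scale/=.
  by field; rewrite !gt_eqF.
have lA (b : R) : 2 * atan (e^-1 * (z - b)) @[z --> +oo] --> 2 * (pi / 2).
  apply: cvgM; first exact: cvg_cst.
  apply: (@cvg_comp _ _ _ (fun z => e^-1 * (z - b)) (@atan R) +oo +oo); last exact: cvgy_atan.
  apply/cvgryPge => A; near=> z.
  rewrite mulrC ler_pdivlMr// lerBrDr; near: z; exact: nbhs_pinfty_ge (num_real _).
have [] := @integral_two_sided (fun z => 2 * e / (e ^+ 2 + (a - z) ^+ 2)) _
  (fun z => 2 * e / (e ^+ 2 + (- a - z) ^+ 2)) _ _ _ _ (cK a) _ (cK a) (cK (- a)) _ _
  (dA a) (dA (- a)) (lA a) (lA (- a)).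
- by move=> z; rewrite divr_ge0// ?mulr_ge0// ltW.
- by [].
- by move=> z z0; congr (_ / (_ + _)); rewrite -sqrrN; congr (_ ^+ 2); ring.
move=> H ->; split=> //; rewrite !sub0r opprK mulrN atanN; lra.
Unshelve. all: by end_near. Qed.

Lemma continuous_exp_abs (e : R) : continuous (fun x : R => expR (- e * `|x|)).
Proof.
move=> x; apply: (@continuous_comp _ _ _ (fun x : R => - e * `|x|) expR).
  by apply: cvgM; [exact: cvg_cst|exact: norm_continuous].
exact: continuous_expR.
Qed.

(** The integrand changes sign, and the fundamental theorem of calculus on a half-line is available
    for nonnegative functions: 1 + cos is integrated instead of cos. *)
Lemma laplace_fourier (e z t : R) : 0 < e ->
  [/\ Rsummable leb (fun x => expR (- e * `|x|)),
   Rsummable leb (fun x => cos (z * x + t) * expR (- e * `|x|)) &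
   \int[leb]_x (cos (z * x + t) * expR (- e * `|x|)) = cos t * (2 * e / (e ^+ 2 + z ^+ 2))].
Proof.
move=> e0.
have D0 w : 0 < e ^+ 2 + w ^+ 2 by rewrite ltr_pwDl ?exprn_gt0 ?sqr_ge0.
pose A (w s x : R) : R := - (e^-1) * expR (- e * x) + expR (- e * x) *
  ((- e / (e ^+ 2 + w ^+ 2)) * cos (w * x + s) + (w / (e ^+ 2 + w ^+ 2)) * sin (w * x + s)).
have dA w s (x : R) : is_derive x 1 (A w s) ((1 + cos (w * x + s)) * expR (- e * x)).
  have H1 := is_derive_cos (w * x + s); have H2 := is_derive_sin (w * x + s).
  have H3 := is_derive_expR (- e * x).
  have H4 : is_derive x 1 (fun x : R => - e * x) (- e).
    by apply: is_derive_eq; rewrite /GRing.scale/=; ring.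
  have H5 : is_derive x 1 (fun x : R => w * x + s) w.
    by apply: is_derive_eq; rewrite /GRing.scale/=; ring.
  have K1 := @is_derive1_comp R cos (fun x : R => w * x + s) x _ _ H1 H5.
  have K2 := @is_derive1_comp R sin (fun x : R => w * x + s) x _ _ H2 H5.
  have K3 := @is_derive1_comp R expR (fun x : R => - e * x) x _ _ H3 H4; rewrite /comp in K1 K2 K3.
  rewrite /A; apply: is_derive_eq; rewrite /GRing.scale/=.
  by field; rewrite !gt_eqF.
have cc w s : continuous (fun x : R => cos (w * x + s)).
  move=> x; apply: (@continuous_comp _ _ _ (fun x : R => w * x + s) cos); last exact: continuous_cos.
  by apply: cvgD; [apply: cvgM; [exact: cvg_cst|exact: cvg_id]|exact: cvg_cst].
have cE : continuous (fun x : R => expR (- e * x)).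
  move=> x; apply: (@continuous_comp _ _ _ (fun x : R => - e * x) expR); last exact: continuous_expR.
  by apply: cvgM; [exact: cvg_cst|exact: cvg_id].
have lE : expR (- e * x) @[x --> +oo] --> (0 : R).
  under eq_fun do rewrite mulNr.
  apply: (@cvg_comp _ _ _ (fun x : R => e * x) (fun x : R => expR (- x)) +oo +oo); last exact: cvgr_expR.
  apply/cvgryPge => B; near=> x.
  by rewrite mulrC -ler_pdivrMr//; near: x; exact: nbhs_pinfty_ge (num_real _).
have lA w s : A w s x @[x --> +oo] --> (0 : R).
  rewrite -[X in _ --> X]addr0 /A; apply: cvgD.
    by rewrite -[X in _ --> X](mulr0 (- e^-1)); apply: cvgM => //; exact: cvg_cst.
  pose M : R := `|- e / (e ^+ 2 + w ^+ 2)| + `|w / (e ^+ 2 + w ^+ 2)|.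
  apply: (@squeeze_cvgr _ _ _ _ (fun x => - (expR (- e * x) * M)) (fun x => expR (- e * x) * M)).
  - apply: nearW => x; rewrite -ler_norml normrM ger0_norm ?expR_ge0// ler_wpM2l ?expR_ge0//.
    rewrite (le_trans (ler_normD _ _))// !normrM -!normrM lerD// normrM -[leRHS]mulr1 ler_wpM2l//.
      by rewrite ler_norml cos_geN1 cos_le1.
    by rewrite ler_norml sin_geN1 sin_le1.
  - by rewrite -oppr0; apply: cvgN; rewrite -[X in _ --> X](mul0r M); apply: cvgM => //; exact: cvg_cst.
  - by rewrite -[X in _ --> X](mul0r M); apply: cvgM => //; exact: cvg_cst.
have main w s : Rsummable leb (fun x => (1 + cos (w * x + s)) * expR (- e * `|x|)) /\
  \int[leb]_x ((1 + cos (w * x + s)) * expR (- e * `|x|)) =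
   2 / e + cos s * (2 * e / (e ^+ 2 + w ^+ 2)).
  have [] := @integral_two_sided (fun x => (1 + cos (w * x + s)) * expR (- e * `|x|))
    (fun x => (1 + cos (w * x + s)) * expR (- e * x))
    (fun x => (1 + cos (- w * x + s)) * expR (- e * x)) _ _ _ _ _ _ _ _ _ _
   (dA w s) (dA (- w) s) (lA w s) (lA (- w) s).
  - move=> x; apply: cvgM; last exact: continuous_exp_abs.
    by apply: cvgD; [exact: cvg_cst|exact: cc].
  - by move=> x; rewrite mulr_ge0 ?expR_ge0// -lerBlDl sub0r cos_geN1.
  - by move=> x; apply: cvgM; [apply: cvgD; [exact: cvg_cst|exact: cc]|exact: cE].
  - by move=> x; apply: cvgM; [apply: cvgD; [exact: cvg_cst|exact: cc]|exact: cE].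
  - by move=> x x0; rewrite ger0_norm.
  - by move=> x x0; rewrite normrN ger0_norm// mulrN !mulNr.
  move=> H ->; split=> //; rewrite /A !mulr0 !add0r expR0 sqrrN.
  by field; rewrite !gt_eqF.
have [S0 I0] := main 0 0.
have S1 : Rsummable leb (fun x => expR (- e * `|x|)).
  apply: eq_Rsummable (RsummableZ 2^-1 S0) => x /=.
  rewrite mul0r addr0 cos0; lra.
have I1 : \int[leb]_x (expR (- e * `|x|)) = 2 / e.
  have -> : \int[leb]_x (expR (- e * `|x|)) = \int[leb]_x (2^-1 * ((1 + cos (0 * x + 0)) * expR (- e * `|x|))).
    by apply: eq_Rintegral => x _; rewrite mul0r addr0 cos0; lra.
  rewrite RintZ// I0 cos0 expr0n/= addr0; field; rewrite gt_eqF//.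
have [S2 I2] := main z t.
have S3 : Rsummable leb (fun x => cos (z * x + t) * expR (- e * `|x|)).
  by apply: eq_Rsummable (RsummableB S2 S1) => x /=; ring.
split=> //.
have -> : \int[leb]_x (cos (z * x + t) * expR (- e * `|x|)) =
  \int[leb]_x ((1 + cos (z * x + t)) * expR (- e * `|x|) - expR (- e * `|x|)).
  by apply: eq_Rintegral => x _; ring.
by rewrite RintB// I2 I1; ring.
Unshelve. all: by end_near. Qed.
End two_sided.

(** * Product integrals, Fubini and dominated convergence *)

Section product_integrals.
Context {R : realType}.
Notation leb := (@lebesgue_measure R).

Lemma measurable_rV_comp n (f : R -> R) (i : 'I_n) : measurable_fun setT f ->
  measurable_fun setT (fun x : 'rV[R]_n => f (x 0 i)).
Proof. by move=> mf; apply: (measurableT_comp mf); exact: measurable_coord_rV. Qed.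

Lemma measurable_rV_prod n (phi : 'I_n -> R -> R) : (forall i, measurable_fun setT (phi i)) ->
  measurable_fun setT (fun x : 'rV[R]_n => \prod_i phi i (x 0 i)).
Proof. by move=> mphi; apply: measurable_prod => i _; exact: measurable_rV_comp. Qed.

Lemma integral_rV_prod n (phi : 'I_n -> R -> R) : (forall i, measurable_fun setT (phi i)) ->
  (forall i t, 0 <= phi i t) -> (forall i, Rsummable leb (phi i)) ->
  (\int[lebesgue_rV R n]_x (\prod_i phi i (x 0 i))%:E = (\prod_i \int[leb]_t phi i t)%:E)%E.
Proof.
elim: n phi => [|n IH] phi mphi phi0 iphi.
  under eq_integral do rewrite big_ord0.
  by rewrite big_ord0 integral_cst// mul1e [X in X _]/= diracT.
rewrite ge0_integral_cons; [|by apply/measurable_EFinP; exact: (measurable_rV_prod mphi)|by move=> x; rewrite lee_fin prodr_ge0//].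
have inner t : (\int[lebesgue_rV R n]_y (\prod_i phi i (rV_cons (t, y) 0 i))%:E =
    (phi ord0 t)%:E * (\prod_(i < n) \int[leb]_t phi (lift ord0 i) t)%:E)%E.
  rewrite -(IH (fun i => phi (lift ord0 i)))// -ge0_integralZl_EFin//.
  - apply: eq_integral => y _; rewrite big_ord_recl mxE unlift_none/= EFinM.
    by under eq_bigr do rewrite mxE liftK/=.
  - by move=> y _; rewrite lee_fin prodr_ge0//.
  - by apply/measurable_EFinP; apply: (@measurable_rV_prod n (fun i => phi (lift ord0 i))).
under eq_integral do rewrite inner.
rewrite big_ord_recl EFinM -Rint_fine// muleC -ge0_integralZl_EFin//=; last 3 first.
- by move=> t _; rewrite lee_fin.
- by apply/measurable_EFinP; exact: mphi.
- by apply: prodr_ge0 => i _; exact: Rint_ge0.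
by apply: eq_integral => t _; rewrite muleC.
Qed.

Lemma Rint_rV_prod n (phi : 'I_n -> R -> R) : (forall i, measurable_fun setT (phi i)) ->
  (forall i t, 0 <= phi i t) -> (forall i, Rsummable leb (phi i)) ->
  Rsummable (lebesgue_rV R n) (fun x => \prod_i phi i (x 0 i)) /\
  \int[lebesgue_rV R n]_x (\prod_i phi i (x 0 i)) = \prod_i \int[leb]_t phi i t.
Proof.
move=> mphi phi0 iphi; have E := integral_rV_prod mphi phi0 iphi.
split; last by rewrite /Rintegral E.
apply/integrableP; split; first by apply/measurable_EFinP; exact: (measurable_rV_prod mphi).
under eq_integral do rewrite /= ger0_norm ?prodr_ge0//.
by rewrite E ltry.
Qed.
End product_integrals.

Section fubini_dominated.
Context d1 d2 (T1 : measurableType d1) (T2 : measurableType d2) (R : realType).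
Variables (m1 : {sigma_finite_measure set T1 -> \bar R}).
Variables (m2 : {sigma_finite_measure set T2 -> \bar R}).

(** Domination by a product is the only integrability criterion needed on the product space. *)
Lemma Fubini_dom (F : T1 * T2 -> R) (f1 : T1 -> R) (f2 : T2 -> R) :
  measurable_fun setT F -> Rsummable m1 f1 -> Rsummable m2 f2 ->
  (forall x, 0 <= f1 x) -> (forall y, 0 <= f2 y) ->
  (forall x y, `|F (x, y)| <= f1 x * f2 y) ->
  [/\ Rsummable m1 (fun x => \int[m2]_y F (x, y)) &
   \int[m1]_x \int[m2]_y F (x, y) = \int[m2]_y \int[m1]_x F (x, y)].
Proof.
move=> mF s1 s2 p1 p2 Fle.
have sx x : Rsummable m2 (fun y => F (x, y)).
  apply: (Rsummable_dom _ (RsummableZ (f1 x) s2)) => // .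
  by apply: (measurableT_comp mF); apply: measurable_fun_pair.
have sy y : Rsummable m1 (fun x => F (x, y)).
  apply: (Rsummable_dom _ (RsummableZ (f2 y) s1)) => [|x]; last by rewrite mulrC.
  by apply: (measurableT_comp mF); apply: measurable_fun_pair.
have mF' : measurable_fun setT (EFin \o F) by exact/measurable_EFinP.
have iF : (m1 \x m2)%E.-integrable setT (EFin \o F).
  apply/integrableP; split => //.
  rewrite (fubini_tonelli1 (fun p => `|(EFin \o F) p|%E))//; last exact: measurableT_comp.
  apply: (@le_lt_trans _ _ (\int[m1]_x ((f1 x)%:E * (\int[m2]_y f2 y)%:E))%E).
    apply: ge0_le_integral => //.
    - by move=> x _; apply: integral_ge0.
    - apply: (measurable_fun_fubini_tonelli_F (fun p => `|(EFin \o F) p|%E)) => //.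
      exact: measurableT_comp.
    - by apply/emeasurable_funM => //; exact/measurable_EFinP/(Rsummable_measurable s1).
    - move=> x _; rewrite -Rint_fine// -ge0_integralZl_EFin//; last 2 first.
      + by move=> y _; rewrite lee_fin.
      + exact/measurable_EFinP/(Rsummable_measurable s2).
      apply: ge0_le_integral => //.
      + apply/measurable_EFinP; apply: measurableT_comp => //.
        by apply: (measurableT_comp mF); apply: measurable_fun_pair.
      + apply: emeasurable_funM => //; exact/measurable_EFinP/(Rsummable_measurable s2).
      + by move=> y _; rewrite -EFinM lee_fin.
  under eq_integral do rewrite -EFinM mulrC.
  have s3 : Rsummable m1 (fun x => (\int[m2]_y f2 y) * f1 x) by exact: RsummableZ.
  by rewrite Rint_fine// ltry.
have E1 : fubini_F m2 (EFin \o F) = fun x => (\int[m2]_y F (x, y))%:E.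
  by apply/funext => x; rewrite /fubini_F -Rint_fine.
have E2 : fubini_G m1 (EFin \o F) = fun y => (\int[m1]_x F (x, y))%:E.
  by apply/funext => y; rewrite /fubini_G -Rint_fine.
split; first by have := integrable_fubini_F iF; rewrite E1.
have := Fubini iF; rewrite -/(fubini_F _ _) => H.
have := integral12_prod_meas1 iF; have := integral21_prod_meas1 iF.
rewrite E1 E2 /Rintegral => -> ->//.
Qed.
End fubini_dominated.

Section dct.
Context d (T : measurableType d) (R : realType) (mu : {measure set T -> \bar R}).

Lemma Rint_DCT (F_ : nat -> T -> R) (F G : T -> R) :
  (forall k, measurable_fun setT (F_ k)) -> measurable_fun setT F -> Rsummable mu G ->
  (forall k x, `|F_ k x| <= G x) -> (forall x, F_ k x @[k --> \oo] --> F x) ->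
  \int[mu]_x F_ k x @[k --> \oo] --> \int[mu]_x F x.
Proof.
move=> mF_ mF sG FG lF.
have s k : Rsummable mu (F_ k) by exact: Rsummable_dom (FG k).
have sF : Rsummable mu F.
  apply: (Rsummable_dom mF sG) => x.
  apply: (ler_cvg_to (cvg_norm (lF x)) (cvg_cst (G x))); apply: nearW => k; exact: FG.
have H : ((\int[mu]_x (F_ k x)%:E)%E @[k --> \oo] --> (\int[mu]_x (F x)%:E)%E).
  apply: (@dominated_cvg _ _ _ mu setT measurableT (fun k x => (F_ k x)%:E)
    (EFin \o F) (EFin \o G) _ _ _ sG) => //.
  - by move=> k; exact/measurable_EFinP.
  - by move=> x _; apply: cvg_EFin; [exact: nearW|exact: lF].
  - by move=> k x _; rewrite lee_fin.
move: H; rewrite (Rint_fine sF) => H; exact: (fine_cvg H).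
Qed.
End dct.

(** * Oscillatory integrals *)

Section oscillatory.
Context {R : realType} {n : nat}.
Notation leb := (@lebesgue_measure R).
Notation mu := (lebesgue_rV R n).
Implicit Types (h : 'rV[R]_n -> R) (x y xi : 'rV[R]_n) (t : R).

(** The oscillatory integral with a phase t: t = 0 and t = - pi / 2 give the real and imaginary
    parts of the Fourier integrals, and differentiating shifts t by pi / 2. *)
Definition osc t h x xi : R := \int[mu]_y (cos (dotp (x - y) xi + t) * h y).

Lemma dotpBl x y xi : dotp (x - y) xi = dotp x xi - dotp xi y.
Proof.
rewrite /dotp -sumrB; apply: eq_bigr => i _; rewrite !mxE; ring.
Qed.

Lemma smooth_phase t x xi : smooth (fun y => cos (dotp (x - y) xi + t)) /\
  forall i, partial i (fun y => cos (dotp (x - y) xi + (t + pi / 2))) =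
     fun y => - (xi 0 i * cos (dotp (x - y) xi + t)) * - 1.
Proof.
have E s : (fun y => dotp (x - y) xi + s) = (fun y => (dotp x xi + s) - dotp xi y).
  by apply/funext => y; rewrite dotpBl; ring.
have S s : smooth (fun y => dotp (x - y) xi + s).
  by rewrite E; apply: smoothB; [exact: smooth_cst|exact: smooth_dotp].
have [H _] := smooth_cos (S t); split=> // i.
have [_ ->] := smooth_cos (S (t + pi / 2)).
rewrite E partialB; [|exact: smooth_cst|exact: smooth_dotp].
rewrite partial_cst partial_dotp; apply/funext => y.
by rewrite addrA sinDpihalf; ring.
Qed.

Lemma osc_by_parts t h x xi i : csmooth1 h ->
  xi 0 i * osc t h x xi = - osc (t + pi / 2) (partial i h) x xi.
Proof.
move=> ch; have [S1 _] := smooth_phase t x xi; have [S2 _] := smooth_phase (t + pi / 2) x xi.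
have [_ D] := smooth_phase t x xi.
rewrite /osc Rint_by_parts// opprK -RintZ; last exact/csmooth1_Rsummable/csmooth1Ml.
by apply: eq_Rintegral => y _; rewrite D; ring.
Qed.

Lemma osc_phase_pi t h x xi : csmooth1 h -> osc (t + pi) h x xi = - osc t h x xi.
Proof.
move=> ch; have [S1 _] := smooth_phase t x xi.
rewrite /osc -RintN; last exact/csmooth1_Rsummable/csmooth1Ml.
by apply: eq_Rintegral => y _; rewrite addrA cosDpi mulNr.
Qed.

Lemma oscD t h1 h2 x xi : csmooth1 h1 -> csmooth1 h2 ->
  osc t (fun y => h1 y + h2 y) x xi = osc t h1 x xi + osc t h2 x xi.
Proof.
move=> c1 c2; have [S1 _] := smooth_phase t x xi.
rewrite /osc -RintD; [|exact/csmooth1_Rsummable/csmooth1Ml..].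
by apply: eq_Rintegral => y _; rewrite mulrDr.
Qed.

Lemma oscN t h x xi : csmooth1 h -> osc t (fun y => - h y) x xi = - osc t h x xi.
Proof.
move=> ch; have [S1 _] := smooth_phase t x xi.
rewrite /osc -RintN; last exact/csmooth1_Rsummable/csmooth1Ml.
by apply: eq_Rintegral => y _; rewrite mulrN.
Qed.

Lemma osc_by_parts2 t h x xi i j : csmooth1 h ->
  xi 0 i * xi 0 j * osc t h x xi = - osc t (partial j (partial i h)) x xi.
Proof.
move=> ch; have c1 := csmooth1_partial i ch; have c2 := csmooth1_partial j c1.
rewrite mulrAC osc_by_parts// mulNr mulrC osc_by_parts// opprK -osc_phase_pi//.
by congr osc; lra.
Qed.

Lemma osc_le t h x xi : csmooth1 h -> `|osc t h x xi| <= \int[mu]_y `|h y|.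
Proof.
move=> ch; have [S1 _] := smooth_phase t x xi.
have S := csmooth1_Rsummable (csmooth1Ml S1 ch).
rewrite (le_trans (Rint_norm S))//; apply: Rint_le; first exact: Rsummable_norm.
  by apply: Rsummable_norm; exact: csmooth1_Rsummable.
by move=> y; rewrite normrM ler_piMl// ler_norml cos_geN1 cos_le1.
Qed.

(** Integrating by parts with (1 - d_i^2) in every coordinate gives an integrable
    majorant. *)
Lemma osc_decay t h x : csmooth1 h -> exists2 K : R, 0 <= K &
  forall xi, `|osc t h x xi| <= K * \prod_i (1 + xi 0 i ^+ 2)^-1.
Proof.
move=> ch; pose L i g : 'rV[R]_n -> R := fun y => g y + - partial i (partial i g) y.
have cL i g : csmooth1 g -> csmooth1 (L i g).
  by move=> cg; apply: csmooth1D => //; do ![exact: cg|apply: csmooth1N|apply: csmooth1_partial].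
have cf s : csmooth1 (foldr L h s) by elim: s => //= i s IH; exact: cL.
have Hs s xi : (\prod_(i <- s) (1 + xi 0 i ^+ 2)) * osc t h x xi = osc t (foldr L h s) x xi.
  elim: s => [|i s IH] /=; first by rewrite big_nil mul1r.
  have c1 := csmooth1_partial i (csmooth1_partial i (cf s)).
  rewrite big_cons -mulrA IH /L oscD//; last exact: csmooth1N.
  by rewrite oscN// -osc_by_parts2// expr2; ring.
exists (\int[mu]_y `|foldr L h (index_enum 'I_n) y|) => [|xi]; first exact: Rint_ge0.
have P0 : 0 < \prod_i (1 + xi 0 i ^+ 2).
  by apply: prodr_gt0 => i _; rewrite ltr_pwDl ?sqr_ge0.
rewrite prodfV ler_pdivlMr// mulrC -(ger0_norm (ltW P0)) -normrM Hs.
exact: osc_le.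
Qed.

(** Abel summation factor; its Fourier transform is a product of Poisson kernels. *)
Definition abel (e : R) xi := \prod_i expR (- e * `|xi 0 i|).

Lemma abel_gt0 e xi : 0 < abel e xi.
Proof. by apply: prodr_gt0 => i _; exact: expR_gt0. Qed.

Lemma measurable_abel e : measurable_fun setT (abel e).
Proof.
apply: (@measurable_rV_prod R n (fun=> fun s => expR (- e * `|s|))) => i.
apply: continuous_measurable_fun; exact: continuous_exp_abs.
Qed.

Lemma Rsummable_abel e : 0 < e -> Rsummable mu (abel e).
Proof.
move=> e0; have [] // := @Rint_rV_prod R n (fun=> fun s => expR (- e * `|s|)).
- by move=> i; apply: continuous_measurable_fun; exact: continuous_exp_abs.
- by move=> i; have [] := laplace_fourier 0 0 e0.
Qed.

End oscillatory.

Section abel_means.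
Context {R : realType}.
Notation leb := (@lebesgue_measure R).

Lemma measurable_cos_dotp n (z : 'rV[R]_n) t :
  measurable_fun setT (fun xi : 'rV[R]_n => cos (dotp z xi + t)).
Proof.
apply: (@measurableT_comp _ _ _ _ _ _ (fun s : R => cos (s + t))).
  apply: continuous_measurable_fun => s.
  apply: (@continuous_comp _ _ _ (fun s : R => s + t) cos); last exact: continuous_cos.
  by apply: cvgD; [exact: cvg_id|exact: cvg_cst].
apply: measurable_sum => i; apply: measurable_funM => //; exact: measurable_coord_rV.
Qed.

Lemma Rsummable_cos_abel n (z : 'rV[R]_n) t e : 0 < e ->
  Rsummable (lebesgue_rV R n) (fun xi => cos (dotp z xi + t) * abel e xi).
Proof.
move=> e0; apply: (Rsummable_dom _ (Rsummable_abel e0)).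
  by apply: measurable_funM; [exact: measurable_cos_dotp|exact: measurable_abel].
move=> xi; rewrite normrM (ger0_norm (ltW (abel_gt0 e xi))).
apply: ler_piMl; first exact: ltW (abel_gt0 e xi).
by rewrite ler_norml cos_geN1 cos_le1.
Qed.

Lemma abel_fourier n (z : 'rV[R]_n) t e : 0 < e ->
  \int[lebesgue_rV R n]_xi (cos (dotp z xi + t) * abel e xi) =
  cos t * \prod_i (2 * e / (e ^+ 2 + z 0 i ^+ 2)).
Proof.
move=> e0; elim: n z t => [|n IH] z t.
  have E (xi : 'rV[R]_0) : cos (dotp z xi + t) * abel e xi = cos t.
    by rewrite /dotp /abel !big_ord0 add0r mulr1.
  rewrite big_ord0 mulr1 /Rintegral; under eq_integral do rewrite E.
  by rewrite integral_cst// [X in (_ * X)%E]/= diracT mule1.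
pose z' : 'rV[R]_n := \row_i z 0 (lift ord0 i).
have E s (y : 'rV[R]_n) : cos (dotp z (rV_cons (s, y)) + t) * abel e (rV_cons (s, y)) =
   expR (- e * `|s|) * (cos (dotp z' y + (z 0 ord0 * s + t)) * abel e y).
  rewrite /dotp /abel !big_ord_recl !mxE unlift_none/=.
  under eq_bigr do rewrite mxE liftK/=.
  under [X in _ * (_ * X)]eq_bigr do rewrite mxE liftK/=.
  rewrite mulrCA; congr (_ * (cos _ * _)).
  rewrite addrAC addrC; congr (_ + _).
  by apply: eq_bigr => i _; rewrite mxE.
have mF : measurable_fun setT (fun xi : 'rV[R]_n.+1 => cos (dotp z xi + t) * abel e xi).
  by apply: measurable_funM; [exact: measurable_cos_dotp|exact: measurable_abel].
have [|_ ->] := Rint_cons mF (Rsummable_cos_abel z t e0).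
  move=> s; have := RsummableZ (expR (- e * `|s|)) (Rsummable_cos_abel z' (z 0 ord0 * s + t) e0).
  by apply: eq_Rsummable => y; rewrite E.
have I1 s : \int[lebesgue_rV R n]_y (cos (dotp z (rV_cons (s, y)) + t) * abel e (rV_cons (s, y))) =
   (\prod_i (2 * e / (e ^+ 2 + z' 0 i ^+ 2))) * (cos (z 0 ord0 * s + t) * expR (- e * `|s|)).
  under eq_Rintegral do rewrite E.
  by rewrite RintZ; [rewrite IH; ring|exact: Rsummable_cos_abel].
under eq_Rintegral do rewrite I1.
have [_ s2 i2] := laplace_fourier (z 0 ord0) t e0.
rewrite RintZ// i2 big_ord_recl; under eq_bigr do rewrite mxE; ring.
Qed.
End abel_means.

(** * Fourier inversion *)

Section inversion.
Context {R : realType}.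
Notation leb := (@lebesgue_measure R).

Lemma abelE n (e : R) (xi : 'rV[R]_n) : abel e xi = expR (- e * \sum_i `|xi 0 i|).
Proof.
rewrite mulr_sumr (big_morph (@expR R) (@expRD R) (@expR0 R)) //.
Qed.

Lemma measurable_phase n (x : 'rV[R]_n) t :
  measurable_fun setT (fun p : 'rV[R]_n * 'rV[R]_n => cos (dotp (x - p.2) p.1 + t)).
Proof.
apply: (@measurableT_comp _ _ _ _ _ _ (fun s : R => cos (s + t))).
  apply: continuous_measurable_fun => s.
  apply: (@continuous_comp _ _ _ (fun s : R => s + t) cos); last exact: continuous_cos.
  by apply: cvgD; [exact: cvg_id|exact: cvg_cst].
apply: measurable_sum => i; apply: measurable_funM.
  under eq_fun do rewrite !mxE.
  apply: measurable_funB => //.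
  by apply: (measurableT_comp (measurable_coord_rV i)); exact: measurable_snd.
by apply: (measurableT_comp (measurable_coord_rV i)); exact: measurable_fst.
Qed.

Definition poisson n (e : R) (z : 'rV[R]_n) : R := \prod_i (2 * e / (e ^+ 2 + z 0 i ^+ 2)).

Lemma osc_abel n (h : 'rV[R]_n -> R) x t e : 0 < e -> csmooth1 h ->
  Rsummable (lebesgue_rV R n) (fun xi => osc t h x xi * abel e xi) /\
  \int[lebesgue_rV R n]_xi (osc t h x xi * abel e xi) =
   cos t * \int[lebesgue_rV R n]_y (h y * poisson e (x - y)).
Proof.
move=> e0 ch.
pose F (p : 'rV[R]_n * 'rV[R]_n) := cos (dotp (x - p.2) p.1 + t) * h p.2 * abel e p.1.
have [mh _] := csmooth1_bms ch.
have mF : measurable_fun setT F.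
  apply: measurable_funM; last by apply: (measurableT_comp (measurable_abel e)); exact: measurable_fst.
  apply: measurable_funM; first exact: measurable_phase.
  by apply: (measurableT_comp mh); exact: measurable_snd.
have sh := csmooth1_Rsummable ch.
have [||xi y|S E] := Fubini_dom mF (Rsummable_abel (n := n) e0) (Rsummable_norm sh).
- by move=> xi; exact: ltW (abel_gt0 e xi).
- by [].
- rewrite /F /= !normrM (ger0_norm (ltW (abel_gt0 e xi))) mulrC.
  rewrite ler_pM2l ?abel_gt0// ler_piMl// ler_norml cos_geN1 cos_le1//.
have IE xi : \int[lebesgue_rV R n]_y F (xi, y) = osc t h x xi * abel e xi.
  rewrite /osc mulrC -RintZ; first by apply: eq_Rintegral => y _; rewrite /F /= mulrC.
  have [S1 _] := smooth_phase t x xi.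
  exact/csmooth1_Rsummable/csmooth1Ml.
split; first by apply: eq_Rsummable S => xi.
under eq_Rintegral do rewrite -IE.
rewrite E.
have E2 y : \int[lebesgue_rV R n]_xi F (xi, y) = cos t * (h y * poisson e (x - y)).
  under eq_Rintegral => xi _ do rewrite /F /= (mulrC _ (h y)) -mulrA.
  rewrite RintZ; last exact: Rsummable_cos_abel.
  rewrite (abel_fourier _ _ e0); exact: mulrCA.
under eq_Rintegral do rewrite E2.
rewrite RintZ; first exact: erefl.
move=> {S E IE E2 mF F}.
have [_ [K [_ [hK _]]]] := csmooth1_bms ch.
apply: (@RsummableM_bounded _ _ _ _ K) => //.
have [] // := @Rint_rV_prod R n (fun i => fun z => 2 * e / (e ^+ 2 + (x 0 i - z) ^+ 2)).
- by move=> i; exact: Rsummable_measurable (poisson_kernel (x 0 i) e0).1.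
- by move=> i z; rewrite divr_ge0 ?mulr_ge0 ?addr_ge0 ?sqr_ge0// ltW.
- by move=> i; exact: (poisson_kernel (x 0 i) e0).1.
by move=> S3 _; apply: eq_Rsummable S3 => y; apply: eq_bigr => i _; rewrite !mxE.
Qed.

(** Away from x some coordinate of x - y is at least d in absolute value, and replacing its Poisson
    kernel by the one of width 1 gains a factor e; the total mass stays the same. *)
Lemma poisson_approx n (h : 'rV[R]_n -> R) x : csmooth1 h -> forall eta : R, 0 < eta ->
  exists2 C : R, 0 <= C & forall e, 0 < e ->
  `|\int[lebesgue_rV R n]_y (h y * poisson e (x - y)) - (2 * pi) ^+ n * h x| <=
     (2 * pi) ^+ n * (eta + C * e).
Proof.
move=> ch eta eta0; have [mh [K [r [hK _]]]] := csmooth1_bms ch.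
have [sh _] := ch.
have /nbhs_ballP[d /= d0 Hd] : nbhs x [set y | `|h x - h y| < eta].
  have /cvgrPdist_lt := smooth_continuous sh (x := x); exact.
have K0 : 0 <= K by rewrite (le_trans _ (hK x)).
pose c : R := 1 + d ^- 2.
exists (n%:R * (2 * K * c)) => [|e e0]; first by rewrite !mulr_ge0 ?addr_ge0 ?invr_ge0 ?exprn_ge0// ltW.
pose k (e z : R) := 2 * e / (e ^+ 2 + z ^+ 2).
have k0 e' z : 0 < e' -> 0 < k e' z.
  by move=> e'0; rewrite divr_gt0 ?mulr_gt0 ?ltr_pwDl ?exprn_gt0 ?sqr_ge0.
pose ph (w : 'I_n -> R) (y : 'rV[R]_n) := \prod_j k (w j) (x 0 j - y 0 j).
have Hph w : (forall j, 0 < w j) -> Rsummable (lebesgue_rV R n) (ph w) /\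
    \int[lebesgue_rV R n]_y ph w y = (2 * pi) ^+ n.
  move=> w0; have [] // := @Rint_rV_prod R n (fun j => fun z => k (w j) (x 0 j - z)).
  - by move=> j; exact: Rsummable_measurable (poisson_kernel (x 0 j) (w0 j)).1.
  - by move=> j z; exact/ltW/k0.
  - by move=> j; exact: (poisson_kernel (x 0 j) (w0 j)).1.
  move=> S ->; split=> //.
  rewrite (eq_bigr (fun=> 2 * pi)) => [|j _]; last exact: (poisson_kernel (x 0 j) (w0 j)).2.
  by rewrite prodr_const card_ord.
have PE y : poisson e (x - y) = ph (fun=> e) y.
  by apply: eq_bigr => j _; rewrite !mxE.
have [S0 I0] := Hph (fun=> e) (fun=> e0).
pose w (i j : 'I_n) := if j == i then 1 else e : R.
have w0 i j : 0 < w i j by rewrite /w; case: eqP.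
under eq_Rintegral do rewrite PE.
have sP : Rsummable (lebesgue_rV R n) (fun y => h y * ph (fun=> e) y).
  by apply: (@RsummableM_bounded _ _ _ _ K).
rewrite -I0 mulrC -RintZ// -RintB//; last exact: RsummableZ.
have sD := RsummableB sP (RsummableZ (h x) S0).
apply: (le_trans (Rint_norm sD)).
pose maj y := eta * ph (fun=> e) y + (2 * K * c * e) * \sum_i ph (w i) y.
have sS : Rsummable (lebesgue_rV R n) (fun y => \sum_i ph (w i) y).
  by apply: Rsummable_sum => i; have [] := Hph (w i) (w0 i).
have smaj : Rsummable (lebesgue_rV R n) maj by apply: RsummableD; exact: RsummableZ.
have -> : (\int[lebesgue_rV R n]_y ph (fun=> e) y) * (eta + n%:R * (2 * K * c) * e) =
   \int[lebesgue_rV R n]_y maj y.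
  rewrite RintD; [|exact: RsummableZ..].
  rewrite !RintZ// Rint_sum => [|i]; last by have [] := Hph (w i) (w0 i).
  rewrite (eq_bigr (fun=> (2 * pi) ^+ n)) => [|i _]; last by have [] := Hph (w i) (w0 i).
  rewrite sumr_const card_ord I0 -[_ *+ n]mulr_natl; ring.
apply: Rint_le => // [|y]; first exact: Rsummable_norm.
have p0 w' : (forall j, 0 < w' j) -> 0 <= ph w' y.
  by move=> H; apply: prodr_ge0 => j _; exact/ltW/k0.
rewrite -mulrBl normrM (ger0_norm (p0 (fun=> e) (fun=> e0))).
have [near_xy|] := pselect (forall j, `|x 0 j - y 0 j| < d).
  rewrite /maj -[leLHS]addr0 lerD//.
    apply: ler_wpM2r; first exact: p0.
    rewrite distrC; apply/ltW/Hd; split=> // i j; rewrite ord1; exact: near_xy.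
  rewrite mulr_ge0 ?sumr_ge0 ?mulr_ge0 ?addr_ge0 ?invr_ge0 ?exprn_ge0// ?ltW//.
  by move=> i _; exact: p0.
move=> /existsNP[i /negP]; rewrite -leNgt => far.
have step1 : ph (fun=> e) y <= c * e * ph (w i) y.
  rewrite /ph (bigD1 i)//= [in leRHS](bigD1 i)//= mulrA.
  rewrite (eq_bigr (fun j => k (w i j) (x 0 j - y 0 j))) => [|j /negbTE ji]; last by rewrite /w ji.
  apply: ler_wpM2r; first by apply: prodr_ge0 => j _; exact/ltW/k0.
  rewrite /w eqxx /k expr1n mulr1.
  move: far; set z := x 0 i - y 0 i => far.
  have z2 : d ^+ 2 <= z ^+ 2 by rewrite -(real_normK (num_real z)) ler_pXn2r ?nnegrE// ltW.
  rewrite ler_pdivrMr ?ltr_pwDl ?exprn_gt0 ?sqr_ge0//.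
  have zz : 0 < 1 + z ^+ 2 by rewrite ltr_pwDl ?sqr_ge0.
  have : 1 + z ^+ 2 <= c * (e ^+ 2 + z ^+ 2).
    have : 1 <= d ^- 2 * z ^+ 2 by rewrite mulrC ler_pdivlMr ?exprn_gt0// mul1r.
    have : 0 <= d ^- 2 by rewrite invr_ge0 exprn_ge0 ?ltW.
    have := sqr_ge0 e; rewrite /c; nra.
  move=> H; have {}H : 1 <= c * (e ^+ 2 + z ^+ 2) / (1 + z ^+ 2) by rewrite ler_pdivlMr// mul1r.
  rewrite (_ : c * e * (2 / _) * _ = (2 * e) * (c * (e ^+ 2 + z ^+ 2) / (1 + z ^+ 2))); last by ring.
  by rewrite -[leLHS]mulr1; apply: ler_wpM2l => //; rewrite mulr_ge0// ltW.
rewrite /maj -[leLHS]add0r lerD//; first by rewrite mulr_ge0 ?p0// ltW.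
have hd : `|h y - h x| <= 2 * K.
  by rewrite (le_trans (ler_normB _ _))// mulr_natl mulr2n lerD.
apply: (@le_trans _ _ (2 * K * (c * e * ph (w i) y))).
  by apply: ler_pM => //; exact: p0.
rewrite !mulrA; apply: ler_wpM2l.
  by rewrite !mulr_ge0 ?addr_ge0 ?invr_ge0 ?exprn_ge0// ltW.
rewrite (bigD1 i)//= lerDl sumr_ge0// => j _; exact: p0.
Qed.

(** Abel means converge to the integral because of the decay of osc, and to the value of h because
    they are convolutions with an approximate identity. *)
Theorem fourier_inversion n (h : 'rV[R]_n -> R) x t : csmooth1 h ->
  Rsummable (lebesgue_rV R n) (osc t h x) /\
  \int[lebesgue_rV R n]_xi osc t h x xi = cos t * ((2 * pi) ^+ n * h x).
Proof.
move=> ch; have [K K0 HK] := osc_decay t x ch.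
(* Fubini gives the measurability of the Abel means; the Abel factor is then undone. *)
have mosc : measurable_fun setT (osc t h x).
  have [/Rsummable_measurable S _] := osc_abel x t (@ltr01 R) ch.
  have -> : osc t h x = fun xi => osc t h x xi * abel 1 xi * abel (- 1) xi.
    apply/funext => xi; rewrite -mulrA !abelE -expRD -mulrDl opprK addNr mul0r expR0 mulr1//.
  apply: measurable_funM => //; exact: measurable_abel.
have sP : Rsummable (lebesgue_rV R n) (fun xi => K * \prod_i (1 + xi 0 i ^+ 2)^-1).
  apply: RsummableZ.
  have [] // := @Rint_rV_prod R n (fun i => fun z => 2^-1 * (2 * 1 / (1 ^+ 2 + (0 - z) ^+ 2))).
  - move=> i; apply: measurable_funM => //.
    exact: Rsummable_measurable (poisson_kernel 0 (@ltr01 R)).1.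
  - by move=> i z; rewrite mulr_ge0 ?divr_ge0 ?mulr_ge0 ?addr_ge0 ?sqr_ge0.
  - by move=> i; apply: RsummableZ; exact: (poisson_kernel 0 (@ltr01 R)).1.
  move=> S3 _; apply: eq_Rsummable S3 => y; apply: eq_bigr => i _.
  by rewrite sub0r sqrrN expr1n mulr1 mulrA mulVf// mul1r.
have sosc : Rsummable (lebesgue_rV R n) (osc t h x) by exact: Rsummable_dom sP HK.
split=> //.
pose e k : R := k.+1%:R^-1.
have e0 k : 0 < e k by rewrite invr_gt0.
have L1 : \int[lebesgue_rV R n]_xi (osc t h x xi * abel (e k) xi) @[k --> \oo] -->
    \int[lebesgue_rV R n]_xi osc t h x xi.
  apply: (Rint_DCT _ mosc sP) => [k|k xi|xi].
  - by apply: measurable_funM => //; exact: measurable_abel.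
  - apply: le_trans (HK xi); rewrite normrM (ger0_norm (ltW (abel_gt0 _ _))) ler_piMr//.
    rewrite abelE expR_le1 mulNr oppr_le0 mulr_ge0 ?sumr_ge0//; exact: ltW.
  - rewrite -[X in _ --> X]mulr1; apply: cvgM; first exact: cvg_cst.
    under eq_fun do rewrite abelE.
    have L : - e k * \sum_i `|xi 0 i| @[k --> \oo] --> (0 : R).
      rewrite -[X in _ --> X](mul0r (\sum_i `|xi 0 i|)); apply: cvgM; last exact: cvg_cst.
      by rewrite -[X in _ --> X]oppr0; apply: cvgN; exact: cvg_harmonic.
    rewrite -expR0; apply: (cvg_comp _ (@expR R) L); exact: continuous_expR.
have E k := (osc_abel x t (e0 k) ch).2.
suff L2 : cos t * \int[lebesgue_rV R n]_y (h y * poisson (e k) (x - y)) @[k --> \oo] -->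
    cos t * ((2 * pi) ^+ n * h x).
  apply: (cvg_unique _ L1); first exact: Rhausdorff.
  apply: cvg_trans L2; apply: near_eq_cvg; apply: nearW => k; exact/esym/E.
apply: cvgM; first exact: cvg_cst.
apply/cvgrPdist_le => eps eps0.
have pin : 0 < (2 * pi : R) ^+ n by rewrite exprn_gt0// mulr_gt0// pi_gt0.
have [C C0 HC] := poisson_approx x ch (divr_gt0 (divr_gt0 eps0 pin) (ltr0n R 2)).
have : (2 * pi) ^+ n * C * e k @[k --> \oo] --> (0 : R).
  rewrite -(mulr0 ((2 * pi) ^+ n * C)); apply: cvgM; [exact: cvg_cst|exact: cvg_harmonic].
move/cvgrPdist_le => /(_ (eps / 2) (divr_gt0 eps0 (ltr0n R 2))) H.
near=> k; rewrite distrC (le_trans (HC _ (e0 k)))//.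
have : `|0 - (2 * pi) ^+ n * C * e k| <= eps / 2 by near: k.
rewrite sub0r normrN => /(le_trans (ler_norm _)) H2.
rewrite mulrDr mulrA (_ : (2 * pi) ^+ n * (eps / (2 * pi) ^+ n / 2) = eps / 2); last first.
  by field; rewrite gt_eqF.
lra.
Unshelve. all: by end_near. Qed.
End inversion.

(** * Weyl quantization of quadratic polynomials in the momentum *)

Local Open Scope complex_scope.

Section four_terms.
Context d (T : measurableType d) (R : realType) (mu : {measure set T -> \bar R}).

Lemma Rint_add4 (o1 o2 o3 o4 : T -> R) (v1 v2 v3 v4 : R) :
  Rsummable mu o1 /\ \int[mu]_x o1 x = v1 -> Rsummable mu o2 /\ \int[mu]_x o2 x = v2 ->
  Rsummable mu o3 /\ \int[mu]_x o3 x = v3 -> Rsummable mu o4 /\ \int[mu]_x o4 x = v4 ->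
  \int[mu]_x ((o1 x + o2 x) + (o3 x + o4 x)) = (v1 + v2) + (v3 + v4).
Proof.
move=> [s1 <-] [s2 <-] [s3 <-] [s4 <-].
by rewrite (RintD (RsummableD s1 s2) (RsummableD s3 s4)) (RintD s1 s2) (RintD s3 s4).
Qed.

Lemma Rint_sub4 (o1 o2 o3 o4 : T -> R) (v1 v2 v3 v4 : R) :
  Rsummable mu o1 /\ \int[mu]_x o1 x = v1 -> Rsummable mu o2 /\ \int[mu]_x o2 x = v2 ->
  Rsummable mu o3 /\ \int[mu]_x o3 x = v3 -> Rsummable mu o4 /\ \int[mu]_x o4 x = v4 ->
  \int[mu]_x ((o1 x + o2 x) - (o3 x + o4 x)) = (v1 + v2) - (v3 + v4).
Proof.
move=> [s1 <-] [s2 <-] [s3 <-] [s4 <-].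
by rewrite (RintB (RsummableD s1 s2) (RsummableD s3 s4)) (RintD s1 s2) (RintD s3 s4).
Qed.

End four_terms.

Lemma realC_mul (R : realType) (k p q : R) : k%:C * (p +i* q) = (k * p) +i* (k * q).
Proof. by apply/eqP; rewrite eq_complex; apply/andP; split; apply/eqP => /=; ring. Qed.

Section weyl.
Context {R : realType} {n : nat}.
Notation mu := (lebesgue_rV R n).
Implicit Types (g h : 'rV[R]_n -> R) (x y xi : 'rV[R]_n) (t : R).

Lemma eq_osc t h1 h2 x xi : h1 =1 h2 -> osc t h1 x xi = osc t h2 x xi.
Proof. by move=> /funext ->. Qed.

Lemma oscZ t (k : R) h x xi : csmooth1 h -> osc t (fun y => k * h y) x xi = k * osc t h x xi.
Proof.
move=> ch; have [S1 _] := smooth_phase t x xi.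
rewrite /osc -RintZ; last exact/csmooth1_Rsummable/csmooth1Ml.
by apply: eq_Rintegral => y _; rewrite mulrCA.
Qed.

Lemma osc_sum t (I : Type) (s : seq I) (F : I -> 'rV[R]_n -> R) x xi :
  (forall i, csmooth1 (F i)) ->
  osc t (fun y => \sum_(i <- s) F i y) x xi = \sum_(i <- s) osc t (F i) x xi.
Proof.
move=> cF; elim: s => [|a s IH].
  rewrite big_nil -[RHS](mul0r (osc t (fun=> 0) x xi)) -oscZ; last exact: csmooth1_0.
  by apply: eq_osc => y; rewrite big_nil mul0r.
rewrite big_cons -IH -oscD//; last exact: csmooth1_sum.
by apply: eq_osc => y; rewrite big_cons.
Qed.

Lemma csmooth1Z (k : R) h : csmooth1 h -> csmooth1 (fun y => k * h y).
Proof. by move=> ch; apply: csmooth1Ml => //; exact: smooth_cst. Qed.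

Lemma partial2M f g j k : smooth f -> smooth g ->
  partial k (partial j (fun y => f y * g y)) = fun y =>
   partial k (partial j f) y * g y + partial j f y * partial k g y +
   (partial k f y * partial j g y + f y * partial k (partial j g) y).
Proof.
move=> sf sg; rewrite (partialM j sf sg) partialD.
- by rewrite (partialM k (smooth_partial j sf) sg) (partialM k sf (smooth_partial j sg)).
- exact: (smoothM (smooth_partial j sf) sg).
- exact: (smoothM sf (smooth_partial j sg)).
Qed.

Lemma partial2_affine f j k (s : R) z : smooth f ->
  partial k (partial j (fun y => f (s *: y + z))) =
  fun y => s * (s * partial k (partial j f) (s *: y + z)).
Proof.
move=> sf; have sf' := smooth_partial j sf.
rewrite (partial_affine s z j sf) (partialZ s k (smooth_affine s z sf')).
by rewrite (partial_affine s z k sf').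
Qed.

Variables (a : 'I_n -> 'I_n -> 'rV[R]_n -> R) (b : 'I_n -> 'rV[R]_n -> R) (c : 'rV[R]_n -> R).
Hypotheses (asmth : forall j k, smooth (a j k)) (bsmth : forall j, smooth (b j)) (csmth : smooth c).

Let mid x h y := h (2^-1 *: y + 2^-1 *: x).

(** The terms of even and of odd degree in xi, after integration by parts in y; they contribute to
    different parts of the complex integral.  The point x at which the operator is evaluated
    is a fixed parameter, and y is the variable of integration. *)
Definition weyl_even x g y : R :=
  \sum_j \sum_k - partial k (partial j (fun y => mid x (a j k) y * g y)) y + mid x c y * g y.
Definition weyl_odd x g y : R :=
  \sum_j - partial j (fun y => mid x (b j) y * g y) y.

Lemma csmooth1_mid x f g : smooth f -> csmooth1 g -> csmooth1 (fun y => mid x f y * g y).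
Proof. by move=> sf cg; exact: (csmooth1Ml (smooth_affine _ _ sf) cg). Qed.

Lemma csmooth1_weyl_even x g : csmooth1 g -> csmooth1 (weyl_even x g).
Proof.
move=> cg; apply: csmooth1D; last exact: (csmooth1_mid x csmth cg).
apply: csmooth1_sum => j; apply: csmooth1_sum => k.
exact: (csmooth1N (csmooth1_partial k (csmooth1_partial j (csmooth1_mid x (asmth j k) cg)))).
Qed.

Lemma csmooth1_weyl_odd x g : csmooth1 g -> csmooth1 (weyl_odd x g).
Proof.
move=> cg; apply: csmooth1_sum => j.
exact: (csmooth1N (csmooth1_partial j (csmooth1_mid x (bsmth j) cg))).
Qed.

Lemma osc_weyl t g x xi : csmooth1 g ->
  csmooth1 (fun y => perturbation a b c (2^-1 *: (x + y)) xi * g y) /\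
  osc t (fun y => perturbation a b c (2^-1 *: (x + y)) xi * g y) x xi =
   osc t (weyl_even x g) x xi + osc (t + pi / 2) (weyl_odd x g) x xi.
Proof.
move=> cg.
have ca j k := csmooth1_mid x (asmth j k) cg.
have cb j := csmooth1_mid x (bsmth j) cg.
have cc := csmooth1_mid x csmth cg.
have E y : perturbation a b c (2^-1 *: (x + y)) xi * g y =
   \sum_j \sum_k (xi 0 j * xi 0 k) * (mid x (a j k) y * g y) +
   \sum_j xi 0 j * (mid x (b j) y * g y) + mid x c y * g y.
  have me h : mid x h y = h (2^-1 *: (x + y)) by rewrite /mid -scalerDr addrC.
  rewrite /perturbation !mulrDl !mulr_suml me.
  congr (_ + _ + _); apply: eq_bigr => j _; last by rewrite me; ring.
  by rewrite mulr_suml; apply: eq_bigr => k _; rewrite me; ring.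
have c1 j k := csmooth1Z (xi 0 j * xi 0 k) (ca j k).
have c2 j := csmooth1Z (xi 0 j) (cb j).
have c3 j : csmooth1 (fun y => \sum_k (xi 0 j * xi 0 k) * (mid x (a j k) y * g y)).
  exact: csmooth1_sum.
have c4 : csmooth1 (fun y => \sum_j \sum_k (xi 0 j * xi 0 k) * (mid x (a j k) y * g y) +
   \sum_j xi 0 j * (mid x (b j) y * g y)).
  by apply: csmooth1D; exact: csmooth1_sum.
split; first by rewrite (funext E); apply: csmooth1D; [exact: c4|exact: cc].
rewrite (eq_osc _ _ _ E) oscD// oscD; [|exact: csmooth1_sum|exact: csmooth1_sum].
have d1 j k := csmooth1N (csmooth1_partial k (csmooth1_partial j (ca j k))).
have d2 j := csmooth1N (csmooth1_partial j (cb j)).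
have d3 j : csmooth1 (fun y => \sum_k - partial k (partial j (fun y => mid x (a j k) y * g y)) y).
  exact: csmooth1_sum (d1 j).
rewrite /weyl_even /weyl_odd (oscD _ _ _ (csmooth1_sum _ _ d3) cc).
rewrite (osc_sum _ _ _ _ c3) (osc_sum _ _ _ _ c2) (osc_sum _ _ _ _ d3) (osc_sum _ _ _ _ d2).
rewrite addrAC; congr (_ + _ + _); apply: eq_bigr => j _.
  rewrite (osc_sum _ _ _ _ (c1 j)) (osc_sum _ _ _ _ (d1 j)); apply: eq_bigr => k _.
  rewrite (oscZ _ _ _ _ (ca j k)) (osc_by_parts2 _ _ _ _ _ (ca j k)).
  by rewrite (oscN _ _ _ (csmooth1_partial k (csmooth1_partial j (ca j k)))).
rewrite (oscZ _ _ _ _ (cb j)) (osc_by_parts _ _ _ _ (cb j)).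
by rewrite (oscN _ _ _ (csmooth1_partial j (cb j))).
Qed.

Lemma weyl_even_diag x g : csmooth1 g -> weyl_even x g x =
  - (\sum_j \sum_k (4^-1 * partial k (partial j (a j k)) x * g x +
      2^-1 * partial j (a j k) x * partial k g x + 2^-1 * partial k (a j k) x * partial j g x +
      a j k x * partial k (partial j g) x)) + c x * g x.
Proof.
move=> [sg _].
have xx : 2^-1 *: x + 2^-1 *: x = x :> 'rV[R]_n.
  by rewrite -scalerDl -[RHS]scale1r; congr (_ *: _); lra.
rewrite /weyl_even /mid xx; congr (_ + _); rewrite -sumrN; apply: eq_bigr => j _.
rewrite -sumrN; apply: eq_bigr => k _; congr (- _).
have sA := smooth_affine 2^-1 (2^-1 *: x) (asmth j k).
rewrite (partial2M j k sA sg) (partial2_affine j k 2^-1 (2^-1 *: x) (asmth j k)).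
rewrite !(partial_affine 2^-1 (2^-1 *: x) _ (asmth j k)) xx.
move: (partial k (partial j (a j k)) x) (partial j (a j k) x) (partial k (a j k) x) (a j k x).
move: (g x) (partial j g x) (partial k g x) (partial k (partial j g) x) => g0 gj gk gjk p q r s.
by field.
Qed.

Lemma weyl_odd_diag x g : csmooth1 g -> weyl_odd x g x =
  - (\sum_j (2^-1 * partial j (b j) x * g x + b j x * partial j g x)).
Proof.
move=> [sg _].
have xx : 2^-1 *: x + 2^-1 *: x = x :> 'rV[R]_n.
  by rewrite -scalerDl -[RHS]scale1r; congr (_ *: _); lra.
rewrite /weyl_odd /mid -sumrN; apply: eq_bigr => j _; congr (- _).
have sA := smooth_affine 2^-1 (2^-1 *: x) (bsmth j).
by rewrite (partialM j sA sg) (partial_affine 2^-1 (2^-1 *: x) j (bsmth j)) xx.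
Qed.

Lemma weylE (u v : 'rV[R]_n -> R) x : csmooth1 u -> csmooth1 v ->
  weyl (fun y xi => (perturbation a b c y xi)%:C) (fun y => u y +i* v y) x =
  (weyl_even x u x - weyl_odd x v x) +i* (weyl_even x v x + weyl_odd x u x).
Proof.
move=> cu cv; rewrite /weyl.
have [sue suo] := (csmooth1_weyl_even x cu, csmooth1_weyl_odd x cu).
have [sve svo] := (csmooth1_weyl_even x cv, csmooth1_weyl_odd x cv).
have inner xi : cintegral (fun y => cis (dotp (x - y) xi) *
    (perturbation a b c (2^-1 *: (x + y)) xi)%:C * (u y +i* v y)) =
  ((osc 0 (weyl_even x u) x xi + osc (pi / 2) (weyl_odd x u) x xi) +
     (osc (pi / 2) (weyl_even x v) x xi + osc pi (weyl_odd x v) x xi)) +i*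
  ((osc 0 (weyl_even x v) x xi + osc (pi / 2) (weyl_odd x v) x xi) -
     (osc (pi / 2) (weyl_even x u) x xi + osc pi (weyl_odd x u) x xi)).
  have [wu u0] := osc_weyl 0 x xi cu; have [_ u1] := osc_weyl (pi / 2) x xi cu.
  have [wv v0] := osc_weyl 0 x xi cv; have [_ v1] := osc_weyl (pi / 2) x xi cv.
  rewrite -splitr add0r in u0 u1 v0 v1; rewrite -u0 -u1 -v0 -v1 /cintegral /osc.
  have su t : Rsummable mu (fun y => cos (dotp (x - y) xi + t) *
      (perturbation a b c (2^-1 *: (x + y)) xi * u y)).
    by have [S1 _] := smooth_phase t x xi; exact/csmooth1_Rsummable/csmooth1Ml.
  have sv t : Rsummable mu (fun y => cos (dotp (x - y) xi + t) *
      (perturbation a b c (2^-1 *: (x + y)) xi * v y)).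
    by have [S1 _] := smooth_phase t x xi; exact/csmooth1_Rsummable/csmooth1Ml.
  rewrite -RintD// -RintB//.
  by congr (_ +i* _); apply: eq_Rintegral => y _ /=; rewrite addr0 cosDpihalf; ring.
have pin : (2 * pi) ^+ n != 0 :> R by rewrite expf_neq0// mulf_neq0// gt_eqF// pi_gt0.
rewrite (funext inner).
rewrite /cintegral /=.
have inv t h (ch : csmooth1 h) := fourier_inversion x t ch.
rewrite (Rint_add4 (inv 0 _ sue) (inv (pi / 2) _ suo) (inv (pi / 2) _ sve) (inv pi _ svo)).
rewrite (Rint_sub4 (inv 0 _ sve) (inv (pi / 2) _ svo) (inv (pi / 2) _ sue) (inv pi _ suo)).
rewrite cos0 cos_pihalf cospi.
move: (weyl_even x u x) (weyl_odd x u x) (weyl_even x v x) (weyl_odd x v x) => p q p' q'.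
rewrite realC_mul.
by congr (_ +i* _); rewrite -[RHS](mulKf pin); congr (_ * _); ring.
Qed.

End weyl.

(** * Multiplier identities *)

Section null.
Context {R : realType} {n : nat}.
Notation mu := (lebesgue_rV R n).
Implicit Types (F Z : 'rV[R]_n -> R).

(** Equality modulo functions of zero integral: an integration by parts becomes the pointwise
    statement that some combination is a divergence, and can be followed by pointwise bounds. *)
Definition null Z := Rsummable mu Z /\ \int[mu]_x Z x = 0.

Lemma eq_null Z1 Z2 : Z1 =1 Z2 -> null Z1 -> null Z2.
Proof. by move=> /funext ->. Qed.

Lemma nullD Z1 Z2 : null Z1 -> null Z2 -> null (fun x => Z1 x + Z2 x).
Proof.
by move=> [s1 e1] [s2 e2]; split; [exact: RsummableD|rewrite RintD// e1 e2 addr0].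
Qed.

Lemma nullN Z : null Z -> null (fun x => - Z x).
Proof. by move=> [s e]; split; [exact: RsummableN|rewrite RintN// e oppr0]. Qed.

Lemma nullB Z1 Z2 : null Z1 -> null Z2 -> null (fun x => Z1 x - Z2 x).
Proof. by move=> n1 n2; apply: nullD => //; exact: nullN. Qed.

Lemma null0 : null (fun=> 0).
Proof. by split; [exact: Rsummable0|exact: Rint0]. Qed.

Lemma null_sum (I : Type) (r : seq I) (P : pred I) (Z : I -> 'rV[R]_n -> R) :
  (forall i, null (Z i)) -> null (fun x => \sum_(i <- r | P i) Z i x).
Proof.
move=> nZ; elim: r => [|a r IH].
  by apply: eq_null null0 => x; rewrite big_nil.
case Pa : (P a).
  by apply: eq_null (nullD (nZ a) IH) => x; rewrite big_cons Pa.
by apply: eq_null IH => x; rewrite big_cons Pa.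
Qed.

Lemma null_partial F i : csmooth1 F -> null (partial i F).
Proof.
by move=> cF; split; [exact/csmooth1_Rsummable/csmooth1_partial|exact: Rint_partial].
Qed.
End null.

Lemma sum_combine (R : pzRingType) (I : finType) (X Y Z S T : I -> R) :
  (forall j, X j = Y j - Z j - (S j - T j)) ->
  \sum_j X j = \sum_j Y j - \sum_j Z j - (\sum_j S j - \sum_j T j).
Proof. by move=> E; rewrite -!sumrB; apply: eq_bigr => j _; rewrite E. Qed.

Section identities.
Context {R : realType} {n : nat}.
Notation mu := (lebesgue_rV R n).
Variables (g : 'I_n -> 'I_n -> 'rV[R]_n -> R) (b : 'I_n -> 'rV[R]_n -> R) (q : 'rV[R]_n -> R).
Hypotheses (gsym : forall j k x, g j k x = g k j x) (sg : forall j k, smooth (g j k)).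
Hypotheses (sb : forall j, smooth (b j)) (sq : smooth q).
Implicit Types (u v phi : 'rV[R]_n -> R).

(** B and A f are the skew-symmetric operators b.grad + div b / 2 and f.grad + div f / 2, that is i
    times the Weyl quantizations of b.xi and f.xi. *)
Definition Lop u x : R :=
  - (\sum_j \sum_k partial j (fun y => g j k y * partial k u y) x) + q x * u x.
Definition Bop u x : R := \sum_j (b j x * partial j u x + 2^-1 * partial j (b j) x * u x).
Definition Aop (f : 'I_n -> 'rV[R]_n -> R) u x : R :=
  \sum_l (f l x * partial l u x + 2^-1 * partial l (f l) x * u x).

Lemma cs_flux u j k : csmooth1 u -> csmooth1 (fun y => g j k y * partial k u y).
Proof. by move=> cu; exact: (csmooth1Ml (sg j k) (csmooth1_partial k cu)). Qed.

Lemma null_energy u phi : csmooth1 u -> smooth phi ->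
  null (fun x => phi x * u x * Lop u x -
    (\sum_j \sum_k g j k x * partial k u x * (phi x * partial j u x + u x * partial j phi x) +
      phi x * q x * u x ^+ 2)).
Proof.
move=> cu sphi; have [su _] := cu.
have cpu := csmooth1Ml sphi cu; have spu := smoothM sphi su.
pose F j k x := (phi x * u x) * (g j k x * partial k u x).
have cF j k : csmooth1 (F j k) by exact: (csmooth1Ml spu (cs_flux j k cu)).
apply: (@eq_null _ _ (fun x => \sum_j \sum_k - partial j (F j k) x)); last first.
  apply: null_sum => j; apply: null_sum => k; exact: (nullN (null_partial j (cF j k))).
move=> x; rewrite /Lop.
have -> : \sum_j \sum_k - partial j (F j k) x =
  - (phi x * u x) * (\sum_j \sum_k partial j (fun y => g j k y * partial k u y) x) -
  \sum_j \sum_k g j k x * partial k u x * (phi x * partial j u x + u x * partial j phi x).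
  rewrite mulr_sumr -sumrB; apply: eq_bigr => j _; rewrite mulr_sumr -sumrB; apply: eq_bigr => k _.
  have [sf _] := cs_flux j k cu.
  rewrite /F (partialM j spu sf) (partialM j sphi su).
  move: (partial j _ x) (partial j phi x) (partial j u x) (partial k u x) => p1 p2 p3 p4; ring.
ring.
Qed.

(** Twice the pairing of A u with L u is a commutator: no second derivative of u
    survives, because those that appear form the divergence of g_jk d_j u d_k u f. *)
Lemma null_rellich u f : csmooth1 u -> (forall l, smooth (f l)) ->
  null (fun x => 2 * Aop f u x * Lop u x -
    (\sum_j \sum_k \sum_l
       (2 * g j k x * partial j (f l) x * partial k u x * partial l u x
        - f l x * partial l (g j k) x * partial j u x * partial k u x
        + g j k x * partial k u x * partial j (partial l (f l)) x * u x)
     - \sum_l f l x * partial l q x * u x ^+ 2)).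
Proof.
move=> cu sf; have [su _] := cu.
have cd l := csmooth1_partial l cu; have sd l := smooth_partial l su.
pose T j k x := partial j (fun y => g j k y * partial k u y) x.
pose m l x := 2 * (f l x * partial l u x) + partial l (f l) x * u x.
have sfl l := smooth_partial l (sf l).
have sm l : smooth (m l).
  exact: (smoothD (smoothZ 2 (smoothM (sf l) (sd l))) (smoothM (sfl l) su)).
pose F1 j k l x := m l x * (g j k x * partial k u x).
have cF1 j k l : csmooth1 (F1 j k l) by exact: (csmooth1Ml (sm l) (cs_flux j k cu)).
pose F2 j k l x := (f l x * g j k x) * (partial k u x * partial j u x).
have cF2 j k l : csmooth1 (F2 j k l).
  exact: (csmooth1Ml (smoothM (sf l) (sg j k)) (csmooth1Ml (sd k) (cd j))).
pose F3 l x := (f l x * q x) * (u x * u x).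
have cF3 l : csmooth1 (F3 l).
  exact: (csmooth1Ml (smoothM (sf l) sq) (csmooth1Ml su cu)).
pose S j k l x := f l x * g j k x * (partial k u x * partial l (partial j u) x).
apply: (@eq_null _ _ (fun x => \sum_j \sum_k \sum_l (- partial j (F1 j k l) x + partial l (F2 j k l) x)
   + \sum_l partial l (F3 l) x)); last first.
  apply: nullD; last by apply: null_sum => l; exact: null_partial.
  apply: null_sum => j; apply: null_sum => k; apply: null_sum => l.
  exact: (nullD (nullN (null_partial j (cF1 j k l))) (null_partial l (cF2 j k l))).
move=> x.
have sym : \sum_j \sum_k \sum_l S j k l x = \sum_j \sum_k \sum_l S k j l x.
  exact: exchange_big.
have E3 : \sum_l partial l (F3 l) x = \sum_l m l x * (q x * u x) + \sum_l f l x * partial l q x * u x ^+ 2.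
  rewrite -big_split; apply: eq_bigr => l _ /=.
  rewrite /F3 (partialM l (smoothM (sf l) sq) (smoothM su su)) (partialM l (sf l) sq) (partialM l su su) /m.
  move: (partial l (f l) x) (partial l q x) (partial l u x) => p1 p2 p3; ring.
have E12 : \sum_j \sum_k \sum_l (- partial j (F1 j k l) x + partial l (F2 j k l) x) =
  \sum_j \sum_k \sum_l - (m l x * T j k x) - \sum_j \sum_k \sum_l
       (2 * g j k x * partial j (f l) x * partial k u x * partial l u x
        - f l x * partial l (g j k) x * partial j u x * partial k u x
        + g j k x * partial k u x * partial j (partial l (f l)) x * u x)
  - (\sum_j \sum_k \sum_l S j k l x - \sum_j \sum_k \sum_l S k j l x).
  apply: sum_combine => j; apply: sum_combine => k; apply: sum_combine => l.
  have [sfx _] := cs_flux j k cu.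
  rewrite /F1 (partialM j (sm l) sfx) -/(T j k x) /F2.
  rewrite (partialM l (smoothM (sf l) (sg j k)) (smoothM (sd k) (sd j))).
  rewrite (partialM l (sf l) (sg j k)) (partialM l (sd k) (sd j)).
  rewrite /m (partialD j (smoothZ 2 (smoothM (sf l) (sd l))) (smoothM (sfl l) su)).
  rewrite (partialZ 2 j (smoothM (sf l) (sd l))) (partialM j (sf l) (sd l)) (partialM j (sfl l) su).
  rewrite /S (gsym k j) (partialC j l su).
  move: (T j k x) (partial l (partial j u) x) (partial l (partial k u) x) => t1 t2 t3.
  move: (partial j (partial l (f l)) x) (partial l (f l) x) (partial j (f l) x) => t4 t5 t6.
  move: (partial l (g j k) x) (partial l u x) (partial k u x) (partial j u x) => t7 t8 t9 t10.
  ring.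
have EA : 2 * Aop f u x = \sum_l m l x.
  rewrite /Aop mulr_sumr; apply: eq_bigr => l _; rewrite /m.
  by field.
have EL : 2 * Aop f u x * Lop u x =
  \sum_j \sum_k \sum_l - (m l x * T j k x) + \sum_l m l x * (q x * u x).
  rewrite EA /Lop mulrDr mulrN mulr_sumr -sumrN -mulr_suml; congr (_ + _).
  apply: eq_bigr => j _; rewrite mulr_sumr -sumrN; apply: eq_bigr => k _.
  by rewrite mulr_suml -sumrN.
have key (y z s1 s2 m' q' : R) : s1 = s2 ->
  y - z - (s1 - s2) + (m' + q') = (y + m') - (z - q') by move=> ->; ring.
apply: (etrans (congr2 +%R E12 E3)); apply: (etrans (key _ _ _ _ _ _ sym)).
by rewrite -EL.
Qed.

(** The commutator of two skew-symmetric vector fields is again one, acting on u and v through their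
    Wronskian W. *)
Lemma null_magnetic u v f : csmooth1 u -> csmooth1 v -> (forall l, smooth (f l)) ->
  let W j x := u x * partial j v x - v x * partial j u x in
  null (fun x => 2 * (Aop f u x * Bop v x - Aop f v x * Bop u x) -
    \sum_j \sum_l (b j x * partial j (f l) x * W l x - f l x * partial l (b j) x * W j x)).
Proof.
move=> cu cv sf W; have [su _] := cu; have [sv _] := cv.
have cW j : csmooth1 (W j).
  exact: (csmooth1B (csmooth1Mr cu (smooth_partial j sv)) (csmooth1Mr cv (smooth_partial j su))).
have sW j := (cW j).1.
have sfb l j := smoothM (sf l) (sb j).
pose F1 j l x := (f l x * b j x) * W j x.
pose F2 j l x := (f l x * b j x) * W l x.
have cF1 j l : csmooth1 (F1 j l) by exact: (csmooth1Ml (sfb l j) (cW j)).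
have cF2 j l : csmooth1 (F2 j l) by exact: (csmooth1Ml (sfb l j) (cW l)).
apply: (@eq_null _ _ (fun x => \sum_j \sum_l (partial l (F1 j l) x - partial j (F2 j l) x))); last first.
  apply: null_sum => j; apply: null_sum => l.
  exact: (nullB (null_partial l (cF1 j l)) (null_partial j (cF2 j l))).
move=> x.
have dW i j : partial i (W j) x = partial i u x * partial j v x + u x * partial i (partial j v) x
   - (partial i v x * partial j u x + v x * partial i (partial j u) x).
  rewrite (partialB i (smoothM su (smooth_partial j sv)) (smoothM sv (smooth_partial j su))).
  by rewrite (partialM i su (smooth_partial j sv)) (partialM i sv (smooth_partial j su)).
have -> : 2 * (Aop f u x * Bop v x - Aop f v x * Bop u x) = \sum_j \sum_l
   2 * ((f l x * partial l u x + 2^-1 * partial l (f l) x * u x) *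
        (b j x * partial j v x + 2^-1 * partial j (b j) x * v x) -
        (f l x * partial l v x + 2^-1 * partial l (f l) x * v x) *
        (b j x * partial j u x + 2^-1 * partial j (b j) x * u x)).
  rewrite /Aop /Bop !mulr_sumr -sumrB mulr_sumr; apply: eq_bigr => j _.
  by rewrite !mulr_suml -sumrB mulr_sumr.
rewrite -sumrB; apply: eq_bigr => j _; rewrite -sumrB; apply: eq_bigr => l _.
rewrite /F1 /F2 (partialM l (sfb l j) (sW j)) (partialM j (sfb l j) (sW l)).
rewrite (partialM l (sf l) (sb j)) (partialM j (sf l) (sb j)) !dW (partialC j l su) (partialC j l sv) /W.
move: (partial l (partial j u) x) (partial l (partial j v) x) (partial l u x) (partial j u x) => t1 t2 t3 t4.
move: (partial l v x) (partial j v x) (partial l (f l) x) (partial j (f l) x) => t5 t6 t7 t8.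
move: (partial l (b j) x) (partial j (b j) x) => t9 t10.
by field.
Qed.
End identities.

(** * Orders of growth and negligible terms *)

Section orders.
Context {R : realType} {n : nat}.
Implicit Types (F G : 'rV[R]_n -> R) (m p r : R) (x : 'rV[R]_n).

Definition ord m F := exists2 K : R, 0 <= K & forall x, `|F x| <= K * wgt m x.

Lemma ordW m p F : m <= p -> ord m F -> ord p F.
Proof.
move=> mp [K K0 H]; exists K => // x; apply: le_trans (H x) _.
by apply: ler_wpM2l => //; exact: ler_wgt.
Qed.

Lemma ordD m F G : ord m F -> ord m G -> ord m (fun x => F x + G x).
Proof.
move=> [K K0 HF] [L L0 HG]; exists (K + L) => [|x]; first exact: addr_ge0.
by rewrite mulrDl (le_trans (ler_normD _ _))// lerD.
Qed.

Lemma ordN m F : ord m F -> ord m (fun x => - F x).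
Proof. by move=> [K K0 HF]; exists K => // x; rewrite normrN. Qed.

Lemma ordM m p F G : ord m F -> ord p G -> ord (m + p) (fun x => F x * G x).
Proof.
move=> [K K0 HF] [L L0 HG]; exists (K * L) => [|x]; first exact: mulr_ge0.
by rewrite wgtD normrM mulrACA; apply: ler_pM.
Qed.

Lemma ord_cst (c : R) : ord 0 (fun=> c).
Proof. by exists `|c| => // x; rewrite wgt0 mulr1. Qed.

Lemma ordZ m (c : R) F : ord m F -> ord m (fun x => c * F x).
Proof. by move=> oF; rewrite -[m]add0r; exact: (ordM (ord_cst c) oF). Qed.

Lemma ord_wgt m : ord m (wgt m).
Proof. by exists 1 => // x; rewrite mul1r ger0_norm ?wgt_ge0. Qed.

Lemma ord_coord i : ord 1 (fun x => x 0 i).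
Proof. by exists 1 => // x; rewrite mul1r coord_le_wgt. Qed.

Lemma ord_partial_wgt m i : ord (m - 1) (partial i (wgt m)).
Proof.
rewrite partial_wgt; have -> : m - 1 = 1 + (m - 2) by ring.
by apply: ordM; [apply: ordZ; exact: ord_coord|exact: ord_wgt].
Qed.

Lemma ord_sum (I : Type) (s : seq I) m (F : I -> 'rV[R]_n -> R) :
  (forall i, ord m (F i)) -> ord m (fun x => \sum_(i <- s) F i x).
Proof.
move=> oF; elim: s => [|a s [K K0 HK]].
  by exists 0 => // x; rewrite big_nil normr0 mul0r.
have [L L0 HL] := oF a; exists (L + K) => [|x]; first exact: addr_ge0.
by rewrite big_cons mulrDl (le_trans (ler_normD _ _))// lerD.
Qed.

(** A weight of lower order is absorbed by one of higher order, up to a multiple of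
    any weight whatsoever, because only a bounded region is left over. *)
Lemma wgt_absorb m p r (e : R) : m < p -> 0 < e ->
  exists2 K : R, 0 <= K & forall x, wgt m x <= e * wgt p x + K * wgt r x.
Proof.
move=> mp e0; have pm : 0 < p - m by rewrite subr_gt0.
exists (Num.max 1 e^-1 `^ (`|m - r| / (p - m))) => [|x]; first exact: powR_ge0.
have [big|small] := leP e^-1 (wgt (p - m) x).
  rewrite -[leLHS]addr0; apply: lerD; last by rewrite mulr_ge0 ?powR_ge0 ?wgt_ge0.
  have -> : p = (p - m) + m by ring.
  rewrite wgtD mulrA -[leLHS]mul1r; apply: ler_wpM2r; first exact: wgt_ge0.
  by rewrite -(mulfV (lt0r_neq0 e0)) ler_pM2l.
rewrite -[leLHS]add0r; apply: lerD; first by rewrite mulr_ge0 ?wgt_ge0 ?ltW.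
rewrite -{1}(subrK r m) wgtD; apply: ler_wpM2r; first exact: wgt_ge0.
have W1 : 1 <= wgt (p - m) x by rewrite -(wgt0 x); apply: ler_wgt; exact: ltW.
apply: (@le_trans _ _ (wgt (p - m) x `^ (`|m - r| / (p - m)))).
  rewrite {2}/wgt -powRrM; apply: ler_powR; first exact: jap2_ge1.
  rewrite (_ : (p - m) / 2 * (`|m - r| / (p - m)) = `|m - r| / 2); last by field; rewrite gt_eqF.
  by rewrite ler_pM2r ?invr_gt0// ler_norm.
apply: ge0_ler_powR; rewrite ?nnegrE ?wgt_ge0 ?le_max ?ler01 ?(ltW small) ?orbT//.
by apply: divr_ge0 => //; exact: ltW.
Qed.
End orders.

Section errors.
Context {R : realType} {n : nat}.
Local Notation fct := ('rV[R]_n -> R).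
Implicit Types (T Q : fct -> fct -> fct) (u v : fct) (x : 'rV[R]_n).

Definition grad2 u v x : R := \sum_j (partial j u x ^+ 2 + partial j v x ^+ 2).
Definition mass u v x : R := u x ^+ 2 + v x ^+ 2.
(** Selects the real or the imaginary part, so that one lemma covers the four kinds of monomials. *)
Definition pk (s : bool) u v := if s then u else v.

Lemma grad2_ge0 u v x : 0 <= grad2 u v x.
Proof. by apply: sumr_ge0 => j _; rewrite addr_ge0 ?sqr_ge0. Qed.
Lemma mass_ge0 u v x : 0 <= mass u v x.
Proof. by rewrite addr_ge0 ?sqr_ge0. Qed.
Lemma pk_mass s u v x : pk s u v x ^+ 2 <= mass u v x.
Proof. by case: s; rewrite /mass /= ?lerDl ?lerDr sqr_ge0. Qed.
Lemma pk_grad2 s j u v x : partial j (pk s u v) x ^+ 2 <= grad2 u v x.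
Proof.
rewrite /grad2 (bigD1 j)//= -[leLHS]addr0 lerD//.
  by case: s; rewrite /= ?lerDl ?lerDr sqr_ge0.
by apply: sumr_ge0 => i _; rewrite addr_ge0 ?sqr_ge0.
Qed.

(** T is negligible with respect to Q1, modulo Q2; the constants are uniform in u and v. *)
Definition Err Q1 Q2 T := forall e : R, 0 < e -> exists2 K : R, 0 <= K &
  forall u v x, `|T u v x| <= e * Q1 u v x + K * Q2 u v x.

Lemma ErrD Q1 Q2 T1 T2 : Err Q1 Q2 T1 -> Err Q1 Q2 T2 ->
  Err Q1 Q2 (fun u v x => T1 u v x + T2 u v x).
Proof.
move=> E1 E2 e e0; have e20 : 0 < e / 2 by rewrite divr_gt0.
have [K K0 HK] := E1 _ e20; have [L L0 HL] := E2 _ e20.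
exists (K + L) => [|u v x]; first exact: addr_ge0.
rewrite (le_trans (ler_normD _ _))//; have := HK u v x; have := HL u v x; lra.
Qed.

Lemma ErrN Q1 Q2 T : Err Q1 Q2 T -> Err Q1 Q2 (fun u v x => - T u v x).
Proof. by move=> E e e0; have [K K0 HK] := E _ e0; exists K => // u v x; rewrite normrN. Qed.

Lemma ErrB Q1 Q2 T1 T2 : Err Q1 Q2 T1 -> Err Q1 Q2 T2 ->
  Err Q1 Q2 (fun u v x => T1 u v x - T2 u v x).
Proof. by move=> E1 E2; apply: ErrD => //; exact: ErrN. Qed.

Lemma eq_Err Q1 Q2 T1 T2 : (forall u v x, T1 u v x = T2 u v x) -> Err Q1 Q2 T1 -> Err Q1 Q2 T2.
Proof. by move=> E H e e0; have [K K0 HK] := H _ e0; exists K => // u v x; rewrite -E. Qed.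

Lemma Err0 Q1 Q2 : (forall u v x, 0 <= Q1 u v x) -> Err Q1 Q2 (fun _ _ _ => 0).
Proof. by move=> H e e0; exists 0 => // u v x; rewrite normr0 mul0r addr0 mulr_ge0// ltW. Qed.

Lemma Err_sum Q1 Q2 (I : Type) (s : seq I) (T : I -> fct -> fct -> fct) :
  (forall u v x, 0 <= Q1 u v x) -> (forall i, Err Q1 Q2 (T i)) ->
  Err Q1 Q2 (fun u v x => \sum_(i <- s) T i u v x).
Proof.
move=> Q0 ET; elim: s => [|a s IH].
  by apply: eq_Err (Err0 _ Q0) => u v x; rewrite big_nil.
by apply: eq_Err (ErrD (ET a) IH) => u v x; rewrite big_cons.
Qed.

Lemma normM_le (A B C : R) : A ^+ 2 <= B -> C ^+ 2 <= B -> `|A * C| <= B.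
Proof.
move=> AB CB; rewrite normrM.
have := sqr_ge0 (`|A| - `|C|); have hA := real_normK (num_real A); have hC := real_normK (num_real C).
rewrite -hA in AB; rewrite -hC in CB; nra.
Qed.

Lemma normM_le_split (k A B p q P Q : R) : 0 <= A -> 0 <= B -> k ^+ 2 <= A * B ->
  p ^+ 2 <= P -> q ^+ 2 <= Q -> `|k * p * q| <= A * P + B * Q.
Proof.
move=> A0 B0 kAB pP qQ.
have P0 : 0 <= P by apply: le_trans pP; exact: sqr_ge0.
have Q0 : 0 <= Q by apply: le_trans qQ; exact: sqr_ge0.
rewrite -(@ler_pXn2r _ 2) ?nnegrE ?addr_ge0 ?mulr_ge0//.
rewrite real_normK ?num_real// !exprMn.
have H1 : k ^+ 2 * p ^+ 2 * q ^+ 2 <= (A * B) * P * Q.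
  apply: ler_pM; [by rewrite mulr_ge0 ?sqr_ge0|exact: sqr_ge0| |exact: qQ].
  by apply: ler_pM; [exact: sqr_ge0|exact: sqr_ge0|exact: kAB|exact: pP].
apply: (le_trans H1); rewrite (_ : A * B * P * Q = (A * P) * (B * Q)); last by ring.
have : 0 <= A * P by exact: mulr_ge0.
have : 0 <= B * Q by exact: mulr_ge0.
move: (A * P) (B * Q) => s t s0 t0; nra.
Qed.

Section monomials.
Variables (al p1 p2 k : R).
Hypothesis k0 : 0 <= k.

(** What is to be controlled, and what is already known to be bounded: k is 0 in the first estimate
    and 1 in the second one, which takes the first for granted. *)
Definition Qtop u v x := wgt p1 x * grad2 u v x + wgt p2 x * mass u v x.
Definition Qlow u v x := k * wgt (- (2 * al)) x * grad2 u v x + mass u v x.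

Lemma Qtop_ge0 u v x : 0 <= Qtop u v x.
Proof. by rewrite addr_ge0 ?mulr_ge0 ?wgt_ge0 ?grad2_ge0 ?mass_ge0. Qed.

(** The conditions on the coefficient of a monomial of order zero, two or one in the gradient under
    which this monomial is negligible; the mixed one goes through the arithmetic-geometric mean. *)
Definition mass_small (F : fct) := forall e, 0 < e -> exists2 K : R, 0 <= K &
  forall x, `|F x| <= e * wgt p2 x + K.
Definition grad_small (F : fct) := forall e, 0 < e -> exists2 K : R, 0 <= K &
  forall x, `|F x| <= e * wgt p1 x + K * (k * wgt (- (2 * al)) x).
Definition mixed_small (F : fct) := forall e, 0 < e -> exists K (A B : fct),
  [/\ 0 <= K, forall x, 0 <= A x <= e * wgt p1 x + K * (k * wgt (- (2 * al)) x),
   forall x, 0 <= B x <= e * wgt p2 x + K & forall x, F x ^+ 2 <= A x * B x].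

Lemma Err_mass F s s' : mass_small F ->
  Err Qtop Qlow (fun u v x => F x * pk s u v x * pk s' u v x).
Proof.
move=> hF e e0; have [K K0 HK] := hF e e0; exists K => // u v x.
rewrite -mulrA normrM.
apply: (@le_trans _ _ ((e * wgt p2 x + K) * mass u v x)).
  by apply: ler_pM => //; apply: normM_le; exact: pk_mass.
have := mulr_ge0 (ltW e0) (mulr_ge0 (wgt_ge0 p1 x) (grad2_ge0 u v x)).
have := mulr_ge0 K0 (mulr_ge0 (mulr_ge0 k0 (wgt_ge0 (- (2 * al)) x)) (grad2_ge0 u v x)).
rewrite /Qtop /Qlow; lra.
Qed.

Lemma Err_grad F s s' i j : grad_small F ->
  Err Qtop Qlow (fun u v x => F x * partial i (pk s u v) x * partial j (pk s' u v) x).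
Proof.
move=> hF e e0; have [K K0 HK] := hF e e0; exists K => // u v x.
rewrite -mulrA normrM.
apply: (@le_trans _ _ ((e * wgt p1 x + K * (k * wgt (- (2 * al)) x)) * grad2 u v x)).
  by apply: ler_pM => //; apply: normM_le; exact: pk_grad2.
have := mulr_ge0 (ltW e0) (mulr_ge0 (wgt_ge0 p2 x) (mass_ge0 u v x)).
have := mulr_ge0 K0 (mass_ge0 u v x).
rewrite /Qtop /Qlow; lra.
Qed.

Lemma Err_mixed F s s' i : mixed_small F ->
  Err Qtop Qlow (fun u v x => F x * partial i (pk s u v) x * pk s' u v x).
Proof.
move=> hF e e0; have [K [A [B [K0 hA hB hAB]]]] := hF e e0; exists K => // u v x.
have /andP[A0 A1] := hA x; have /andP[B0 B1] := hB x.
apply: (le_trans (normM_le_split A0 B0 (hAB x) (pk_grad2 s i u v x) (pk_mass s' u v x))).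
have := ler_wpM2r (grad2_ge0 u v x) A1; have := ler_wpM2r (mass_ge0 u v x) B1.
rewrite /Qtop /Qlow; lra.
Qed.
End monomials.
End errors.

Section symbols.
Context {R : realType} {n : nat}.
Implicit Types (F G : 'rV[R]_n -> R) (m p : R).

(** Two derivatives are enough: the multiplier identities differentiate the vector field at most
    twice. *)
Definition symb m F := [/\ smooth F, ord m F, forall j, ord (m - 1) (partial j F) &
  forall j k, ord (m - 2) (partial k (partial j F))].

Lemma symb_cst (c : R) : symb 0 (fun _ : 'rV[R]_n => c).
Proof.
have o0 m : ord m (fun _ : 'rV[R]_n => 0) by exists 0 => // x; rewrite normr0 mul0r.
split; [exact: smooth_cst|exact: ord_cst|..] => j; first by rewrite partial_cst.
by move=> k; rewrite partial_cst partial_cst.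
Qed.

Lemma symb_coord i : symb 1 (fun x : 'rV[R]_n => x 0 i).
Proof.
split; [exact: smooth_coord|exact: ord_coord|..] => j.
  by rewrite partial_coord subrr; exact: ord_cst.
move=> k; rewrite partial_coord partial_cst.
by exists 0 => // x; rewrite normr0 mul0r.
Qed.

Lemma symbD m F G : symb m F -> symb m G -> symb m (fun x => F x + G x).
Proof.
move=> [sF oF pF ppF] [sG oG pG ppG].
split; [exact: (smoothD sF sG)|exact: (ordD oF oG)|..] => j.
  by rewrite (partialD j sF sG); exact: (ordD (pF j) (pG j)).
move=> k; rewrite (partialD j sF sG) (partialD k (smooth_partial j sF) (smooth_partial j sG)).
exact: (ordD (ppF j k) (ppG j k)).
Qed.

Lemma symbM m p F G : symb m F -> symb p G -> symb (m + p) (fun x => F x * G x).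
Proof.
move=> [sF oF pF ppF] [sG oG pG ppG].
split; [exact: (smoothM sF sG)|exact: (ordM oF oG)|..] => j.
  rewrite (partialM j sF sG); apply: ordD.
    by rewrite addrAC; exact: (ordM (pF j) oG).
  by rewrite -addrA; exact: (ordM oF (pG j)).
move=> k; rewrite (partial2M j k sF sG).
have E : m - 1 + (p - 1) = m + p - 2 by ring.
apply: ordD; apply: ordD.
- by rewrite addrAC; exact: (ordM (ppF j k) oG).
- by rewrite -E; exact: (ordM (pF j) (pG k)).
- by rewrite -E; exact: (ordM (pF k) (pG j)).
- by rewrite -addrA; exact: (ordM oF (ppG j k)).
Qed.

Lemma symbZ m (c : R) F : symb m F -> symb m (fun x => c * F x).
Proof. by move=> sF; rewrite -[m]add0r; exact: (symbM (symb_cst c) sF). Qed.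

Lemma symbB m F G : symb m F -> symb m G -> symb m (fun x => F x - G x).
Proof.
move=> sF sG; have -> : (fun x => F x - G x) = (fun x => F x + -1 * G x).
  by apply/funext => x; rewrite mulN1r.
exact: (symbD sF (symbZ (-1) sG)).
Qed.

Lemma symbW m p F : m <= p -> symb m F -> symb p F.
Proof.
move=> mp [sF oF pF ppF].
have mp1 : m - 1 <= p - 1 by rewrite lerD2r.
have mp2 : m - 2 <= p - 2 by rewrite lerD2r.
split; [exact: sF|exact: (ordW mp oF)|move=> j|move=> j k].
  exact: (ordW mp1 (pF j)).
exact: (ordW mp2 (ppF j k)).
Qed.

Lemma symb_wgt m : symb m (wgt m : 'rV[R]_n -> R).
Proof.
split; [exact: smooth_wgt|exact: ord_wgt|exact: ord_partial_wgt|] => j k.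
rewrite (partial_wgt m j).
have sx : smooth (fun x : 'rV[R]_n => m * x 0 j) by apply: smoothZ; exact: smooth_coord.
rewrite (partialM k sx (smooth_wgt (m - 2))) (partialZ m k (smooth_coord j)) partial_coord.
apply: ordD.
  rewrite -[X in ord X]add0r; apply: ordM; [exact: ord_cst|exact: ord_wgt].
rewrite [X in ord X](_ : m - 2 = 1 + (m - 2 - 1)); last by ring.
by apply: ordM; [apply: ordZ; exact: ord_coord|exact: ord_partial_wgt].
Qed.
End symbols.

Section small_coefficients.
Context {R : realType} {n : nat}.
Variables (al p1 p2 k : R).
Implicit Types (F : 'rV[R]_n -> R) (m : R).

Lemma mass_small_ord0 F : ord 0 F -> mass_small p2 F.
Proof.
move=> [K K0 HK] e e0; exists K => // x; apply: le_trans (HK x) _.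
by rewrite wgt0 mulr1 lerDr mulr_ge0 ?wgt_ge0// ltW.
Qed.

Lemma ord_absorb m p s F : m < p -> ord m F -> forall e, 0 < e -> exists2 K : R, 0 <= K &
  forall x, `|F x| <= e * wgt p x + K * wgt s x.
Proof.
move=> mp [K K0 HK] e e0.
have K1 : 0 < K + 1 by rewrite ltr_wpDl.
have [L L0 HL] := wgt_absorb (n := n) s mp (divr_gt0 e0 K1).
exists ((K + 1) * L) => [|x]; first by rewrite mulr_ge0// ltW.
apply: le_trans (HK x) _.
apply: (@le_trans _ _ ((K + 1) * wgt m x)).
  by apply: ler_wpM2r; [exact: wgt_ge0|rewrite lerDl].
apply: (le_trans (ler_wpM2l (ltW K1) (HL x))).
have Ee : (K + 1) * e / (K + 1) = e by field; rewrite gt_eqF.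
by rewrite mulrDr !mulrA lerD2r Ee.
Qed.

Lemma mass_small_lt m F : m < p2 -> ord m F -> mass_small p2 F.
Proof.
move=> mp oF e e0; have [K K0 HK] := ord_absorb 0 mp oF e0.
by exists K => // x; have := HK x; rewrite wgt0 mulr1.
Qed.

Lemma grad_small_lt m F : m < p1 -> ord m F -> grad_small al p1 1 F.
Proof.
move=> mp oF e e0; have [K K0 HK] := ord_absorb (- (2 * al)) mp oF e0.
by exists K => // x; rewrite mul1r.
Qed.

(** A coefficient O(<x>^(-al)) pairs the gradient with exactly the weight <x>^(-2 al), and the
    arithmetic-geometric mean makes its share as small as desired. *)
Lemma mixed_small_top F : p1 = - (2 * al) -> ord (- al) F -> 0 <= k -> mixed_small al p1 p2 k F.
Proof.
move=> p1E [K K0 HK] k0 e e0.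
exists (K ^+ 2 / e), (fun x => e * wgt (- (2 * al)) x), (fun=> K ^+ 2 / e).
have Ke : 0 <= K ^+ 2 / e by rewrite divr_ge0 ?sqr_ge0// ltW.
split=> [//|x|x|x].
- rewrite p1E mulr_ge0 ?wgt_ge0 ?(ltW e0)//= lerDl.
  by rewrite mulr_ge0// mulr_ge0// wgt_ge0.
- by rewrite Ke/= lerDr mulr_ge0 ?wgt_ge0// ltW.
- rewrite -(real_normK (num_real (F x))).
  apply: (@le_trans _ _ ((K * wgt (- al) x) ^+ 2)).
    by rewrite ler_pXn2r ?nnegrE ?mulr_ge0 ?wgt_ge0.
  rewrite exprMn [wgt (- al) x ^+ 2]expr2 -wgtD (_ : - al - al = - (2 * al)); last by ring.
  by rewrite le_eqVlt; apply/orP; left; apply/eqP; field; rewrite gt_eqF.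
Qed.

(** The same coefficient, when the weighted gradient is already under control. *)
Lemma mixed_small_low F : ord (- al) F -> mixed_small al p1 p2 1 F.
Proof.
move=> [K K0 HK] e e0.
exists K, (fun x => K * wgt (- (2 * al)) x), (fun=> K).
split=> [//|x|x|x].
- by rewrite mulr_ge0 ?wgt_ge0//= mul1r lerDr mulr_ge0 ?wgt_ge0// ltW.
- by rewrite K0/= lerDr mulr_ge0 ?wgt_ge0// ltW.
- rewrite -(real_normK (num_real (F x))).
  apply: (@le_trans _ _ ((K * wgt (- al) x) ^+ 2)).
    by rewrite ler_pXn2r ?nnegrE ?mulr_ge0 ?wgt_ge0.
  rewrite exprMn [wgt (- al) x ^+ 2]expr2 -wgtD (_ : - al - al = - (2 * al)); last by ring.
  by rewrite le_eqVlt; apply/orP; left; apply/eqP; ring.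
Qed.

Lemma mixed_small_lt m m1 m2 F : m + m = m1 + m2 -> m1 < p1 -> m2 < p2 -> ord m F ->
  mixed_small al p1 p2 1 F.
Proof.
move=> mE l1 l2 [K K0 HK] e e0.
have o1 : ord m1 (fun x : 'rV[R]_n => K * wgt m1 x) by apply: ordZ; exact: ord_wgt.
have o2 : ord m2 (fun x : 'rV[R]_n => K * wgt m2 x) by apply: ordZ; exact: ord_wgt.
have [K1 K10 H1] := ord_absorb (- (2 * al)) l1 o1 e0.
have [K2 K20 H2] := ord_absorb 0 l2 o2 e0.
have P1 x : 0 <= K * wgt m1 x by rewrite mulr_ge0 ?wgt_ge0.
have P2 x : 0 <= K * wgt m2 x by rewrite mulr_ge0 ?wgt_ge0.
exists (K1 + K2), (fun x => K * wgt m1 x), (fun x => K * wgt m2 x); split=> [|x|x|x].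
- exact: addr_ge0.
- rewrite P1/=; have := H1 x; rewrite ger0_norm// mul1r => /le_trans; apply.
  by rewrite lerD2l; apply: ler_wpM2r; [exact: wgt_ge0|rewrite lerDl].
- rewrite P2/=; have := H2 x; rewrite ger0_norm// wgt0 mulr1 => /le_trans; apply.
  by rewrite lerD2l lerDr.
- rewrite -(real_normK (num_real (F x))).
  apply: (@le_trans _ _ ((K * wgt m x) ^+ 2)).
    by rewrite ler_pXn2r ?nnegrE ?mulr_ge0 ?wgt_ge0.
  rewrite exprMn [wgt m x ^+ 2]expr2 -wgtD mE wgtD.
  by rewrite le_eqVlt; apply/orP; left; apply/eqP; ring.
Qed.
End small_coefficients.

Lemma null_le {R : realType} {n : nat} (Z A B : 'rV[R]_n -> R) : null Z ->
  Rsummable (lebesgue_rV R n) A -> Rsummable (lebesgue_rV R n) B ->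
  (forall x, A x <= B x - Z x) ->
  \int[lebesgue_rV R n]_x A x <= \int[lebesgue_rV R n]_x B x.
Proof.
move=> [sZ iZ] sA sB AB; rewrite -[leRHS]subr0 -iZ -(RintB sB sZ).
by apply: Rint_le => //; exact: RsummableB.
Qed.

(** * The two weighted estimates *)

Section estimates.
Context {R : realType} {n : nat}.
Notation mu := (lebesgue_rV R n).
Local Notation fct := ('rV[R]_n -> R).
Variables (al de c0 : R).
Variables (a : 'I_n -> 'I_n -> fct) (b : 'I_n -> fct) (r : fct).
Hypotheses (al0 : 0 < al) (de0 : 0 < de) (de1 : de <= 1) (c00 : 0 < c0).
Hypotheses (asym : forall j k x, a j k x = a k j x).
Hypotheses (sa : forall j k, smooth (a j k)) (sb : forall j, smooth (b j)) (sr : smooth r).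
Hypotheses (oa : forall j k, ord (- (2 * de)) (a j k))
  (oda : forall j k l, ord (- (2 * de) - 1) (partial l (a j k))).
Hypotheses (ob : forall j, ord (al - 2 * de) (b j))
  (odb : forall j l, ord (al - 2 * de - 1) (partial l (b j))).
Hypotheses (or : ord (2 * al - 2 * de) r) (odr : forall l, ord (2 * al - 2 * de - 1) (partial l r)).

Definition gmet j k : fct := fun x => (j == k)%:R + a j k x.
Definition qpot : fct := fun x => - wgt (2 * al) x + r x.
Hypothesis ell : forall x (z : 'I_n -> R),
  c0 * \sum_j z j ^+ 2 <= \sum_j \sum_k gmet j k x * z k * z j.

Definition Pre u v : fct := fun x => Lop gmet qpot u x + Bop b v x.
Definition Pim u v : fct := fun x => Lop gmet qpot v x - Bop b u x.
Definition Psq u v : fct := fun x => Pre u v x ^+ 2 + Pim u v x ^+ 2.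

Lemma gsym j k x : gmet j k x = gmet k j x.
Proof. by rewrite /gmet eq_sym asym. Qed.
Lemma sg j k : smooth (gmet j k).
Proof. exact: (smoothD (smooth_cst _) (sa j k)). Qed.
Lemma sq : smooth qpot.
Proof. exact: (smoothD (smoothN (smooth_wgt _)) sr). Qed.
Lemma og j k : ord 0 (gmet j k).
Proof.
apply: ordD; first exact: ord_cst.
by apply: ordW (oa j k); rewrite oppr_le0 mulr_ge0// ltW.
Qed.
Lemma oq : ord (2 * al) qpot.
Proof.
apply: ordD; first exact: (ordN (ord_wgt _)).
by apply: ordW or; rewrite gerBl mulr_ge0// ltW.
Qed.

Lemma csmooth1_Lop u : csmooth1 u -> csmooth1 (Lop gmet qpot u).
Proof.
move=> cu; apply: csmooth1D; last exact: (csmooth1Ml sq cu).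
apply: csmooth1N; apply: csmooth1_sum => j; apply: csmooth1_sum => k.
exact: (csmooth1_partial j (cs_flux sg j k cu)).
Qed.

Lemma csmooth1_Bop u : csmooth1 u -> csmooth1 (Bop b u).
Proof.
move=> cu; apply: csmooth1_sum => j; apply: csmooth1D.
  exact: (csmooth1Ml (sb j) (csmooth1_partial j cu)).
exact: (csmooth1Ml (smoothZ 2^-1 (smooth_partial j (sb j))) cu).
Qed.

Lemma csmooth1_Pre u v : csmooth1 u -> csmooth1 v -> csmooth1 (Pre u v).
Proof. by move=> cu cv; exact: (csmooth1D (csmooth1_Lop cu) (csmooth1_Bop cv)). Qed.
Lemma csmooth1_Pim u v : csmooth1 u -> csmooth1 v -> csmooth1 (Pim u v).
Proof. by move=> cu cv; exact: (csmooth1B (csmooth1_Lop cv) (csmooth1_Bop cu)). Qed.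

Lemma csmooth1_sqr (u : fct) : csmooth1 u -> csmooth1 (fun x => u x ^+ 2).
Proof. by move=> cu; have [su _] := cu; exact: (csmooth1Ml su cu). Qed.

Lemma csmooth1_mass (u v : fct) : csmooth1 u -> csmooth1 v -> csmooth1 (mass u v).
Proof. by move=> cu cv; exact: (csmooth1D (csmooth1_sqr cu) (csmooth1_sqr cv)). Qed.
Lemma csmooth1_Psq u v : csmooth1 u -> csmooth1 v -> csmooth1 (Psq u v).
Proof. by move=> cu cv; exact: (csmooth1_mass (csmooth1_Pre cu cv) (csmooth1_Pim cu cv)). Qed.
Lemma csmooth1_grad2 (u v : fct) : csmooth1 u -> csmooth1 v -> csmooth1 (grad2 u v).
Proof.
move=> cu cv; apply: csmooth1_sum => j.
exact: (csmooth1_mass (csmooth1_partial j cu) (csmooth1_partial j cv)).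
Qed.

(** The terms obtained by pairing with phi times the function: the flux through the gradient of
    phi, the main term, and the magnetic term. *)
Definition Tgrad phi (w : fct) : fct := fun x =>
  \sum_j \sum_k gmet j k x * partial k w x * (w x * partial j phi x).
Definition Mgrad phi (w : fct) : fct := fun x =>
  \sum_j \sum_k gmet j k x * partial k w x * (phi x * partial j w x).
Definition Tmag phi (u v : fct) : fct := fun x =>
  \sum_j phi x * b j x * (u x * partial j v x - v x * partial j u x).

Lemma null_weighted phi u v : smooth phi -> csmooth1 u -> csmooth1 v ->
  null (fun x => (phi x * u x * Pre u v x + phi x * v x * Pim u v x) -
    ((Mgrad phi u x + Mgrad phi v x) + (Tgrad phi u x + Tgrad phi v x) +
     phi x * qpot x * (u x ^+ 2 + v x ^+ 2) + Tmag phi u v x)).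
Proof.
move=> sphi cu cv.
have Nu := null_energy qpot sg cu sphi.
have Nv := null_energy qpot sg cv sphi.
apply: eq_null (nullD Nu Nv) => x.
have split w : \sum_j \sum_k gmet j k x * partial k w x * (phi x * partial j w x + w x * partial j phi x)
   = Mgrad phi w x + Tgrad phi w x.
  rewrite -big_split; apply: eq_bigr => j _; rewrite -big_split; apply: eq_bigr => k _.
  exact: mulrDr.
have mag : phi x * u x * Bop b v x - phi x * v x * Bop b u x = Tmag phi u v x.
  rewrite /Bop !mulr_sumr -sumrB; apply: eq_bigr => j _.
  move: (partial j u x) (partial j v x) (partial j (b j) x) => p1 p2 p3; ring.
rewrite !split /Pre /Pim -mag.
move: (Mgrad phi u x) (Mgrad phi v x) (Tgrad phi u x) (Tgrad phi v x) => m1 m2 t1 t2.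
move: (Lop gmet qpot u x) (Lop gmet qpot v x) (Bop b v x) (Bop b u x) => l1 l2 b1 b2; ring.
Qed.

Section Err_weighted.
Variables (p1 p2 k : R) (phi : fct).
Hypothesis k0 : 0 <= k.
Let E := Err (Qtop (n := n) p1 p2) (Qlow al k).
Let Q0 := @Qtop_ge0 R n p1 p2.

Lemma Err_Tgrad s : (forall j k', mixed_small al p1 p2 k (fun x => gmet j k' x * partial j phi x)) ->
  E (fun u v => Tgrad phi (pk s u v)).
Proof.
move=> H; apply: (Err_sum _ Q0) => j; apply: (Err_sum _ Q0) => k'.
apply: (eq_Err _ (Err_mixed s s k' (H j k'))) => u v x.
move: (partial k' (pk s u v) x) (partial j phi x) => t1 t2; ring.
Qed.

Lemma Err_Tmag : (forall j, mixed_small al p1 p2 k (fun x => phi x * b j x)) ->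
  E (Tmag phi).
Proof.
move=> H; apply: (Err_sum _ Q0) => j.
apply: (eq_Err _ (ErrB (Err_mixed false true j (H j)) (Err_mixed true false j (H j)))) => u v x.
rewrite /pk; move: (partial j u x) (partial j v x) => t1 t2; ring.
Qed.

Lemma Err_pot (F : fct) : mass_small p2 F -> E (fun u v x => F x * (u x ^+ 2 + v x ^+ 2)).
Proof.
move=> H; apply: (eq_Err _ (ErrD (Err_mass al p1 k0 true true H) (Err_mass al p1 k0 false false H))) => u v x.
rewrite /pk; ring.
Qed.
End Err_weighted.

(** Pairing with <x>^(-2 al) times the function: the potential becomes bounded, the main term is
    coercive, and every other term pairs a gradient with a coefficient O(<x>^(-al)). *)
Theorem gradient_estimate : exists2 C : R, 0 <= C & forall u v, csmooth1 u -> csmooth1 v ->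
  \int[mu]_x (wgt (- (2 * al)) x * grad2 u v x) <=
  C * (\int[mu]_x mass u v x + \int[mu]_x Psq u v x).
Proof.
pose phi := wgt (- (2 * al)) : fct.
have sphi : smooth phi by exact: smooth_wgt.
have al2 : - (2 * al) <= 0 by rewrite oppr_le0 mulr_ge0// ltW.
pose T u v x := (Tgrad phi u x + Tgrad phi v x) +
     phi x * qpot x * (u x ^+ 2 + v x ^+ 2) + Tmag phi u v x.
have ET : Err (Qtop (n := n) (- (2 * al)) 0) (Qlow al 0) T.
  apply: ErrD; first apply: ErrD; first apply: ErrD.
  - apply: (Err_Tgrad true) => j k; apply: (mixed_small_top _ (erefl _) _ (lexx 0)).
    apply: (@ordW _ _ (0 + (- (2 * al) - 1))); first by have := al0; lra.
    exact: (ordM (og j k) (ord_partial_wgt _ j)).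
  - apply: (Err_Tgrad false) => j k; apply: (mixed_small_top _ (erefl _) _ (lexx 0)).
    apply: (@ordW _ _ (0 + (- (2 * al) - 1))); first by have := al0; lra.
    exact: (ordM (og j k) (ord_partial_wgt _ j)).
  - apply: (Err_pot _ (lexx 0)); apply: mass_small_ord0.
    by rewrite -(addNr (2 * al)); exact: (ordM (ord_wgt _) oq).
  - apply: Err_Tmag => j; apply: (mixed_small_top _ (erefl _) _ (lexx 0)).
    apply: (@ordW _ _ (- (2 * al) + (al - 2 * de))); first by have := de0; lra.
    exact: (ordM (ord_wgt _) (ob j)).
have [K K0 HK] := ET _ (divr_gt0 c00 (ltr0n R 2)).
pose C := c0 / 2 + K + 1.
have c2 : 0 <= c0 / 2 by rewrite divr_ge0 ?(ltW c00).
have C0 : 0 <= C by rewrite !addr_ge0.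
exists (2 / c0 * C) => [|u v cu cv]; first by rewrite mulr_ge0 ?divr_ge0 ?(ltW c00).
have N := null_weighted sphi cu cv.
have sM := csmooth1_Rsummable (csmooth1_mass cu cv).
have sP := csmooth1_Rsummable (csmooth1_Psq cu cv).
have sG := csmooth1_Rsummable (csmooth1Ml sphi (csmooth1_grad2 cu cv)).
have key : \int[mu]_x (c0 / 2 * (phi x * grad2 u v x)) <=
    \int[mu]_x (C * mass u v x + Psq u v x).
  apply: (null_le N); [exact: (RsummableZ _ sG)|exact: (RsummableD (RsummableZ _ sM) sP)|move=> x].
  have := HK u v x; rewrite /T /Qtop /Qlow wgt0 mul1r !mul0r add0r.
  have p01 : 0 <= phi x <= 1 by rewrite wgt_ge0 wgt_le1.
  have El (w : fct) : c0 * (phi x * \sum_j partial j w x ^+ 2) <= Mgrad phi w x.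
    have -> : Mgrad phi w x = phi x * \sum_j \sum_k gmet j k x * partial k w x * partial j w x.
      rewrite mulr_sumr; apply: eq_bigr => j _; rewrite mulr_sumr; apply: eq_bigr => k _.
      exact: mulrCA.
    rewrite mulrCA; apply: ler_wpM2l; first by case/andP: p01.
    exact: (ell x (fun j => partial j w x)).
  have GE : grad2 u v x = \sum_j partial j u x ^+ 2 + \sum_j partial j v x ^+ 2.
    by rewrite /grad2 big_split.
  have := El u; have := El v.
  have AM (s t : R) : phi x * s * t <= s ^+ 2 + t ^+ 2.
    have := sqr_ge0 (s - t); have := sqr_ge0 (s + t); case/andP: p01; nra.
  have := AM (u x) (Pre u v x); have := AM (v x) (Pim u v x).
  have mu0 := mass_ge0 u v x.
  rewrite -/(phi x) GE /Psq ler_norml.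
  rewrite /mass in mu0 *; rewrite /C.
  move: (\sum_j partial j u x ^+ 2) (\sum_j partial j v x ^+ 2) => g1 g2.
  move: (Mgrad phi u x) (Mgrad phi v x) (Tgrad phi u x) (Tgrad phi v x) (Tmag phi u v x) => m1 m2 t1 t2 t3.
  move: (qpot x) (Pre u v x) (Pim u v x) => q0 r1 r2.
  move: (phi x * q0 * (u x ^+ 2 + v x ^+ 2)) (phi x * u x * r1) (phi x * v x * r2) => t4 x1 x2.
  move: (u x ^+ 2) (v x ^+ 2) (r1 ^+ 2) (r2 ^+ 2) mu0 => uu vv rr1 rr2 mu0 h1 h2 h3 h4 /andP[h5 h6].
  lra.
rewrite (RintZ _ sG) (RintD (RsummableZ _ sM) sP) (RintZ _ sM) in key.
have IP : 0 <= \int[mu]_x Psq u v x by apply: Rint_ge0 => x; exact: mass_ge0.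
have C1 : 1 <= C by rewrite lerDr addr_ge0.
rewrite -(ler_pM2l (divr_gt0 c00 (ltr0n R 2))).
apply: (le_trans key).
have -> (s : R) : c0 / 2 * (2 / c0 * C * s) = C * s by field; rewrite gt_eqF.
by rewrite mulrDr lerD2l ler_peMl.
Qed.

(** The radial multiplier radF x.grad of the second estimate quantizes the escape function, radG is
    the radial derivative of radF divided by |x|, and psi is the zeroth order correction. *)
Definition radF : fct := fun x => 2 * wgt (- 1 - al) x - wgt (- 1 - al - de) x.
Definition radG : fct := fun x => 2 * (- 1 - al) * wgt (- 3 - al) x
  - (- 1 - al - de) * wgt (- 3 - al - de) x.
Definition fld l : fct := fun x => x 0 l * radF x.
Definition psi : fct := fun x => 2 * al * radF x - de * wgt (- 1 - al - de) x.

Lemma symb_radF : symb (- 1 - al) radF.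
Proof.
apply: symbB; first exact: (symbZ 2 (symb_wgt _)).
by apply: (symbW _ (symb_wgt _)); have := de0; lra.
Qed.

Lemma symb_fld l : symb (- al) (fld l).
Proof. by rewrite (_ : - al = 1 + (- 1 - al)); [exact: (symbM (symb_coord l) symb_radF)|ring]. Qed.

Lemma symb_psi : symb (- 1 - al) psi.
Proof.
apply: symbB; first exact: (symbZ (2 * al) symb_radF).
by apply: (symbW _ (symbZ de (symb_wgt _))); have := de0; lra.
Qed.

Lemma partial_radF j : partial j radF = fun x => x 0 j * radG x.
Proof.
rewrite (partialB j (smoothZ 2 (smooth_wgt _)) (smooth_wgt _)) (partialZ 2 j (smooth_wgt _)) !partial_wgt.
apply/funext => x; rewrite /radG.
have -> : - 1 - al - 2 = - 3 - al by ring.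
have -> : - 1 - al - de - 2 = - 3 - al - de by ring.
ring.
Qed.

Lemma partial_fld j l x : partial j (fld l) x = (l == j)%:R * radF x + x 0 l * (x 0 j * radG x).
Proof.
have [sF _ _ _] := symb_radF.
by rewrite (partialM j (smooth_coord l) sF) partial_coord partial_radF.
Qed.

Lemma sum_CS (y z : 'I_n -> R) : (\sum_j y j * z j) ^+ 2 <= (\sum_j y j ^+ 2) * \sum_j z j ^+ 2.
Proof.
have : 0 <= \sum_j \sum_l (y j * z l - y l * z j) ^+ 2.
  by apply: sumr_ge0 => j _; apply: sumr_ge0 => l _; exact: sqr_ge0.
have -> : \sum_j \sum_l (y j * z l - y l * z j) ^+ 2 =
   \sum_j \sum_l (y j ^+ 2 * z l ^+ 2) + \sum_j \sum_l (z j ^+ 2 * y l ^+ 2)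
   - 2 * \sum_j \sum_l ((y j * z j) * (y l * z l)).
  rewrite mulr_sumr -big_split -sumrB; apply: eq_bigr => j _ /=.
  rewrite mulr_sumr -big_split -sumrB; apply: eq_bigr => l _ /=; ring.
have P (p q : 'I_n -> R) : \sum_j \sum_l (p j * q l) = (\sum_j p j) * \sum_l q l.
  by rewrite mulr_suml; apply: eq_bigr => j _; rewrite mulr_sumr.
rewrite !P; move: (\sum_j y j * z j) (\sum_j y j ^+ 2) (\sum_j z j ^+ 2) => s t w; lra.
Qed.

Definition Kin (w : fct) : fct := fun x =>
  \sum_j \sum_k \sum_l 2 * (j == k)%:R * partial j (fld l) x * partial k w x * partial l w x +
  \sum_j \sum_k (j == k)%:R * partial k w x * (psi x * partial j w x).

(** The kinetic term: psi is chosen so that the coefficients of <x>^(-1-al) cancel. *)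
Lemma Kin_ge w x : de * wgt (- 1 - al - de) x * \sum_j partial j w x ^+ 2 <= Kin w x.
Proof.
have col (h : 'I_n -> 'I_n -> R) : \sum_j \sum_k (j == k)%:R * h j k = \sum_j h j j.
  apply: eq_bigr => j _; rewrite (bigD1 j)//= eqxx mul1r big1 ?addr0// => k kj.
  by rewrite eq_sym (negbTE kj) mul0r.
have -> : Kin w x = 2 * radF x * (\sum_j partial j w x ^+ 2) +
   2 * radG x * (\sum_j x 0 j * partial j w x) ^+ 2 + psi x * \sum_j partial j w x ^+ 2.
  rewrite /Kin; congr (_ + _); last first.
    under eq_bigr do under eq_bigr do rewrite -mulrA.
    rewrite col mulr_sumr; apply: eq_bigr => j _; rewrite expr2; exact: mulrCA.
  transitivity (\sum_j \sum_k (j == k)%:R * (\sum_l 2 * partial j (fld l) x * partial k w x * partial l w x)).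
    apply: eq_bigr => j _; apply: eq_bigr => k _; rewrite mulr_sumr; apply: eq_bigr => l _.
    move: (partial j (fld l) x) (partial k w x) (partial l w x) => t1 t2 t3; ring.
  rewrite col expr2 mulr_suml !mulr_sumr -big_split; apply: eq_bigr => j _ /=.
  transitivity (\sum_l ((l == j)%:R * (2 * radF x * partial j w x * partial l w x) +
     2 * radG x * ((x 0 j * partial j w x) * (x 0 l * partial l w x)))).
    apply: eq_bigr => l _; rewrite partial_fld.
    move: (partial j w x) (partial l w x) => t1 t2; ring.
  rewrite big_split /= mulr_sumr mulr_sumr; congr (_ + _).
  rewrite (bigD1 j)//= eqxx big1 => [|l /negbTE ->]; last by rewrite mul0r.
  by rewrite addr0 mul1r expr2 mulrA.
set S := \sum_j partial j w x ^+ 2.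
have S0 : 0 <= S by apply: sumr_ge0 => j _; exact: sqr_ge0.
have G0 : radG x <= 0.
  have := ler_wgt x (_ : - 3 - al - de <= - 3 - al).
  have := wgt_ge0 (- 3 - al) x; have := wgt_ge0 (- 3 - al - de) x.
  rewrite /radG; move: (wgt (- 3 - al) x) (wgt (- 3 - al - de) x) => A B B0 A0 H.
  have {}H : B <= A by apply: H; have := de0; lra.
  have : (1 + al + de) * B <= (1 + al + de) * A.
    by apply: ler_wpM2l => //; have := de0; have := al0; lra.
  have : 0 <= (1 + al - de) * A by apply: mulr_ge0 => //; have := de1; have := al0; lra.
  lra.
have CS : (\sum_j x 0 j * partial j w x) ^+ 2 <= jap2 x * S.
  apply: (le_trans (sum_CS _ _)); apply: ler_wpM2r => //.
  rewrite /jap2 /dotp; under eq_bigr do rewrite expr2.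
  by rewrite lerDr.
have GJ : radG x * jap2 x = 2 * (- 1 - al) * wgt (- 1 - al) x - (- 1 - al - de) * wgt (- 1 - al - de) x.
  rewrite /radG -wgt2 (_ : - 1 - al - de = (- 3 - al - de) + 2); last by ring.
  rewrite [X in _ = 2 * (_ - al) * wgt X x - _](_ : _ = (- 3 - al) + 2); last by ring.
  rewrite !wgtD; ring.
have := ler_wnM2l G0 CS; rewrite mulrA GJ /psi /radF.
move: (radG x) (_ ^+ 2) => g d.
move: (wgt (- 1 - al) x) (wgt (- 1 - al - de) x) => A B H.
lra.
Qed.

Let p1 : R := - 1 - al - de.
Let p2 : R := al - 1 - de.

(** The other half of the same choice: the leading parts of the potential terms cancel as well, and
    what remains grows like <x>^(al - 1 - de). *)
Lemma Pot_E x : \sum_l fld l x * partial l (wgt (2 * al)) x - psi x * wgt (2 * al) x =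
  de * wgt p2 x - 2 * al * radF x * wgt (2 * al - 2) x.
Proof.
have -> : \sum_l fld l x * partial l (wgt (2 * al)) x =
   2 * al * radF x * wgt (2 * al - 2) x * dotp x x.
  rewrite /dotp mulr_sumr; apply: eq_bigr => l _; rewrite partial_wgt /fld; ring.
have -> : dotp x x = wgt 2 x - 1 by rewrite wgt2 /jap2; ring.
have E1 : wgt (2 * al - 2) x * wgt 2 x = wgt (2 * al) x by rewrite -wgtD subrK.
have E2 : wgt p2 x = wgt (- 1 - al - de) x * wgt (2 * al) x.
  by rewrite -wgtD; congr wgt; rewrite /p2; ring.
rewrite E2 /psi -E1; ring.
Qed.

(** The remaining terms of the identity, where either a derivative of a, b, r or one more derivative
    of the multiplier occurs. *)
Definition Er1 (w : fct) : fct := fun x => \sum_j \sum_k \sum_l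
  2 * a j k x * partial j (fld l) x * partial k w x * partial l w x.
Definition Er2 (w : fct) : fct := fun x => \sum_j \sum_k \sum_l
  fld l x * partial l (a j k) x * partial j w x * partial k w x.
Definition Er3 (w : fct) : fct := fun x => \sum_j \sum_k \sum_l
  gmet j k x * partial k w x * partial j (partial l (fld l)) x * w x.
Definition Er4 (w : fct) : fct := fun x => \sum_j \sum_k
  a j k x * partial k w x * (psi x * partial j w x).
Definition Erpot : fct := fun x =>
  psi x * r x - 2 * al * radF x * wgt (2 * al - 2) x - \sum_l fld l x * partial l r x.
Definition Ermag (u v : fct) : fct := fun x =>
  let W j := u x * partial j v x - v x * partial j u x in
  \sum_j \sum_l (b j x * partial j (fld l) x * W l - fld l x * partial l (b j) x * W j).
Definition Erw (w : fct) : fct := fun x => Er1 w x - Er2 w x + Er3 w x + Er4 w x + Tgrad psi w x.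
Definition Err2 (u v : fct) : fct := fun x =>
  Erw u x + Erw v x + Erpot x * (u x ^+ 2 + v x ^+ 2) + (Tmag psi u v x + Ermag u v x).

Lemma rellich_split w x :
  \sum_j \sum_k \sum_l
       (2 * gmet j k x * partial j (fld l) x * partial k w x * partial l w x
        - fld l x * partial l (gmet j k) x * partial j w x * partial k w x
        + gmet j k x * partial k w x * partial j (partial l (fld l)) x * w x)
     - \sum_l fld l x * partial l qpot x * w x ^+ 2 =
  \sum_j \sum_k \sum_l 2 * (j == k)%:R * partial j (fld l) x * partial k w x * partial l w x +
  (Er1 w x - Er2 w x + Er3 w x) +
  (\sum_l fld l x * partial l (wgt (2 * al)) x - \sum_l fld l x * partial l r x) * w x ^+ 2.
Proof.
have -> : \sum_l fld l x * partial l qpot x * w x ^+ 2 =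
  - ((\sum_l fld l x * partial l (wgt (2 * al)) x - \sum_l fld l x * partial l r x) * w x ^+ 2).
  rewrite -sumrB -mulNr -sumrN mulr_suml; apply: eq_bigr => l _.
  rewrite (partialD l (smoothN (smooth_wgt _)) sr) (partialN l (smooth_wgt _)).
  move: (partial l (wgt (2 * al)) x) (partial l r x) => t1 t2; ring.
rewrite opprK; congr (_ + _).
have sum4 (I : finType) (A B C D E : I -> R) : (forall i, A i = B i + (C i - D i + E i)) ->
   \sum_i A i = \sum_i B i + (\sum_i C i - \sum_i D i + \sum_i E i).
  by move=> H; rewrite -sumrB -!big_split; apply: eq_bigr => i _; exact: H.
apply: (sum4) => j; apply: (sum4) => k; apply: (sum4) => l.
rewrite (partialD l (smooth_cst _) (sa j k)) partial_cst /gmet.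
move: (partial j (fld l) x) (partial k w x) (partial l w x) (partial l (a j k) x) => t1 t2 t3 t4.
move: (partial j w x) (partial j (partial l (fld l)) x) => t5 t6; ring.
Qed.

Lemma Mgrad_split w x : Mgrad psi w x =
  \sum_j \sum_k (j == k)%:R * partial k w x * (psi x * partial j w x) + Er4 w x.
Proof.
rewrite -big_split; apply: eq_bigr => j _; rewrite -big_split; apply: eq_bigr => k _ /=.
rewrite /gmet; move: (partial k w x) (partial j w x) => t1 t2; ring.
Qed.

Lemma null_decay u v : csmooth1 u -> csmooth1 v -> null (fun x =>
  (2 * Aop fld u x * Pre u v x + 2 * Aop fld v x * Pim u v x
    + (psi x * u x * Pre u v x + psi x * v x * Pim u v x)) -
  (Kin u x + Kin v x + de * wgt p2 x * (u x ^+ 2 + v x ^+ 2) + Err2 u v x)).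
Proof.
move=> cu cv.
have sfl l : smooth (fld l) by have [] := symb_fld l.
have spsi : smooth psi by have [] := symb_psi.
have N1 := null_rellich gsym sg sq cu sfl.
have N2 := null_rellich gsym sg sq cv sfl.
have N3 := null_magnetic sb cu cv sfl.
have N4 := null_weighted spsi cu cv.
apply: eq_null (nullD (nullD N1 N2) (nullD N3 N4)) => x.
rewrite !rellich_split !Mgrad_split /Kin /Err2 /Erw /Erpot -/(Ermag u v x) /Pre /Pim.
have := Pot_E x.
have -> : psi x * qpot x = psi x * r x - psi x * wgt (2 * al) x by rewrite /qpot; ring.
move: (\sum_l fld l x * partial l (wgt (2 * al)) x) (\sum_l fld l x * partial l r x) => s1 s2.
move: (\sum_j \sum_k \sum_l 2 * (j == k)%:R * partial j (fld l) x * partial k u x * partial l u x) => k1.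
move: (\sum_j \sum_k \sum_l 2 * (j == k)%:R * partial j (fld l) x * partial k v x * partial l v x) => k2.
move: (\sum_j \sum_k (j == k)%:R * partial k u x * (psi x * partial j u x)) => k3.
move: (\sum_j \sum_k (j == k)%:R * partial k v x * (psi x * partial j v x)) => k4.
move: (Aop fld u x) (Aop fld v x) (Lop gmet qpot u x) (Lop gmet qpot v x) (Bop b u x) (Bop b v x) => A1 A2 L1 L2 B1 B2.
move: (Er1 u x) (Er1 v x) (Er2 u x) (Er2 v x) (Er3 u x) (Er3 v x) (Er4 u x) (Er4 v x) => e1 e2 e3 e4 e5 e6 e7 e8.
move: (Tgrad psi u x) (Tgrad psi v x) (Tmag psi u v x) (Ermag u v x) => t1 t2 t3 t4.
move: (wgt p2 x) (wgt (2 * al) x) (wgt (2 * al - 2) x) (psi x) (radF x) (r x) (u x) (v x) => w1 w2 w3 ps f r0 u0 v0 E.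
have -> : s1 = de * w1 - 2 * al * f * w3 + ps * w2 by rewrite -E; ring.
ring.
Qed.

Let q1 : - 1 - al - 2 * de < p1. Proof. by rewrite /p1; have := de0; lra. Qed.
Let q2 : al - 1 - 2 * de < p2. Proof. by rewrite /p2; have := de0; lra. Qed.
Let Qpos := @Qtop_ge0 R n p1 p2.

(** The magnetic terms split evenly between the gradient, of weight <x>^(-1-al), and the mass, of
    weight <x>^(al-1). *)
Lemma mixed_small_magnetic (F : fct) : ord (- 1 - 2 * de) F -> mixed_small al p1 p2 1 F.
Proof.
move=> oF; apply: (@mixed_small_lt _ _ al p1 p2 (- 1 - 2 * de) (- 1 - al - 2 * de) (al - 1 - 2 * de)).
- ring.
- exact: q1.
- exact: q2.
- exact: oF.
Qed.

Lemma ofld l : ord (- al) (fld l). Proof. by have [] := symb_fld l. Qed.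
Lemma odfld j l : ord (- al - 1) (partial j (fld l)). Proof. by have [_ _ + _] := symb_fld l; exact. Qed.
Lemma oddfld j l : ord (- al - 2) (partial j (partial l (fld l))).
Proof. by have [_ _ _ +] := symb_fld l; exact. Qed.
Lemma opsi : ord (- 1 - al) psi. Proof. by have [] := symb_psi. Qed.

Lemma Err_Erw s : Err (Qtop (n := n) p1 p2) (Qlow al 1) (fun u v => Erw (pk s u v)).
Proof.
apply: ErrD; first apply: ErrD; first apply: ErrD; first apply: ErrB.
- apply: (Err_sum _ Qpos) => j; apply: (Err_sum _ Qpos) => k; apply: (Err_sum _ Qpos) => l.
  apply: Err_grad; apply: (grad_small_lt al q1).
  rewrite (_ : - 1 - al - 2 * de = - (2 * de) + (- al - 1)); last by ring.
  exact: (ordM (ordZ 2 (oa j k)) (odfld j l)).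
- apply: (Err_sum _ Qpos) => j; apply: (Err_sum _ Qpos) => k; apply: (Err_sum _ Qpos) => l.
  apply: Err_grad; apply: (grad_small_lt al q1).
  rewrite (_ : - 1 - al - 2 * de = - al + (- (2 * de) - 1)); last by ring.
  exact: (ordM (ofld l) (oda j k l)).
- apply: (Err_sum _ Qpos) => j; apply: (Err_sum _ Qpos) => k; apply: (Err_sum _ Qpos) => l.
  have M : mixed_small al p1 p2 1 (fun x => gmet j k x * partial j (partial l (fld l)) x).
    apply: mixed_small_low; apply: (@ordW _ _ (0 + (- al - 2))); first by lra.
    exact: (ordM (og j k) (oddfld j l)).
  apply: (eq_Err _ (Err_mixed s s k M)) => u v x.
  move: (partial k (pk s u v) x) (partial j (partial l (fld l)) x) => t1 t2; ring.
- apply: (Err_sum _ Qpos) => j; apply: (Err_sum _ Qpos) => k.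
  have M : grad_small al p1 1 (fun x => a j k x * psi x).
    apply: (grad_small_lt al q1).
    rewrite (_ : - 1 - al - 2 * de = - (2 * de) + (- 1 - al)); last by ring.
    exact: (ordM (oa j k) opsi).
  apply: (eq_Err _ (Err_grad p2 s s k j M)) => u v x.
  move: (partial k (pk s u v) x) (partial j (pk s u v) x) => t1 t2; ring.
- apply: Err_Tgrad => j k; apply: mixed_small_low.
  apply: (@ordW _ _ (0 + (- 1 - al - 1))); first by lra.
  by have [_ _ oh _] := symb_psi; exact: (ordM (og j k) (oh j)).
Qed.

Lemma Err_Err2 : Err (Qtop (n := n) p1 p2) (Qlow al 1) Err2.
Proof.
apply: ErrD; first apply: ErrD; first apply: ErrD.
- exact: (Err_Erw true).
- exact: (Err_Erw false).
- apply: (Err_pot _ ler01); apply: (mass_small_lt q2).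
  apply: ordD; first apply: ordD.
  + by rewrite (_ : al - 1 - 2 * de = (- 1 - al) + (2 * al - 2 * de)); [exact: (ordM opsi or)|ring].
  + apply: ordN; have [_ oF _ _] := symb_radF.
    apply: (@ordW _ _ ((- 1 - al) + (2 * al - 2))); first by have := de1; lra.
    exact: (ordM (ordZ (2 * al) oF) (ord_wgt _)).
  + apply: ordN; apply: ord_sum => l.
    by rewrite (_ : al - 1 - 2 * de = - al + (2 * al - 2 * de - 1)); [exact: (ordM (ofld l) (odr l))|ring].
- apply: ErrD.
  + apply: Err_Tmag => j; apply: mixed_small_magnetic.
    by rewrite (_ : - 1 - 2 * de = (- 1 - al) + (al - 2 * de)); [exact: (ordM opsi (ob j))|ring].
  + apply: (Err_sum _ Qpos) => j; apply: (Err_sum _ Qpos) => l.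
    have M1 : mixed_small al p1 p2 1 (fun x => b j x * partial j (fld l) x).
      apply: mixed_small_magnetic; rewrite (_ : - 1 - 2 * de = (al - 2 * de) + (- al - 1)); last by ring.
      exact: (ordM (ob j) (odfld j l)).
    have M2 : mixed_small al p1 p2 1 (fun x => fld l x * partial l (b j) x).
      apply: mixed_small_magnetic; rewrite (_ : - 1 - 2 * de = - al + (al - 2 * de - 1)); last by ring.
      exact: (ordM (ofld l) (odb j l)).
    apply: (eq_Err _ (ErrB (ErrB (Err_mixed false true l M1) (Err_mixed true false l M1))
      (ErrB (Err_mixed false true j M2) (Err_mixed true false j M2)))) => u v x; rewrite /pk.
    move: (partial j (fld l) x) (partial l (b j) x) (partial l u x) (partial l v x) => t1 t2 t3 t4.
    move: (partial j u x) (partial j v x) => t5 t6; ring.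
Qed.

(** The multiplier has coefficients O(<x>^(-al)), so the first estimate bounds it. *)
Lemma Aop_bound : exists2 K : R, 0 <= K & forall s u v x,
  Aop fld (pk s u v) x ^+ 2 <= K * Qlow al 1 u v x.
Proof.
have Q0 u v x : 0 <= Qlow al 1 u v x.
  by rewrite /Qlow mul1r addr_ge0 ?mass_ge0// mulr_ge0 ?wgt_ge0 ?grad2_ge0.
pose B (T : bool -> fct -> fct -> fct) := exists2 K : R, 0 <= K & forall s u v x, T s u v x ^+ 2 <= K * Qlow al 1 u v x.
have BD T1 T2 : B T1 -> B T2 -> B (fun s u v x => T1 s u v x + T2 s u v x).
  move=> [K K0 HK] [L L0 HL]; exists (2 * K + 2 * L) => [|s u v x]; first by rewrite addr_ge0 ?mulr_ge0.
  have := HK s u v x; have := HL s u v x; have := sqr_ge0 (T1 s u v x - T2 s u v x); nra.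
suff : B (fun s u v x => Aop fld (pk s u v) x) by [].
rewrite /Aop; elim: (index_enum _) => [|l ls IH].
  by exists 0 => // s u v x; rewrite big_nil expr0n/= mul0r.
suff H : B (fun s u v x => fld l x * partial l (pk s u v) x + 2^-1 * partial l (fld l) x * pk s u v x).
  have [K K0 HK] := BD _ _ H IH; exists K => // s u v x; rewrite big_cons; exact: HK.
apply: BD.
  have [K K0 HK] := ofld l; exists (K ^+ 2) => [|s u v x]; first exact: sqr_ge0.
  rewrite exprMn -(real_normK (num_real (fld l x))).
  apply: (@le_trans _ _ (K ^+ 2 * (wgt (- (2 * al)) x * grad2 u v x))).
    rewrite mulrA; apply: ler_pM; [exact: sqr_ge0|exact: sqr_ge0| |exact: pk_grad2].
    rewrite (_ : K ^+ 2 * wgt (- (2 * al)) x = (K * wgt (- al) x) ^+ 2).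
      by rewrite ler_pXn2r ?nnegrE ?mulr_ge0 ?wgt_ge0.
    by rewrite exprMn [wgt (- al) x ^+ 2]expr2 -wgtD (_ : - al - al = - (2 * al)); last by ring.
  by apply: ler_wpM2l; [exact: sqr_ge0|rewrite /Qlow mul1r lerDl mass_ge0].
have [K K0 HK] : ord 0 (fun x => 2^-1 * partial l (fld l) x).
  by apply: ordZ; apply: ordW (odfld l l); have := al0; lra.
exists (K ^+ 2) => [|s u v x]; first exact: sqr_ge0.
rewrite exprMn -(real_normK (num_real (2^-1 * partial l (fld l) x))).
apply: ler_pM; [exact: sqr_ge0|exact: sqr_ge0| |].
  by have := HK x; rewrite wgt0 mulr1 => h; rewrite ler_pXn2r ?nnegrE.
apply: (le_trans (pk_mass s u v x)).
by rewrite /Qlow mul1r lerDr mulr_ge0 ?wgt_ge0 ?grad2_ge0.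
Qed.

(** The main terms of the identity are nonnegative and dominate the errors, up to quantities that
    the first estimate bounds. *)
Theorem decay_estimate : exists2 C : R, 0 <= C & forall u v, csmooth1 u -> csmooth1 v ->
  \int[mu]_x (wgt p2 x * mass u v x) <= C * (\int[mu]_x mass u v x + \int[mu]_x Psq u v x).
Proof.
have [K K0 HK] := Err_Err2 (divr_gt0 de0 (ltr0n R 2)).
have [L L0 HL] := Aop_bound.
have [M M0 HM] : ord 0 psi by apply: ordW opsi; have := al0; lra.
have [G G0 HG] := gradient_estimate.
pose C := K + 4 * L + M ^+ 2.
have C0 : 0 <= C by rewrite !addr_ge0 ?mulr_ge0 ?sqr_ge0.
exists (2 / de * (1 + C * (G + 1))) => [|u v cu cv].
  apply: mulr_ge0; first by rewrite divr_ge0 ?(ltW de0).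
  by apply: addr_ge0; [exact: ler01|apply: mulr_ge0; [exact: C0|rewrite addr_ge0]].
have N := null_decay cu cv.
have sM := csmooth1_Rsummable (csmooth1_mass cu cv).
have sP := csmooth1_Rsummable (csmooth1_Psq cu cv).
have sG := csmooth1_Rsummable (csmooth1Ml (smooth_wgt (- (2 * al))) (csmooth1_grad2 cu cv)).
have sW := csmooth1_Rsummable (csmooth1Ml (smooth_wgt p2) (csmooth1_mass cu cv)).
have key : \int[mu]_x (de / 2 * (wgt p2 x * mass u v x)) <=
    \int[mu]_x (Psq u v x + C * (wgt (- (2 * al)) x * grad2 u v x + mass u v x)).
  apply: (null_le N).
  - exact: (RsummableZ _ sW).
  - exact: (RsummableD sP (RsummableZ _ (RsummableD sG sM))).
  move=> x; have := HK u v x; have := HL true u v x; have := HL false u v x.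
  have := Kin_ge u x; have := Kin_ge v x.
  have GE : grad2 u v x = \sum_j partial j u x ^+ 2 + \sum_j partial j v x ^+ 2.
    by rewrite /grad2 big_split.
  have m0 := mass_ge0 u v x; have g0 := grad2_ge0 u v x.
  have w0 := wgt_ge0 (- (2 * al)) x; have w1 := wgt_ge0 p1 x; have w2 := wgt_ge0 p2 x.
  have AM (A P : R) : 2 * A * P <= 2 * A ^+ 2 + P ^+ 2 / 2.
    by have := sqr_ge0 (2 * A - P); lra.
  have BM (s P : R) : psi x * s * P <= M ^+ 2 * s ^+ 2 + P ^+ 2 / 2.
    have h : psi x ^+ 2 <= M ^+ 2.
      by rewrite -(real_normK (num_real (psi x))) ler_pXn2r ?nnegrE//; have := HM x; rewrite wgt0 mulr1.
    have := ler_wpM2r (sqr_ge0 s) h; have := sqr_ge0 (psi x * s - P); nra.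
  have := AM (Aop fld u x) (Pre u v x); have := AM (Aop fld v x) (Pim u v x).
  have := BM (u x) (Pre u v x); have := BM (v x) (Pim u v x).
  have d1 := mulr_ge0 (ltW de0) (mulr_ge0 w1 g0).
  have d2 := mulr_ge0 C0 (mulr_ge0 w0 g0).
  rewrite /Qlow /Qtop !mul1r -/p1 ler_norml /Psq /C.
  rewrite GE in d1 d2 g0 *; rewrite /C in d2; rewrite /pk; rewrite /mass in m0 *.
  move: (\sum_j partial j u x ^+ 2) (\sum_j partial j v x ^+ 2) d1 d2 g0 => g1 g2 d1 d2 g0.
  move: (Kin u x) (Kin v x) (Err2 u v x) (Aop fld u x) (Aop fld v x) => k1 k2 er A1 A2.
  move: (Pre u v x) (Pim u v x) => P1 P2.
  move: (psi x * u x * P1) (psi x * v x * P2) (2 * A1 * P1) (2 * A2 * P2) => X1 X2 X3 X4.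
  move: (A1 ^+ 2) (A2 ^+ 2) (P1 ^+ 2) (P2 ^+ 2) (u x ^+ 2) (v x ^+ 2) m0 => AA1 AA2 PP1 PP2 uu vv m0.
  have MM0 : 0 <= M ^+ 2 := sqr_ge0 M.
  move: (M ^+ 2) MM0 d2 => MM MM0 d2 H1 H2 H3 H4 H5 H6 H7 H8 /andP[H9 H10].
  have e1 : 0 <= MM * (wgt (- (2 * al)) x * (g1 + g2)) by rewrite !mulr_ge0.
  lra.
rewrite (RintZ _ sW) (RintD sP (RsummableZ _ (RsummableD sG sM))) (RintZ _ (RsummableD sG sM)) (RintD sG sM) in key.
have := HG u v cu cv; move: key.
have : 0 <= \int[mu]_x Psq u v x by apply: Rint_ge0 => x; exact: mass_ge0.
have : 0 <= \int[mu]_x mass u v x by apply: Rint_ge0 => x; exact: mass_ge0.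
move: (\int[mu]_x Psq u v x) (\int[mu]_x mass u v x) => P N0 N00 P0.
move: (\int[mu]_x (wgt (- (2 * al)) x * grad2 u v x)) (\int[mu]_x (wgt p2 x * mass u v x)) => I1 I2 H1 H2.
rewrite -(ler_pM2l (divr_gt0 de0 (ltr0n R 2))).
have -> (s : R) : de / 2 * (2 / de * (1 + C * (G + 1)) * s) = (1 + C * (G + 1)) * s.
  by field; rewrite gt_eqF.
apply: (le_trans H1).
have := ler_wpM2l C0 H2; have := mulr_ge0 C0 P0; nra.
Qed.
End estimates.

(** * Decay of the derivatives of symbols *)

Section symbol_bounds.
Context {R : realType} {n : nat}.
Implicit Types (f : 'rV[R]_n -> R) (s : seq 'I_n) (x : 'rV[R]_n).

Lemma smooth_foldr f s : smooth f -> smooth (foldr partial f s).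
Proof. by move=> sf; elim: s => //= i s IH; exact: smooth_partial. Qed.

Lemma foldr_partial_cat f s1 s2 i : smooth f ->
  foldr partial f (s1 ++ i :: s2) = partial i (foldr partial f (s1 ++ s2)).
Proof.
move=> sf; elim: s1 => //= j s1 ->.
exact: (partialC j i (smooth_foldr (s1 ++ s2) sf)).
Qed.

(** Mixed derivatives commute, which reduces sequences of directions to multi-indices. *)
Lemma foldr_partial_perm f s1 s2 : smooth f -> perm_eq s1 s2 ->
  foldr partial f s1 = foldr partial f s2.
Proof.
move=> sf; elim: s1 s2 => [|i s1 IH] s2.
  by rewrite perm_sym => /perm_nilP ->.
move=> ps; have is2 : i \in s2 by rewrite -(perm_mem ps) mem_head.
case/splitPr: s2 / is2 ps => p1 p2 ps.
rewrite foldr_partial_cat//= (IH (p1 ++ p2))//.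
by move: ps; rewrite perm_sym (perm_catCA p1 [:: i] p2) perm_sym perm_cons.
Qed.

Lemma mpartial_seq f s : smooth f -> mpartial (fun i => count_mem i s) f = foldr partial f s.
Proof.
move=> sf; pose t := flatten [seq nseq (count_mem i s) i | i <- enum 'I_n].
have -> : mpartial (fun i => count_mem i s) f = foldr partial f t.
  rewrite /mpartial /t; elim: (enum 'I_n) => //= i e ->.
  rewrite foldr_cat; elim: (count_mem i s) => //= k IH.
  by rewrite -IH.
apply: foldr_partial_perm => //; apply/allP => j _ /=; apply/eqP.
rewrite count_flatten -map_comp sumnE big_map big_enum/= (bigD1 j)//= big1 => [|i ij].
  by rewrite count_nseq/= eqxx mul1n addn0.
by rewrite count_nseq/= (negbTE ij) mul0n.
Qed.

Lemma mabs_seq s : mabs (fun i => count_mem i s) = size s.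
Proof.
rewrite /mabs; elim: s => [|j s IH] /=; first by rewrite big1.
rewrite big_split/= IH (bigD1 j)//= eqxx big1 ?addn0 ?add1n// => i ij.
by rewrite eq_sym (negbTE ij).
Qed.

Lemma wgt_powR m x : wgt 1 x `^ m = wgt m x.
Proof. by rewrite /wgt -powRrM; congr (_ `^ _); lra. Qed.

Lemma enorm_ge0 x : 0 <= enorm x. Proof. exact: sqrtr_ge0. Qed.
Lemma enorm_sqr x : enorm x ^+ 2 = dotp x x.
Proof. by rewrite /enorm sqr_sqrtr// dotp_ge0. Qed.

Lemma wgt1_enorm x : wgt 1 x <= 1 + enorm x <= 2 * wgt 1 x.
Proof.
have e0 := enorm_ge0 x; have w0 := wgt_ge0 1 x.
have E : wgt 1 x ^+ 2 = 1 + enorm x ^+ 2 by rewrite wgt1_sqr enorm_sqr.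
apply/andP; split.
  by rewrite -(@ler_pXn2r _ 2) ?nnegrE ?addr_ge0// E; nra.
by rewrite -(@ler_pXn2r _ 2) ?nnegrE ?addr_ge0 ?mulr_ge0// exprMn E; have := sqr_ge0 (enorm x - 1); nra.
Qed.

Lemma ord_powR m : ord m (fun x : 'rV[R]_n => (1 + enorm x) `^ m).
Proof.
exists (2 `^ `|m|) => [|x]; first exact: powR_ge0.
rewrite ger0_norm ?powR_ge0//; have /andP[h1 h2] := wgt1_enorm x.
have w0 := wgt_ge0 1 x; have e0 := enorm_ge0 x.
have [m0|m0] := leP 0 m.
  rewrite ger0_norm// -wgt_powR -powRM//.
  by apply: ge0_ler_powR; rewrite ?nnegrE ?mulr_ge0 ?addr_ge0.
apply: (@le_trans _ _ (wgt m x)).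
  rewrite -wgt_powR -[m]opprK (powRN (1 + enorm x) (- m)) (powRN (wgt 1 x) (- m)).
  have pe : 0 < 1 + enorm x by apply: ltr_pwDl; [exact: ltr01|exact: e0].
  rewrite lef_pV2 ?posrE; [|exact: powR_gt0 pe|exact: powR_gt0 (wgt_gt0 1 x)].
  by apply: ge0_ler_powR; rewrite ?nnegrE ?mulr_ge0 ?addr_ge0// oppr_ge0 ltW.
rewrite -[leLHS]mul1r; apply: ler_wpM2r; first exact: wgt_ge0.
by rewrite -[leLHS](powRr0 2) ler_powR// ler1n.
Qed.

Lemma symbol_bound_ord m f s : smooth f -> symbol_bound m f ->
  ord (m - (size s)%:R) (foldr partial f s).
Proof.
move=> sf /(_ (fun i => count_mem i s))[C C0 H].
rewrite mabs_seq mpartial_seq// in H.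
have [K K0 HK] := ord_powR (m - (size s)%:R).
exists (C * K) => [|x]; first by rewrite mulr_ge0// ltW.
apply: (le_trans (H x)); rewrite -mulrA; apply: ler_wpM2l; first exact: ltW.
by have := HK x; rewrite ger0_norm ?powR_ge0.
Qed.
End symbol_bounds.

(** * Ellipticity of the principal part *)

Section ellipticity.
Context {R : realType} {n : nat}.
Local Notation fct := ('rV[R]_n -> R).
Variables (hn : (1 <= n)%N) (al de : R) (a : 'I_n -> 'I_n -> fct) (b : 'I_n -> fct) (c : fct).
Hypotheses (de0 : 0 < de) (sa : forall j k, smooth (a j k)).
Hypotheses (oa : forall j k, ord (- (2 * de)) (a j k)).
Hypothesis pelliptic : forall M : R, 0 < M ->
      exists C : R, 0 < C /\ exists R_M : R, 0 < R_M /\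
      forall x xi : 'rV[R]_n, enorm x <= M -> R_M <= enorm xi ->
        C * japanese xi ^+ 2 <= `|repulsive_symbol al (perturbation a b c) x xi|.

Definition princ (x xi : 'rV[R]_n) : R := dotp xi xi + \sum_j \sum_k a j k x * xi 0 j * xi 0 k.

Lemma symbol_scale x xi (t : R) : repulsive_symbol al (perturbation a b c) x (t *: xi) =
  t ^+ 2 * princ x xi + t * (\sum_j b j x * xi 0 j) + (c x - japanese x `^ (2 * al)).
Proof.
rewrite /repulsive_symbol enorm_sqr /perturbation /princ.
have -> : dotp (t *: xi) (t *: xi) = t ^+ 2 * dotp xi xi.
  by rewrite /dotp mulr_sumr; apply: eq_bigr => i _; rewrite !mxE; ring.
have -> : \sum_j \sum_k a j k x * (t *: xi) 0 j * (t *: xi) 0 k =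
   t ^+ 2 * \sum_j \sum_k a j k x * xi 0 j * xi 0 k.
  rewrite mulr_sumr; apply: eq_bigr => j _; rewrite mulr_sumr; apply: eq_bigr => k _.
  by rewrite !mxE; ring.
have -> : \sum_j b j x * (t *: xi) 0 j = t * \sum_j b j x * xi 0 j.
  by rewrite mulr_sumr; apply: eq_bigr => j _; rewrite !mxE; ring.
ring.
Qed.

Lemma enormZ (t : R) (xi : 'rV[R]_n) : enorm (t *: xi) = `|t| * enorm xi.
Proof.
rewrite /enorm (_ : dotp (t *: xi) (t *: xi) = t ^+ 2 * dotp xi xi).
  by rewrite sqrtrM ?sqr_ge0// sqrtr_sqr.
by rewrite /dotp mulr_sumr; apply: eq_bigr => i _; rewrite !mxE; ring.
Qed.

(** The hypothesis on the full symbol at t xi sees only the quadratic part as t tends to infinity. *)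
Lemma princ_lower M : 0 < M -> exists2 C : R, 0 < C &
  forall x xi : 'rV[R]_n, enorm x <= M -> C * dotp xi xi <= `|princ x xi|.
Proof.
move=> M0; have [C [C0 [RM [RM0 H]]]] := pelliptic M0; exists C => // x xi xM.
rewrite leNgt; apply/negP => lt.
have d0 : 0 < dotp xi xi.
  rewrite lt_neqAle dotp_ge0 andbT eq_sym; apply/eqP => E.
  by move: lt; rewrite E mulr0 ltNge normr_ge0.
have e0 : 0 < enorm xi by rewrite /enorm sqrtr_gt0.
set B := \sum_j b j x * xi 0 j; set D := c x - japanese x `^ (2 * al).
pose ep := C * dotp xi xi - `|princ x xi|.
have ep0 : 0 < ep by rewrite subr_gt0.
(* The second summand puts t xi in the elliptic region, the third one makes t so large that the
   quadratic part outweighs B and D. *)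
pose t := 1 + RM / enorm xi + (`|B| + `|D|) / ep.
have q1 : 0 <= RM / enorm xi by rewrite divr_ge0// ltW.
have q2 : 0 <= (`|B| + `|D|) / ep by apply: divr_ge0; [exact: addr_ge0|exact: ltW].
have t1 : 1 <= t by rewrite /t; lra.
have t0 : 0 <= t by apply: le_trans t1.
have tR : RM <= enorm (t *: xi).
  by rewrite enormZ ger0_norm// -ler_pdivrMr// /t; lra.
have := H x (t *: xi) xM tR.
rewrite symbol_scale -/B -/D.
have -> : japanese (t *: xi) ^+ 2 = 1 + t ^+ 2 * dotp xi xi.
  rewrite /japanese sqr_sqrtr; last by rewrite addr_ge0 ?sqr_ge0.
  by rewrite enormZ exprMn enorm_sqr real_normK ?num_real.
have N : `|t ^+ 2 * princ x xi + t * B + D| <= t ^+ 2 * `|princ x xi| + t * `|B| + `|D|.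
  rewrite (le_trans (ler_normD _ _))// lerD2r (le_trans (ler_normD _ _))//.
  by rewrite (normrM (t ^+ 2)) (normrM t B) (ger0_norm t0) (ger0_norm (sqr_ge0 t)).
have T : `|B| + `|D| <= ep * (t - 1).
  by rewrite mulrC -ler_pdivrMr// /t; lra.
have T2 : t * (`|B| + `|D|) <= t * (ep * (t - 1)) by apply: ler_wpM2l.
move=> H1; have := le_trans H1 N.
have td : 0 <= (t - 1) * `|D| by rewrite mulr_ge0// subr_ge0.
have et : 0 < ep * t by rewrite mulr_gt0// (lt_le_trans _ t1).
rewrite /ep in T2 et; move: (`|B|) (`|D|) (`|princ x xi|) (dotp xi xi) H1 T2 td et.
move=> B' D' P d H1 T2 td et; have := le_trans H1 N.
nra.
Qed.

(** The coefficients a tend to 0 at infinity. *)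
Lemma princ_far : exists2 M : R, 0 < M & forall x xi : 'rV[R]_n, M <= enorm x ->
  2^-1 * dotp xi xi <= princ x xi.
Proof.
have [K K0 HK] : ord (- (2 * de)) (fun x => \sum_j \sum_k `|a j k x|).
  apply: ord_sum => j; apply: ord_sum => k; have [C C0 HC] := oa j k.
  by exists C => // x; rewrite normr_id.
pose M := (2 * K + 1) `^ ((2 * de)^-1).
have K1 : 0 < 2 * K + 1 by lra.
exists M => [|x xi xM]; first exact: powR_gt0.
have w0 := wgt_gt0 (2 * de) x.
have wM : 2 * K + 1 <= wgt (2 * de) x.
  have -> : 2 * K + 1 = M `^ (2 * de).
    have d2 : 2 * de != 0 by rewrite mulf_neq0 ?pnatr_eq0// gt_eqF.
    by rewrite /M -powRrM mulVf// powRr1// ltW.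
  rewrite -wgt_powR; have d2 : 0 <= 2 * de by rewrite mulr_ge0// ltW.
  apply: (ge0_ler_powR d2); rewrite ?nnegrE ?powR_ge0 ?wgt_ge0//.
  apply: (le_trans xM); have w1 := wgt_ge0 1 x.
  by rewrite -(@ler_pXn2r _ 2) ?nnegrE ?enorm_ge0// wgt1_sqr enorm_sqr /jap2 lerDr ler01.
have Kw : K * wgt (- (2 * de)) x <= 2^-1.
  have E : wgt (- (2 * de)) x * wgt (2 * de) x = 1 by rewrite -wgtD addNr wgt0.
  have v0 := wgt_ge0 (- (2 * de)) x; have wM' := wM; clear wM.
  move: (wgt (- (2 * de)) x) (wgt (2 * de) x) v0 E wM' w0 => w1 w2 v0 E h w20; nra.
have A : `|\sum_j \sum_k a j k x * xi 0 j * xi 0 k| <= (\sum_j \sum_k `|a j k x|) * dotp xi xi.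
  apply: (le_trans (ler_norm_sum _ _ _)); rewrite mulr_suml; apply: ler_sum => j _.
  apply: (le_trans (ler_norm_sum _ _ _)); rewrite mulr_suml; apply: ler_sum => k _.
  rewrite -mulrA normrM; apply: ler_wpM2l => //.
  have cs i : xi 0 i ^+ 2 <= dotp xi xi.
    by rewrite /dotp (bigD1 i)//= -expr2 lerDl; apply: sumr_ge0 => l _; rewrite -expr2 sqr_ge0.
  rewrite ler_norml; have := cs j; have := cs k.
  have := sqr_ge0 (xi 0 j + xi 0 k); have := sqr_ge0 (xi 0 j - xi 0 k).
  move: (xi 0 j) (xi 0 k) (dotp xi xi) => s t d h1 h2 h3 h4; apply/andP; split; nra.
have S0 : 0 <= \sum_j \sum_k `|a j k x|.
  by apply: sumr_ge0 => j _; apply: sumr_ge0.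
have := HK x; rewrite (ger0_norm S0) /princ => HS.
have d0 := dotp_ge0 xi.
have H : (\sum_j \sum_k `|a j k x|) * dotp xi xi <= 2^-1 * dotp xi xi.
  by apply: ler_wpM2r => //; exact: le_trans Kw.
by move: (le_trans A H); rewrite ler_norml => /andP[]; lra.
Qed.

(** The form cannot degenerate at any point, and it is positive near infinity, so the intermediate
    value theorem on a segment to infinity makes it positive everywhere. *)
Lemma princ_gt0 x xi : 0 < dotp xi xi -> 0 < princ x xi.
Proof.
move=> d0; have [M M0 HM] := princ_far.
pose y : 'rV[R]_n := M *: delta_mx 0 (Ordinal hn).
have yM : M <= enorm y.
  rewrite enormZ gtr0_norm// (_ : enorm _ = 1) ?mulr1//.
  rewrite /enorm /dotp (bigD1 (Ordinal hn))//= big1 => [|i ni].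
    by rewrite !mxE !eqxx mulr1 addr0 sqrtr1.
  by rewrite !mxE (negbTE ni) andbF mulr0.
pose g (t : R) : 'rV[R]_n := x + t *: (y - x).
have cg : continuous g.
  move=> t; apply: (@cvgD _ _ _ _ _ (fun=> x) (fun s : R => s *: (y - x))); first exact: cvg_cst.
  exact: scalel_continuous.
have sp : smooth (princ^~ xi).
  apply: smoothD; first exact: smooth_cst.
  apply: smooth_sum => j; apply: smooth_sum => k.
  exact: (smoothM (smoothM (sa j k) (smooth_cst _)) (smooth_cst _)).
have cf : continuous (fun t => princ (g t) xi).
  by move=> t; have cp := smooth_continuous sp; apply: (@continuous_comp _ _ _ g (princ^~ xi)); [exact: cg|exact: cp].
rewrite ltNge; apply/negP => f0.
have f1 : 0 <= princ (g 1) xi.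
  rewrite /g scale1r addrC subrK; apply: le_trans (HM _ _ yM); rewrite mulr_ge0// ltW//.
have [||t _ t0] := @IVT R (fun t => princ (g t) xi) 0 1 0 ler01.
- exact: continuous_subspaceT.
- by rewrite /g scale0r addr0 ge_min f0 le_max f1 orbT.
have e0 := enorm_ge0 (g t); have e1 : 0 < enorm (g t) + 1 by lra.
have [C C0 HC] := princ_lower e1.
have := HC (g t) xi; rewrite t0 normr0 lerDl ler01 => /(_ isT).
by apply/negP; rewrite -ltNge mulr_gt0.
Qed.

Lemma princ_elliptic : exists2 C : R, 0 < C &
  forall x xi : 'rV[R]_n, C * dotp xi xi <= princ x xi.
Proof.
have [M M0 HM] := princ_far; have [C C0 HC] := princ_lower M0.
exists (Num.min C 2^-1) => [|x xi]; first by rewrite lt_min C0 invr_gt0 ltr0n.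
have [d0|] := ltP 0 (dotp xi xi); last first.
  have := dotp_ge0 xi => h1 h2; have E : dotp xi xi = 0 by lra.
  have z i : xi 0 i = 0.
    move: E; rewrite /dotp => /eqP; rewrite psumr_eq0 => [/allP/(_ i)|k _]; last by rewrite -expr2 sqr_ge0.
    by rewrite mem_index_enum mulf_eq0 orbb => /(_ isT)/eqP.
  rewrite E mulr0 /princ E add0r big1 // => j _; rewrite big1 // => k _; rewrite z; ring.
have [xM|xM] := leP (enorm x) M.
  rewrite -[leRHS]gtr0_norm ?princ_gt0//; apply: le_trans (HC x xi xM).
  by apply: ler_wpM2r; [exact: ltW|rewrite ge_min lexx].
apply: le_trans (HM x xi (ltW xM)); apply: ler_wpM2r; first exact: ltW.
by rewrite ge_min lexx orbT.
Qed.
End ellipticity.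

(** * The a priori estimates *)

Section reduction.
Context {R : realType} {n : nat}.
Local Notation fct := ('rV[R]_n -> R).
Local Notation mu := (lebesgue_rV R n).
Variables (hn : (1 <= n)%N) (alpha : R) (alpha1 : 1 < alpha) (m : R) (m0 : 0 < m).
Variables (a : 'I_n -> 'I_n -> fct) (b : 'I_n -> fct) (c : fct).
Hypotheses (asym : forall j k x, a j k x = a k j x).
Hypotheses (asmth : forall j k, smooth (a j k)) (bsmth : forall j, smooth (b j)) (csmth : smooth c).
Hypotheses (abound : forall j k, symbol_bound (- m) (a j k))
  (bbound : forall j, symbol_bound (alpha - m) (b j)) (cbound : symbol_bound (2 * alpha - m) c).
Hypothesis pelliptic : forall M : R, 0 < M ->
      exists C : R, 0 < C /\ exists R_M : R, 0 < R_M /\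
      forall x xi : 'rV[R]_n, enorm x <= M -> R_M <= enorm xi ->
        C * japanese xi ^+ 2 <= `|repulsive_symbol alpha (perturbation a b c) x xi|.

(** Moving the derivatives of the Weyl ordering into divergence form leaves a quarter of the second
    derivatives of a. *)
Definition lower_order : fct :=
  fun x => c x - 4^-1 * \sum_j \sum_k partial k (partial j (a j k)) x.

Lemma smooth_lower_order : smooth lower_order.
Proof.
apply: (smoothB csmth); apply: smoothZ; apply: smooth_sum => j; apply: smooth_sum => k.
exact: (smooth_partial k (smooth_partial j (asmth j k))).
Qed.

Lemma Lop_expand g x : csmooth1 g ->
  Lop (gmet a) (qpot alpha lower_order) g x =
  - (\sum_j partial j (partial j g) x) - wgt (2 * alpha) x * g x + weyl_even a c x g x.
Proof.
move=> cg; rewrite (weyl_even_diag c asmth x cg); have [sg _] := cg.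
have E j k : partial j (fun y => gmet a j k y * partial k g y) x =
   (j == k)%:R * partial j (partial k g) x + (partial j (a j k) x * partial k g x +
    a j k x * partial k (partial j g) x).
  have sG : smooth (gmet a j k) by exact: (smoothD (smooth_cst _) (asmth j k)).
  rewrite (partialM j sG (smooth_partial k sg)).
  have -> : partial j (gmet a j k) x = partial j (a j k) x.
    by rewrite (partialD j (smooth_cst _) (asmth j k)) partial_cst add0r.
  rewrite (partialC k j sg) /gmet.
  move: (partial j (a j k) x) (partial k g x) (partial j (partial k g) x) => p q s; ring.
rewrite /Lop /qpot /lower_order.
set La := \sum_j partial j (partial j g) x.
have -> : \sum_j \sum_k partial j (fun y => gmet a j k y * partial k g y) x =
  La + \sum_j \sum_k (partial j (a j k) x * partial k g x + a j k x * partial k (partial j g) x).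
  rewrite -big_split/=; apply: eq_bigr => j _.
  transitivity (\sum_k ((j == k)%:R * partial j (partial k g) x + (partial j (a j k) x * partial k g x +
    a j k x * partial k (partial j g) x))).
    by apply: eq_bigr => k _; exact: E.
  rewrite big_split/=; congr (_ + _); rewrite (bigD1 j)//= eqxx mul1r big1 ?addr0// => k kj.
  by rewrite eq_sym (negbTE kj) mul0r.
have sw : \sum_j \sum_k 2^-1 * partial k (a j k) x * partial j g x =
          \sum_j \sum_k 2^-1 * partial j (a j k) x * partial k g x.
  rewrite exchange_big/=; apply: eq_bigr => j _; apply: eq_bigr => k _.
  by have -> : a k j = a j k by apply/funext => y; exact: asym.
have -> : \sum_j \sum_k (4^-1 * partial k (partial j (a j k)) x * g x +
      2^-1 * partial j (a j k) x * partial k g x + 2^-1 * partial k (a j k) x * partial j g x +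
      a j k x * partial k (partial j g) x) =
   4^-1 * (\sum_j \sum_k partial k (partial j (a j k)) x) * g x +
   \sum_j \sum_k (partial j (a j k) x * partial k g x + a j k x * partial k (partial j g) x).
  have -> : 4^-1 * (\sum_j \sum_k partial k (partial j (a j k)) x) * g x =
      \sum_j \sum_k 4^-1 * partial k (partial j (a j k)) x * g x.
    rewrite mulr_sumr mulr_suml; apply: eq_bigr => j _.
    by rewrite mulr_sumr mulr_suml.
  pose T1 := \sum_j \sum_k 4^-1 * partial k (partial j (a j k)) x * g x.
  pose T2 := \sum_j \sum_k a j k x * partial k (partial j g) x.
  pose T3 := \sum_j \sum_k partial j (a j k) x * partial k g x.
  have h : \sum_j \sum_k 2^-1 * partial j (a j k) x * partial k g x = 2^-1 * T3.
    rewrite /T3 mulr_sumr; apply: eq_bigr => j _; rewrite mulr_sumr; apply: eq_bigr => k _.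
    by rewrite mulrA.
  transitivity (T1 + 2^-1 * T3 + 2^-1 * T3 + T2).
    rewrite -{2}h -sw -h /T1 /T2 -!big_split/=; apply: eq_bigr => j _.
    by rewrite -!big_split.
  have -> : \sum_j \sum_k (partial j (a j k) x * partial k g x + a j k x * partial k (partial j g) x)
     = T3 + T2.
    by rewrite /T3 /T2 -big_split; apply: eq_bigr => j _; rewrite -big_split.
  by rewrite -/T1; clear h; clearbody T1 T2 T3; lra.
move: La (\sum_j _) (\sum_j _) => La S1 S2; move: (c x) (wgt _ x) (g x) => s t w; ring.
Qed.

Lemma weyl_odd_Bop g x : csmooth1 g -> weyl_odd b x g x = - Bop b g x.
Proof.
move=> cg; rewrite (weyl_odd_diag bsmth x cg) /Bop; congr (- _); apply: eq_bigr => j _.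
by rewrite addrC.
Qed.

(** Only here do the parities of the Weyl symbol matter: the terms of even degree act on the real
    and imaginary parts separately, the terms of odd degree exchange them. *)
Lemma repulsiveE (u v : fct) : csmooth1 u -> csmooth1 v ->
  repulsive alpha (perturbation a b c) (fun y => u y +i* v y) =
  fun x => Pre alpha a b lower_order u v x +i* Pim alpha a b lower_order u v x.
Proof.
move=> cu cv; apply/funext => x; rewrite /repulsive (weylE asmth bsmth csmth x cu cv).
rewrite /Pre /Pim (Lop_expand _ cu) (Lop_expand _ cv) (weyl_odd_Bop _ cu) (weyl_odd_Bop _ cv).
have -> : claplacian (fun y => u y +i* v y) x =
  (\sum_j partial j (partial j u) x) +i* (\sum_j partial j (partial j v) x).
  rewrite /claplacian /=; elim/big_rec3 : _ => // j s1 s2 s3 _ ->.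
  by [].
rewrite japanese_wgt realC_mul.
move: (\sum_j _) (\sum_j _) (wgt _ x * u x) (wgt _ x * v x) => s1 s2 s3 s4.
by apply/eqP; rewrite eq_complex /=; apply/andP; split; apply/eqP; ring.
Qed.

Lemma csmooth1_repulsive (u v : fct) : csmooth1 u -> csmooth1 v ->
  let Pw := repulsive alpha (perturbation a b c) (fun y => u y +i* v y) in
  csmooth1 (fun x => complex.Re (Pw x)) /\ csmooth1 (fun x => complex.Im (Pw x)).
Proof.
move=> cu cv /=; rewrite (repulsiveE cu cv) /=; have sr := smooth_lower_order.
by split; [exact: (csmooth1_Pre _ asmth bsmth sr)|exact: (csmooth1_Pim _ asmth bsmth sr)].
Qed.

(** Here delta is chosen; 2 delta <= m lets the perturbation be of lower order, and
    2 delta <= alpha - 1 leaves a positive exponent eta. *)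
Theorem a_priori : exists2 eta : R, 0 < eta & exists2 C : R, 0 <= C &
  forall u v : fct, csmooth1 u -> csmooth1 v ->
  let Pw := repulsive alpha (perturbation a b c) (fun y => u y +i* v y) in
  let E := \int[mu]_x mass u v x +
    \int[mu]_x mass (fun x => complex.Re (Pw x)) (fun x => complex.Im (Pw x)) x in
  \int[mu]_x (wgt (- (2 * alpha)) x * grad2 u v x) <= C * E /\
  \int[mu]_x (wgt eta x * mass u v x) <= C * E.
Proof.
pose de := Num.min 1 (Num.min (m / 2) ((alpha - 1) / 2)).
have de0 : 0 < de.
  by rewrite !lt_min ltr01 !divr_gt0// subr_gt0.
have de1 : de <= 1 by rewrite ge_min lexx.
have dem : 2 * de <= m.
  have : de <= m / 2 by rewrite !ge_min lexx !orbT.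
  by clearbody de; lra.
have dea : 2 * de <= alpha - 1.
  have : de <= (alpha - 1) / 2 by rewrite !ge_min lexx !orbT.
  by clearbody de; lra.
clearbody de; have al0 : 0 < alpha by lra.
have sr := smooth_lower_order.
have oa j k : ord (- (2 * de)) (a j k).
  by apply: (ordW _ (symbol_bound_ord [::] (asmth j k) (abound j k))) => /=; lra.
have oda j k l : ord (- (2 * de) - 1) (partial l (a j k)).
  by apply: (ordW _ (symbol_bound_ord [:: l] (asmth j k) (abound j k))) => /=; lra.
have ob j : ord (alpha - 2 * de) (b j).
  by apply: (ordW _ (symbol_bound_ord [::] (bsmth j) (bbound j))) => /=; lra.
have odb j l : ord (alpha - 2 * de - 1) (partial l (b j)).
  by apply: (ordW _ (symbol_bound_ord [:: l] (bsmth j) (bbound j))) => /=; lra.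
have or : ord (2 * alpha - 2 * de) lower_order.
  apply: ordD; first by apply: (ordW _ (symbol_bound_ord [::] csmth cbound)) => /=; lra.
  apply: ordN; apply: ordZ; apply: ord_sum => j; apply: ord_sum => k.
  by apply: (ordW _ (symbol_bound_ord [:: k; j] (asmth j k) (abound j k))) => /=; lra.
have odr l : ord (2 * alpha - 2 * de - 1) (partial l lower_order).
  have s2 j k : smooth (partial k (partial j (a j k))).
    exact: (smooth_partial k (smooth_partial j (asmth j k))).
  have s1 j : smooth (fun x => \sum_k partial k (partial j (a j k)) x).
    by apply: smooth_sum => k; exact: s2.
  have s0 : smooth (fun x => \sum_j \sum_k partial k (partial j (a j k)) x).
    by apply: smooth_sum => j; exact: s1.
  rewrite (partialB l csmth (smoothZ 4^-1 s0)) (partialZ 4^-1 l s0) (partial_sum _ _ l s1).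
  apply: ordD; first by apply: (ordW _ (symbol_bound_ord [:: l] csmth cbound)) => /=; lra.
  apply: ordN; apply: ordZ; apply: ord_sum => j; rewrite (partial_sum _ _ l (s2 j)).
  apply: ord_sum => k.
  by apply: (ordW _ (symbol_bound_ord [:: l; k; j] (asmth j k) (abound j k))) => /=; lra.
have [c0 c00 Hc] := princ_elliptic hn de0 asmth oa pelliptic.
have ell x (z : 'I_n -> R) : c0 * \sum_j z j ^+ 2 <= \sum_j \sum_k gmet a j k x * z k * z j.
  have := Hc x (\row_j z j); rewrite /princ /dotp.
  have -> : \sum_j (\row_j z j) 0 j * (\row_j z j) 0 j = \sum_j z j ^+ 2.
    by apply: eq_bigr => j _; rewrite mxE expr2.
  suff -> : \sum_j \sum_k gmet a j k x * z k * z j =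
    \sum_j z j ^+ 2 + \sum_j \sum_k a j k x * (\row_j z j) 0 j * (\row_j z j) 0 k by [].
  rewrite -big_split; apply: eq_bigr => j _ /=.
  transitivity (\sum_k ((j == k)%:R * z k * z j + a j k x * z j * z k)).
    by apply: eq_bigr => k _; rewrite /gmet; ring.
  rewrite big_split/=; congr (_ + _).
    rewrite (bigD1 j)//= eqxx mul1r big1 ?addr0// => k kj.
    by rewrite eq_sym (negbTE kj) !mul0r.
  by apply: eq_bigr => k _; rewrite !mxE.
have [C1 C10 H1] := gradient_estimate al0 de0 c00 asmth bsmth sr oa ob or ell.
have [C2 C20 H2] := decay_estimate al0 de0 de1 c00 asym asmth bsmth sr oa oda ob odb or odr ell.
exists (alpha - 1 - de); first by lra.
exists (C1 + C2); first exact: addr_ge0.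
move=> u v cu cv /=; rewrite (repulsiveE cu cv) /=.
have E0 : 0 <= \int[mu]_x mass u v x + \int[mu]_x Psq alpha a b lower_order u v x.
  apply: addr_ge0; first exact: (Rint_ge0 _ (mass_ge0 u v)).
  apply: Rint_ge0 => x; exact: (addr_ge0 (sqr_ge0 _) (sqr_ge0 _)).
split.
  apply: (le_trans (H1 u v cu cv)); apply: ler_wpM2r; [exact: E0|by rewrite lerDl].
apply: (le_trans (H2 u v cu cv)); apply: ler_wpM2r; [exact: E0|by rewrite lerDr].
Qed.

Lemma test_function_csmooth1 (w : 'rV[R]_n -> R[i]) : test_function w ->
  csmooth1 (fun x => complex.Re (w x)) /\ csmooth1 (fun x => complex.Im (w x)).
Proof.
move=> [[sR sI] /compact_bounded[M [_ HM]]].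
have M1 : M < M + 1 by rewrite ltrDl.
have out (x : 'rV[R]_n) i : M + 1 < `|x 0 i| -> w x = 0.
  case: (eqVneq (w x) 0) => // wx; rewrite ltNge => /negP[].
  have xM : `|x| <= M + 1 by apply: (HM _ M1); exact: subset_closure.
  apply: le_trans xM.
  rewrite [leRHS]mx_normrE; exact: (le_bigmax _ (fun ij : 'I_1 * 'I_n => `|x ij.1 ij.2|) (0, i)).
by split; split=> //; exists (M + 1) => x i /out ->.
Qed.
End reduction.

(** * The Poincare inequality on an interval *)

Section one_variable.
Context {R : realType}.
Local Notation leb := (@lebesgue_measure R).
Implicit Types (a h t s : R) (U W f df : R -> R).

(** Half-open intervals, because they tile. *)
Definition iv a h t : R := ((a <= t) && (t < a + h))%:R.

Lemma iv_indic a h : iv a h = \1_([set` `[a, (a + h)%R[]).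
Proof.
by apply/funext => t; rewrite indicE /iv mem_setE in_itv.
Qed.

Lemma measurable_iv a h : measurable_fun setT (iv a h).
Proof. by rewrite iv_indic; apply: measurable_indic; exact: measurable_itv. Qed.

Lemma iv_ge0 a h t : 0 <= iv a h t. Proof. by rewrite /iv ler0n. Qed.
Lemma iv_le1 a h t : iv a h t <= 1. Proof. by rewrite /iv lern1 leq_b1. Qed.
Lemma iv_sqr a h t : iv a h t ^+ 2 = iv a h t.
Proof. by rewrite /iv; case: (_ && _); rewrite ?expr1n ?expr0n. Qed.
Lemma iv_norm_le1 a h t : `|iv a h t| <= 1.
Proof. by rewrite ger0_norm ?iv_ge0 ?iv_le1. Qed.

Lemma Rint_iv a h : 0 <= h -> Rsummable leb (iv a h) /\ \int[leb]_t iv a h t = h.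
Proof.
move=> h0; have mI : measurable ([set` `[a, (a + h)%R[] : set R) by exact: measurable_itv.
have E : (\int[leb]_t (iv a h t)%:E = h%:E)%E.
  rewrite iv_indic integral_indic// setIT [LHS](@lebesgue_measure_itv R `[a, (a + h)%R[) /= lte_fin.
  case: ifP => [_|/negbT]; first by rewrite -EFinB addrAC subrr add0r.
  by rewrite ltrDl -leNgt => h1; have -> // : h = 0; apply/eqP; rewrite eq_le h0 h1.
split; last by rewrite /Rintegral E.
apply/integrableP; split; first by apply/measurable_EFinP; exact: measurable_iv.
rewrite (_ : (\int[leb]_x _)%E = h%:E) ?ltry// -E; apply: eq_integral => t _ /=.
by rewrite ger0_norm ?iv_ge0.
Qed.

Lemma iv_bounded_Rsummable a h U (K : R) : 0 <= h -> measurable_fun setT U ->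
  (forall t, iv a h t != 0 -> `|U t| <= K) -> Rsummable leb (fun t => iv a h t * U t).
Proof.
move=> h0 mU HU; have [si _] := Rint_iv a h0.
apply: (Rsummable_dom _ (RsummableZ K si)); first exact: (measurable_funM (measurable_iv a h) mU).
move=> t; have [z|nz] := eqVneq (iv a h t) 0; first by rewrite z mul0r mulr0 normr0.
rewrite normrM (ger0_norm (iv_ge0 a h t)) mulrC; apply: ler_wpM2r; [exact: iv_ge0|exact: HU].
Qed.

(** The fundamental theorem of calculus and the Cauchy-Schwarz inequality bound the oscillation. *)
Lemma oscillation_sqr f df a h t s (K : R) : (forall t, is_derive t 1 f (df t)) -> continuous df ->
  (forall t, `|df t| <= K) -> 0 <= h -> a <= s -> s <= t -> t < a + h ->
  (f t - f s) ^+ 2 <= h * \int[leb]_x (iv a h x * df x ^+ 2).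
Proof.
move=> dF cdf dK h0 as_; rewrite le_eqVlt => /predU1P[-> _|st th].
  rewrite subrr expr0n mulr_ge0//; apply: Rint_ge0 => x; exact: (mulr_ge0 (iv_ge0 a h x) (sqr_ge0 _)).
have mdf : measurable_fun setT df by exact: continuous_measurable_fun.
have dfE : derive1 f = df by apply/funext => x; rewrite derive1E; have H := dF x; rewrite derive_val.
have cf : continuous f.
  by move=> x; apply: differentiable_continuous; apply/derivable1_diffP; have [] := dF x.
pose I : R -> R := \1_([set` `[s, t]]).
have mI : measurable_fun setT I by apply: measurable_indic; exact: measurable_itv.
have II x : I x * iv a h x = I x.
  rewrite /I indicE; case: (boolP (_ \in _)) => [|_]; last by rewrite mul0r.
  rewrite inE /= in_itv/= => /andP[sx xt].
  by rewrite /iv (le_trans as_ sx) (le_lt_trans xt th) mulr1.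
have I0 x : 0 <= I x <= 1 by rewrite /I indicE ler0n lern1 leq_b1.
have -> : f t - f s = \int[leb]_x (iv a h x * (I x * df x)).
  have H : (\int[leb]_(x in `[s, t]) (df x)%:E = (f t)%:E - (f s)%:E)%E.
    apply: (@continuous_FTC2 R df f) => //; first exact: continuous_subspaceT.
    - split=> [x _||]; first by have [] := dF x.
        exact/cvg_at_right_filter/cf.
      exact/cvg_at_left_filter/cf.
    - by move=> x _; rewrite dfE.
  rewrite /Rintegral -[LHS]/(fine (f t - f s)%:E) EFinB -H; congr fine.
  rewrite [LHS]integral_mkcond.
  apply: eq_integral => x _; rewrite patchE mulrA (mulrC (iv _ _ _)) II /I indicE.
  by case: ifP => _; rewrite ?mul1r ?mul0r.
have [si Ei] := Rint_iv a h0.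
have h1 : Rsummable leb (fun x => iv a h x ^+ 2).
  by apply: eq_Rsummable si => x; rewrite iv_sqr.
have h2 : Rsummable leb (fun x => iv a h x * df x ^+ 2).
  apply: (@iv_bounded_Rsummable _ _ _ (K ^+ 2)) => //; first exact: measurable_funX.
  by move=> x _; rewrite normrX lerXn2r// nnegrE; apply: le_trans (dK x).
have Id x : (I x * df x) ^+ 2 <= iv a h x * df x ^+ 2.
  rewrite exprMn -[I x]II; apply: ler_wpM2r; first exact: sqr_ge0.
  rewrite exprMn iv_sqr -[leRHS]mul1r; apply: ler_wpM2r; first exact: iv_ge0.
  by have /andP[? ?] := I0 x; rewrite expr_le1.
have h3 : Rsummable leb (fun x => (I x * df x) ^+ 2).
  apply: (Rsummable_dom _ h2); first exact: (measurable_funX _ (measurable_funM mI mdf)).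
  by move=> x; rewrite ger0_norm ?sqr_ge0.
have [_ CS] := @Rint_CS _ _ R leb (iv a h) (fun x => I x * df x) (measurable_iv a h) (measurable_funM mI mdf) h1 h3.
apply: (le_trans CS); rewrite (_ : \int[leb]_x iv a h x ^+ 2 = h); last first.
  by rewrite -[RHS]Ei; apply: eq_Rintegral => x _; exact: iv_sqr.
by apply: ler_wpM2l => //; exact: Rint_le.
Qed.

(** On a short interval a function with small oscillation is close to its mean. *)
Lemma interval_poincare U a h (D : R) : 0 < h -> measurable_fun setT U ->
  (forall t s, iv a h t != 0 -> iv a h s != 0 -> (U t - U s) ^+ 2 <= D) ->
  Rsummable leb (fun t => iv a h t * U t ^+ 2) /\
  \int[leb]_t (iv a h t * U t ^+ 2) <=
    2 / h * (\int[leb]_t (iv a h t * U t)) ^+ 2 + 2 * h * D.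
Proof.
move=> h0 mU HD; have hh := ltW h0; have [si Ei] := Rint_iv a hh.
have a1 : iv a h a != 0 by rewrite /iv lexx ltrDl h0 oner_neq0.
have D0 : 0 <= D by have := HD a a a1 a1; rewrite subrr expr0n.
have bd t : iv a h t != 0 -> `|U t| <= `|U a| + (1 + D).
  move=> t1; have := HD t a t1 a1 => h1.
  have e : `|U t - U a| <= 1 + D.
    have : `|U t - U a| ^+ 2 <= D by rewrite real_normK ?num_real.
    by move: (`|_|) (normr_ge0 (U t - U a)) => z z0; nra.
  have -> : U t = U a + (U t - U a) by ring.
  by apply: (le_trans (ler_normD _ _)); rewrite lerD2l.
have sU : Rsummable leb (fun t => iv a h t * U t) by exact: (iv_bounded_Rsummable hh mU bd).
have sU2 : Rsummable leb (fun t => iv a h t * U t ^+ 2).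
  apply: (@iv_bounded_Rsummable _ _ _ ((`|U a| + (1 + D)) ^+ 2)) => //.
    exact: measurable_funX.
  move=> t t1; rewrite normrX lerXn2r ?nnegrE//; last exact: bd.
  by apply: le_trans (bd _ t1).
split=> //; set A := \int[leb]_t (iv a h t * U t).
have key t : iv a h t != 0 -> (h * U t - A) ^+ 2 <= h ^+ 2 * D.
  move=> t1.
  have mV : measurable_fun setT (fun s => U t - U s) by exact: measurable_funB.
  have s1 : Rsummable leb (fun s => iv a h s ^+ 2).
    by apply: eq_Rsummable si => x; rewrite iv_sqr.
  have s2 : Rsummable leb (fun s => (iv a h s * (U t - U s)) ^+ 2).
    have s2 : Rsummable leb (fun s => iv a h s * (U t - U s) ^+ 2).
      apply: (@iv_bounded_Rsummable _ _ _ D) => //; first exact: measurable_funX.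
      by move=> s s1'; rewrite ger0_norm ?sqr_ge0//; exact: HD.
    by apply: eq_Rsummable s2 => s; rewrite exprMn iv_sqr.
  have [_ CS] := @Rint_CS _ _ R leb (iv a h) (fun s => iv a h s * (U t - U s)) (measurable_iv a h)
    (measurable_funM (measurable_iv a h) mV) s1 s2.
  have -> : h * U t - A = \int[leb]_s (iv a h s * (iv a h s * (U t - U s))).
    rewrite -{1}Ei mulrC -(RintZ (U t) si) /A -(RintB (RsummableZ (U t) si) sU).
    by apply: eq_Rintegral => s _; rewrite mulrA -expr2 iv_sqr; ring.
  apply: (le_trans CS); rewrite (_ : \int[leb]_x iv a h x ^+ 2 = h); last first.
    by rewrite -[RHS]Ei; apply: eq_Rintegral => x _; exact: iv_sqr.
  rewrite expr2 -mulrA; apply: ler_wpM2l => //.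
  have -> : h * D = \int[leb]_s (D * iv a h s) by rewrite (RintZ D si) Ei mulrC.
  apply: Rint_le => //; first exact: RsummableZ.
  move=> s; rewrite exprMn iv_sqr mulrC.
  have [z|nz] := eqVneq (iv a h s) 0; first by rewrite z !mulr0.
  by apply: ler_wpM2r; [exact: iv_ge0|exact: HD].
have -> : 2 / h * A ^+ 2 + 2 * h * D = \int[leb]_t ((2 / h ^+ 2 * A ^+ 2 + 2 * D) * iv a h t).
  by rewrite (RintZ _ si) Ei; field; rewrite gt_eqF.
apply: Rint_le => //; first exact: RsummableZ.
move=> t; rewrite mulrC; have [z|nz] := eqVneq (iv a h t) 0; first by rewrite z !mulr0.
apply: ler_wpM2r; first exact: iv_ge0.
have := key t nz; rewrite -(@ler_pM2l _ (h ^+ 2)) ?exprn_gt0//.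
have -> : h ^+ 2 * (2 / h ^+ 2 * A ^+ 2 + 2 * D) = 2 * A ^+ 2 + 2 * (h ^+ 2 * D).
  by field; rewrite gt_eqF.
have := sqr_ge0 (h * U t - 2 * A); move: (h ^+ 2 * D) => HD2.
by rewrite -exprMn; move: (h * U t) => z; nra.
Qed.

Lemma iv_partition a h t N : 0 <= h -> \sum_(k < N) iv (a + k%:R * h) h t = iv a (N%:R * h) t.
Proof.
move=> h0; elim: N => [|N IH].
  by rewrite big_ord0 /iv mul0r addr0; case: leP => //= _; rewrite ltNge => ->.
rewrite big_ord_recr /= IH /iv -natr1 mulrDl mul1r addrA.
have Nh : 0 <= N%:R * h by rewrite mulr_ge0.
have [at_|ta] := leP a t; have [t1|t1] := leP (a + N%:R * h) t;
  have [t2|t2] := ltP t (a + N%:R * h + h) => //=; rewrite ?addr0 ?add0r//; exfalso; lra.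
Qed.
End one_variable.

(** * The Poincare inequality on cubes *)

Section cubes.
Context {R : realType}.
Local Notation leb := (@lebesgue_measure R).
Local Notation mu n := (lebesgue_rV R n).

Definition cube n (r : R) (x : 'rV[R]_n) : R := \prod_i iv (- r) (2 * r) (x 0 i).
Definition tail n (x : 'rV[R]_n.+1) : 'rV[R]_n := (rV_uncons x).2.
(** A cube in which the first side is replaced by an interval. *)
Definition slab n (a h r : R) (x : 'rV[R]_n.+1) : R := iv a h (x 0 ord0) * cube r (tail x).

Lemma tail_cons n t (y : 'rV[R]_n) : tail (rV_cons (t, y)) = y.
Proof. by rewrite /tail rV_consK. Qed.

Lemma rV_cons_head n t (y : 'rV[R]_n) : rV_cons (t, y) 0 ord0 = t.
Proof. by rewrite mxE unlift_none. Qed.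

Lemma slab_cons n a h r t (y : 'rV[R]_n) : slab a h r (rV_cons (t, y)) = iv a h t * cube r y.
Proof. by rewrite /slab tail_cons rV_cons_head. Qed.

Lemma cubeS n r (x : 'rV[R]_n.+1) : cube r x = slab (- r) (2 * r) r x.
Proof.
rewrite /cube /slab big_ord_recl; congr (_ * _); apply: eq_bigr => i _.
by rewrite /tail /= mxE.
Qed.

Lemma measurable_cube n r : measurable_fun setT (cube r : 'rV[R]_n -> R).
Proof. exact: (measurable_rV_prod (fun=> measurable_iv (- r) (2 * r))). Qed.

Lemma measurable_tail n : measurable_fun setT (@tail n).
Proof. exact: (measurableT_comp measurable_snd (@measurable_rV_uncons R n)). Qed.

Lemma measurable_slab n a h r : measurable_fun setT (slab a h r : 'rV[R]_n.+1 -> R).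
Proof.
apply: measurable_funM; first exact: (measurable_rV_comp ord0 (measurable_iv a h)).
exact: (measurableT_comp (measurable_cube r) (@measurable_tail n)).
Qed.

Lemma cube_01 n r (x : 'rV[R]_n) : 0 <= cube r x <= 1.
Proof.
apply/andP; split; first by apply: prodr_ge0 => i _; exact: iv_ge0.
by apply: prodr_ile1 => i _; rewrite iv_ge0 iv_le1.
Qed.

Lemma cube_sqr n r (x : 'rV[R]_n) : cube r x ^+ 2 = cube r x.
Proof. by rewrite /cube -prodrXl; apply: eq_bigr => i _; exact: iv_sqr. Qed.

Lemma cube_norm n r (x : 'rV[R]_n) : `|cube r x| <= 1.
Proof. by have /andP[c0 c1] := cube_01 r x; rewrite ger0_norm. Qed.

Lemma slab_01 n a h r (x : 'rV[R]_n.+1) : 0 <= slab a h r x <= 1.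
Proof.
have /andP[c0 c1] := cube_01 r (tail x).
by rewrite /slab mulr_ge0 ?iv_ge0//= mulr_ile1 ?iv_ge0 ?iv_le1.
Qed.

Lemma slab_norm n a h r (x : 'rV[R]_n.+1) : `|slab a h r x| <= 1.
Proof. by have /andP[c0 c1] := slab_01 a h r x; rewrite ger0_norm. Qed.

Lemma slab_partition n a h r N (x : 'rV[R]_n.+1) : 0 <= h ->
  \sum_(k < N) slab (a + k%:R * h) h r x = slab a (N%:R * h) r x.
Proof. by move=> h0; rewrite /slab -iv_partition// mulr_suml. Qed.

Lemma csmooth1_sqr_bms n (F : 'rV[R]_n -> R) : csmooth1 F -> bms (fun x => F x ^+ 2).
Proof. by move=> cF; have [sF _] := cF; exact: (csmooth1_bms (csmooth1Ml sF cF)). Qed.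

Lemma bms_bounded n (F : 'rV[R]_n -> R) : bms F -> exists K, forall x, `|F x| <= K.
Proof. by move=> [_ [K [r [FK _]]]]; exists K. Qed.

Lemma bms_tail n (chi : 'rV[R]_n -> R) (F : 'rV[R]_n.+1 -> R) : bms chi -> bms F ->
  bms (fun x => chi (tail x) * F x).
Proof.
move=> [mc [K [r [cK _]]]] bF; apply: (bmsM _ (fun x => cK (tail x)) bF).
exact: (measurableT_comp mc (@measurable_tail n)).
Qed.

Lemma Rsummable_cons_swap n (F : 'rV[R]_n.+1 -> R) : measurable_fun setT F ->
  Rsummable (mu n.+1) F ->
  (forall y, Rsummable leb (fun t => F (rV_cons (t, y)))) -> (forall x, 0 <= F x) ->
  Rsummable (mu n) (fun y => \int[leb]_t F (rV_cons (t, y))).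
Proof.
move=> mF iF sF F0; have iG := Rsummable_cons mF iF.
have E : fubini_G leb (EFin \o (F \o rV_cons)) = (fun y => (\int[leb]_t F (rV_cons (t, y)))%:E).
  by apply/funext => y; rewrite /fubini_G -Rint_fine.
apply/integrableP; split; first by have := measurable_fubini_G iG; rewrite E.
rewrite (_ : (\int[_]_y _)%E = (\int[mu n]_y fubini_G leb (EFin \o (F \o rV_cons)) y)%E).
  rewrite (integral21_prod_meas1 iG); have := integral_fune_fin_num measurableT iG.
  by rewrite fin_numElt => /andP[].
rewrite E; apply: eq_integral => y _ /=; rewrite ger0_norm//.
by apply: Rint_ge0 => t; exact: F0.
Qed.

Lemma bms_cube n r : bms (cube r : 'rV[R]_n -> R).
Proof.
split; first exact: measurable_cube.
exists 1, r; split=> [x|x xr]; first exact: cube_norm.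
apply/eqP; apply: contra_notT xr; rewrite /cube prodf_seq_neq0 => /allP H i.
have := H i (mem_index_enum i); rewrite /= /iv pnatr_eq0 eqb0 negbK => /andP[h1 h2].
by rewrite in_itv/= h1 ltW// (lt_le_trans h2)//; lra.
Qed.

Lemma bms_interval n a h (chi : 'rV[R]_n -> R) : bms chi ->
  bms (fun x : 'rV[R]_n.+1 => iv a h (x 0 ord0) * chi (tail x)).
Proof.
move=> [mc [K [s [cK cs]]]]; split.
  apply: measurable_funM; first exact: (measurable_rV_comp ord0 (measurable_iv a h)).
  exact: (measurableT_comp mc (@measurable_tail n)).
exists K, (Num.max s (Num.max `|a| `|a + h|)); split=> [x|x xb].
  rewrite normrM -[leRHS]mul1r; apply: ler_pM => //; exact: iv_norm_le1.
have [z|nz] := eqVneq (iv a h (x 0 ord0)) 0; first by rewrite z mul0r.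
rewrite cs ?mulr0// => sb; apply: xb => i; rewrite in_itv/= -ler_norml.
case: (unliftP ord0 i) => [j|] ->; last first.
  move: nz; rewrite /iv pnatr_eq0 eqb0 negbK => /andP[h1 h2].
  rewrite !le_max; have [p|p] := leP 0 (x 0 ord0).
    by rewrite (ger0_norm p) (le_trans (ltW h2) (ler_norm _)) !orbT.
    have q : - x 0 ord0 <= `|a|.
      by apply: (@le_trans _ _ (- a)); [rewrite lerN2|rewrite -normrN ler_norm].
    by rewrite (ltr0_norm p) q orbT.
have := sb j; rewrite /tail /= mxE in_itv/= -ler_norml => h1.
by rewrite le_max h1.
Qed.

Lemma Rint_slab n a h (chi : 'rV[R]_n -> R) (F : 'rV[R]_n.+1 -> R) : bms chi -> bms F ->
  [/\ measurable_fun setT (fun t => \int[mu n]_y (chi y * F (rV_cons (t, y)))),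
      Rsummable leb (fun t => iv a h t * \int[mu n]_y (chi y * F (rV_cons (t, y)))) &
   \int[mu n.+1]_x (iv a h (x 0 ord0) * chi (tail x) * F x) =
   \int[leb]_t (iv a h t * \int[mu n]_y (chi y * F (rV_cons (t, y))))].
Proof.
move=> bc bF; have bG := bms_tail bc bF.
have mi : measurable_fun setT (fun x : 'rV[R]_n.+1 => iv a h (x 0 ord0)).
  exact: (measurable_rV_comp ord0 (measurable_iv a h)).
have bH := bmsM mi (fun x => iv_norm_le1 a h (x 0 ord0)) bG.
have [sG _] := Rint_bms_cons bG; have [sH EH] := Rint_bms_cons bH.
have eG : (fun t => \int[mu n]_y (chi (tail (rV_cons (t, y))) * F (rV_cons (t, y)))) =
          (fun t => \int[mu n]_y (chi y * F (rV_cons (t, y)))).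
  by apply/funext => t; apply: eq_Rintegral => y _; rewrite tail_cons.
have eH : (fun t => \int[mu n]_y (iv a h (rV_cons (t, y) 0 ord0) * (chi (tail (rV_cons (t, y))) * F (rV_cons (t, y))))) =
          (fun t => iv a h t * \int[mu n]_y (chi y * F (rV_cons (t, y)))).
  apply/funext => t; have <- := congr1 (fun f => f t) eG; rewrite -RintZ.
    by apply: eq_Rintegral => y _; rewrite rV_cons_head.
  exact: (Rsummable_bms (bms_slice t bG)).
rewrite eG in sG; rewrite eH in sH EH; split=> //; first exact: Rsummable_measurable sG.
by rewrite -EH; apply: eq_Rintegral => x _; rewrite mulrA.
Qed.

Lemma slab_oscillation n a h r (chi : 'rV[R]_n -> R) (F : 'rV[R]_n.+1 -> R) t s :
  0 <= h -> bms chi -> (forall y, cube r y * chi y = chi y) -> csmooth1 F ->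
  iv a h t != 0 -> iv a h s != 0 ->
  (\int[mu n]_y (chi y * F (rV_cons (t, y))) - \int[mu n]_y (chi y * F (rV_cons (s, y)))) ^+ 2 <=
  (\int[mu n]_y (chi y ^+ 2)) * (h * \int[mu n.+1]_x (slab a h r x * partial ord0 F x ^+ 2)).
Proof.
move=> h0 bc cc cF t1 s1; have [mc _] := bc; have [K HK] := bms_bounded bc.
have [sF _] := cF; have bF := csmooth1_bms cF.
have bF' := csmooth1_bms (csmooth1_partial ord0 cF).
have bFF := csmooth1_sqr_bms (csmooth1_partial ord0 cF).
have bt := csmooth1_bms (csmooth1_slice t cF); have bs := csmooth1_bms (csmooth1_slice s cF).
have cd := csmooth1B (csmooth1_slice t cF) (csmooth1_slice s cF).
have it := Rsummable_bms (bmsM mc HK bt); have is_ := Rsummable_bms (bmsM mc HK bs).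
rewrite -(RintB it is_).
have E : \int[mu n]_y (chi y * F (rV_cons (t, y)) - chi y * F (rV_cons (s, y))) =
  \int[mu n]_y (chi y * (cube r y * (F (rV_cons (t, y)) - F (rV_cons (s, y))))).
  apply: eq_Rintegral => y _; rewrite -{1 2}(cc y).
  by move: (F _) (F _) (chi y) (cube r y) => p q u v; ring.
have m1 : measurable_fun setT (fun y => cube r y * (F (rV_cons (t, y)) - F (rV_cons (s, y)))).
  by apply: measurable_funM; [exact: measurable_cube|have [] := csmooth1_bms cd].
have i1 : Rsummable (mu n) (fun y => chi y ^+ 2) by exact: (Rsummable_bms (bmsM mc HK bc)).
have i2 : Rsummable (mu n) (fun y => cube r y * (F (rV_cons (t, y)) - F (rV_cons (s, y))) ^+ 2).
  exact: (Rsummable_bms (bmsM (measurable_cube r) (cube_norm r) (csmooth1_sqr_bms cd))).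
have i3 : Rsummable (mu n) (fun y => (cube r y * (F (rV_cons (t, y)) - F (rV_cons (s, y)))) ^+ 2).
  by apply: eq_Rsummable i2 => y; rewrite exprMn cube_sqr.
have [_ CS] := Rint_CS mc m1 i1 i3.
rewrite E; apply: (le_trans CS); apply: ler_wpM2l; first exact: (Rint_ge0 _ (fun y => sqr_ge0 (chi y))).
have bS : bms (fun x => slab a h r x * partial ord0 F x ^+ 2).
  exact: (bmsM (measurable_slab a h r) (slab_norm a h r) bFF).
have [mS _] := bS.
have S0 x : 0 <= slab a h r x * partial ord0 F x ^+ 2.
  by have /andP[s0 _] := slab_01 a h r x; exact: (mulr_ge0 s0 (sqr_ge0 _)).
rewrite (Rint_cons_swap mS (Rsummable_bms bS) (fun y => bms_slice0 y bS)).
have sS : Rsummable (mu n) (fun y => \int[leb]_t0 (slab a h r (rV_cons (t0, y)) * partial ord0 F (rV_cons (t0, y)) ^+ 2)).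
  exact: (Rsummable_cons_swap mS (Rsummable_bms bS) (fun y => bms_slice0 y bS) S0).
rewrite -(RintZ h sS); apply: (Rint_le i3 (RsummableZ h sS)) => y.
rewrite exprMn cube_sqr.
have -> : \int[leb]_t0 (slab a h r (rV_cons (t0, y)) * partial ord0 F (rV_cons (t0, y)) ^+ 2) =
  cube r y * \int[leb]_t0 (iv a h t0 * partial ord0 F (rV_cons (t0, y)) ^+ 2).
  have mi : measurable_fun setT (fun x : 'rV[R]_n.+1 => iv a h (x 0 ord0)).
    exact: (measurable_rV_comp ord0 (measurable_iv a h)).
  have s4 := bms_slice0 y (bmsM mi (fun x => iv_norm_le1 a h (x 0 ord0)) bFF).
  have s5 : Rsummable leb (fun t0 => iv a h t0 * partial ord0 F (rV_cons (t0, y)) ^+ 2).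
    by apply: eq_Rsummable s4 => t0; rewrite rV_cons_head.
  rewrite -(RintZ (cube r y) s5); apply: eq_Rintegral => t0 _.
  by rewrite slab_cons -mulrA mulrCA.
rewrite [leRHS]mulrCA; apply: ler_wpM2l; first by have /andP[] := cube_01 r y.
have [L HL] := bms_bounded bF'.
have io t' s' : iv a h t' != 0 -> iv a h s' != 0 -> s' <= t' ->
    (F (rV_cons (t', y)) - F (rV_cons (s', y))) ^+ 2 <=
     h * \int[leb]_x (iv a h x * partial ord0 F (rV_cons (x, y)) ^+ 2).
  rewrite /iv !pnatr_eq0 !eqb0 !negbK => /andP[_ th] /andP[as_ _] st.
  apply: (@oscillation_sqr _ (fun t => F (rV_cons (t, y))) (fun t => partial ord0 F (rV_cons (t, y))) _ _ _ _ L) => //.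
  - by move=> x; exact: is_derive_slice.
  - exact: (slice0_continuous (smooth_partial ord0 sF)).
have [st|ts] := leP s t; first exact: io.
by rewrite -sqrrN opprB; apply: io => //; exact: ltW.
Qed.

(** The functional chi on slices is a function of the first variable with square-integrable
    derivative, so it is close to its means on short intervals. *)
Lemma coefficient_poincare n a h r N (chi : 'rV[R]_n -> R) (F : 'rV[R]_n.+1 -> R) :
  0 < h -> bms chi -> (forall y, cube r y * chi y = chi y) -> csmooth1 F ->
  let V t := \int[mu n]_y (chi y * F (rV_cons (t, y))) in
  Rsummable leb (fun t => iv a (N%:R * h) t * V t ^+ 2) /\
  \int[leb]_t (iv a (N%:R * h) t * V t ^+ 2) <=
  2 / h * \sum_(k < N) (\int[mu n.+1]_x (iv (a + k%:R * h) h (x 0 ord0) * chi (tail x) * F x)) ^+ 2 +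
  2 * h ^+ 2 * \int[mu n]_y (chi y ^+ 2) *
    \int[mu n.+1]_x (slab a (N%:R * h) r x * partial ord0 F x ^+ 2).
Proof.
move=> h0 bc cc cF V; have hh := ltW h0; have bF := csmooth1_bms cF.
have bFF := csmooth1_sqr_bms (csmooth1_partial ord0 cF).
have [mV _ _] := Rint_slab a h bc bF.
pose kap := \int[mu n]_y (chi y ^+ 2).
pose w (k : 'I_N) := \int[mu n.+1]_x (slab (a + k%:R * h) h r x * partial ord0 F x ^+ 2).
have P (k : 'I_N) := interval_poincare h0 mV
  (fun t s t1 s1 => slab_oscillation (a := a + k%:R * h) hh bc cc cF t1 s1).
have E t : iv a (N%:R * h) t * V t ^+ 2 = \sum_(k < N) (iv (a + k%:R * h) h t * V t ^+ 2).
  by rewrite -mulr_suml (iv_partition _ _ _ hh).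
have Ef : (fun t => iv a (N%:R * h) t * V t ^+ 2) =
    (fun t => \sum_(k < N) (iv (a + k%:R * h) h t * V t ^+ 2)).
  by apply/funext => t; exact: E.
have sV (k : 'I_N) : Rsummable leb (fun t => iv (a + k%:R * h) h t * V t ^+ 2) by have [] := P k.
rewrite Ef; split; first exact: (Rsummable_sum _ _ sV).
rewrite (Rint_sum _ _ sV).
have -> : \int[mu n.+1]_x (slab a (N%:R * h) r x * partial ord0 F x ^+ 2) = \sum_k w k.
  have sw (k : 'I_N) : Rsummable (mu n.+1) (fun x => slab (a + k%:R * h) h r x * partial ord0 F x ^+ 2).
    exact: (Rsummable_bms (bmsM (measurable_slab _ h r) (slab_norm _ h r) bFF)).
  rewrite /w -(Rint_sum _ _ sw); apply: eq_Rintegral => x _.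
  by rewrite -mulr_suml (slab_partition _ _ _ _ hh).
rewrite !mulr_sumr -big_split/=; apply: ler_sum => k _.
have [_ Pk] := P k; have [_ _ ->] := Rint_slab (a + k%:R * h) h bc bF.
apply: (le_trans Pk); rewrite -/V -/kap -/(w k).
by rewrite lerD2l le_eqVlt; apply/orP; left; apply/eqP; ring.
Qed.

(** Up to a small multiple of the Dirichlet energy, the mass on a cube is controlled by finitely
    many linear functionals.  The functionals in n + 1 variables are those in n variables applied
    to the slices and then averaged over short intervals of the first variable. *)
Theorem cube_poincare n (r e : R) : 0 < r -> 0 < e ->
  exists (I : finType) (chi : I -> 'rV[R]_n -> R) (C : R),
  [/\ 0 <= C, forall i, bms (chi i), forall i x, cube r x * chi i x = chi i x &
   forall F, csmooth1 F -> \int[mu n]_x (cube r x * F x ^+ 2) <=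
     C * (\sum_i (\int[mu n]_x (chi i x * F x)) ^+ 2) +
     e * \sum_j \int[mu n]_x (cube r x * partial j F x ^+ 2)].
Proof.
move=> r0 e0; elim: n => [|n [I [chi [C [C0 bchi cchi IH]]]]].
  exists unit, (fun _ _ => 1), 1; split=> //.
  - by move=> _; split; [exact: measurable_cst|exists 1, 0; split=> [x|x []]; rewrite ?normr1// => -[]].
  - by move=> _ x; rewrite /cube big_ord0 mulr1.
  move=> F _.
  have I0 (G : 'rV[R]_0 -> R) : \int[mu 0]_x G x = G 0.
    rewrite (_ : G = fun=> G 0); last by apply/funext => x; rewrite (thinmx0 x).
    rewrite /Rintegral integral_cst// [X in (_ * X)%E]/= diracT mule1//.
  by rewrite big_const card_unit /= !I0 big_ord0 /cube big_ord0 !mul1r mulr0 !addr0.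
pose S := \sum_i \int[mu n]_y (chi i y ^+ 2).
have S0 : 0 <= S.
  by apply: sumr_ge0 => i _; exact: (Rint_ge0 _ (fun y => sqr_ge0 (chi i y))).
(* With N >= X intervals of length h, averaging in the first variable costs 2 C S h^2 <= e. *)
pose X := 2 * C * S * (2 * r) ^+ 2 / e.
have X0 : 0 <= X by rewrite /X divr_ge0 ?mulr_ge0 ?sqr_ge0// ltW.
pose N := (Num.bound X).+1; pose h := 2 * r / N%:R.
have h0 : 0 < h by rewrite divr_gt0 ?mulr_gt0 ?ltr0n.
have Nh : N%:R * h = 2 * r by rewrite /h mulrC divfK// pnatr_eq0.
have small : C * (2 * h ^+ 2 * S) <= e.
  have XN : X <= N%:R.
    have := archi_boundP X0 => /ltW h1; apply: (le_trans h1); by rewrite ler_nat.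
  have N1 : 1 <= N%:R :> R by rewrite ler1n.
  have -> : C * (2 * h ^+ 2 * S) = e * X / N%:R ^+ 2.
    have en : e != 0 by rewrite gt_eqF.
    have Nn : N%:R != 0 :> R by rewrite pnatr_eq0.
    by rewrite /X /h; move: (N%:R) Nn => M Mn; field; rewrite en Mn.
  rewrite ler_pdivrMr ?exprn_gt0 ?ltr0n//; rewrite ler_pM2l//.
  apply: (le_trans XN); rewrite expr2; nra.
exists (I * 'I_N)%type, (fun (ik : I * 'I_N) (x : 'rV[R]_n.+1) => iv (- r + ik.2%:R * h) h (x 0 ord0) * chi ik.1 (tail x)), (C * (2 / h)).
split.
- by rewrite mulr_ge0// divr_ge0// ltW.
- by move=> ik; exact: bms_interval.
- move=> [i k] x /=; rewrite cubeS /slab mulrACA cchi; congr (_ * _).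
  rewrite /iv; case: (boolP ((- r + k%:R * h <= _) && _)) => [/andP[h1 h2]|_]; last by rewrite mulr0.
  have k0 : 0 <= k%:R * h by rewrite mulr_ge0// ltW.
  have kN : k%:R * h + h <= 2 * r.
    rewrite -Nh -{2}[h]mul1r -mulrDl natr1; apply: ler_wpM2r; first exact: ltW.
    by rewrite ler_nat.
  by rewrite (le_trans _ h1) ?lerDl//= (lt_le_trans h2) ?mulr1// -addrA lerD2l.
move=> F cF; have [sF _] := cF; have bFF := csmooth1_sqr_bms cF.
have mc := measurable_cube (n := n.+1) r; have c1 := cube_norm (n := n.+1) r.
have bcube : bms (cube r : 'rV[R]_n -> R).
  exact: bms_cube.
have [_ sL EL] := Rint_slab (- r) (2 * r) bcube bFF.
have EL2 : \int[mu n.+1]_x (cube r x * F x ^+ 2) =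
  \int[leb]_t (iv (- r) (2 * r) t * \int[mu n]_y (cube r y * F (rV_cons (t, y)) ^+ 2)).
  by rewrite -EL; apply: eq_Rintegral => x _; rewrite cubeS.
pose V i t := \int[mu n]_y (chi i y * F (rV_cons (t, y))).
pose G j t := \int[mu n]_y (cube r y * partial (lift ord0 j) F (rV_cons (t, y)) ^+ 2).
have CP i := coefficient_poincare (- r) N h0 (bchi i) (cchi i) cF.
have sG j : Rsummable leb (fun t => iv (- r) (2 * r) t * G j t) /\
   \int[mu n.+1]_x (cube r x * partial (lift ord0 j) F x ^+ 2) = \int[leb]_t (iv (- r) (2 * r) t * G j t).
  have [_ s1 s2] := Rint_slab (- r) (2 * r) bcube (csmooth1_sqr_bms (csmooth1_partial (lift ord0 j) cF)).
  by split=> //; rewrite -s2; apply: eq_Rintegral => x _; rewrite cubeS.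
have sV i : Rsummable leb (fun t => iv (- r) (2 * r) t * V i t ^+ 2) by rewrite -Nh; have [] := CP i.
have s1 : Rsummable leb (fun t => \sum_i iv (- r) (2 * r) t * V i t ^+ 2) by exact: (Rsummable_sum _ _ sV).
have s2 : Rsummable leb (fun t => \sum_j iv (- r) (2 * r) t * G j t).
  by apply: (Rsummable_sum _ _) => j; have [] := sG j.
have le1 : \int[mu n.+1]_x (cube r x * F x ^+ 2) <=
   C * (\sum_i \int[leb]_t (iv (- r) (2 * r) t * V i t ^+ 2)) +
   e * \sum_j \int[leb]_t (iv (- r) (2 * r) t * G j t).
  rewrite -(Rint_sum _ _ sV) -(Rint_sum _ _ (fun j => (sG j).1)) -(RintZ C s1) -(RintZ e s2).
  rewrite EL2 -(RintD (RsummableZ C s1) (RsummableZ e s2)).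
  apply: (Rint_le sL (RsummableD (RsummableZ C s1) (RsummableZ e s2))) => t.
  rewrite -!mulr_sumr (mulrCA C) (mulrCA e) -mulrDr; apply: ler_wpM2l; first exact: iv_ge0.
  have ES : \sum_j \int[mu n]_y (cube r y * partial j (fun y => F (rV_cons (t, y))) y ^+ 2) = \sum_j G j t.
    by apply: eq_bigr => j _; apply: eq_Rintegral => y _; rewrite partial_slice.
  have IHt := IH _ (csmooth1_slice t cF); rewrite ES in IHt; exact: IHt.
apply: (le_trans le1); rewrite big_ord_recl mulrDr addrA.
have -> : \sum_j \int[leb]_t (iv (- r) (2 * r) t * G j t) =
   \sum_j \int[mu n.+1]_x (cube r x * partial (lift ord0 j) F x ^+ 2).
  by apply: eq_bigr => j _; have [_ ->] := sG j.
rewrite lerD2r.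
pose W := \int[mu n.+1]_x (cube r x * partial ord0 F x ^+ 2).
have W0 : 0 <= W.
  apply: Rint_ge0 => x; have /andP[c0 _] := cube_01 r x; exact: (mulr_ge0 c0 (sqr_ge0 _)).
have EW : \int[mu n.+1]_x (slab (- r) (2 * r) r x * partial ord0 F x ^+ 2) = W.
  by apply: eq_Rintegral => x _; rewrite cubeS.
rewrite -mulrA -/W.
apply: (@le_trans _ _ (C * (\sum_i (2 / h * \sum_(k < N) (\int[mu n.+1]_x (iv (- r + k%:R * h) h (x 0 ord0) * chi i (tail x) * F x)) ^+ 2 +
  2 * h ^+ 2 * \int[mu n]_y (chi i y ^+ 2) * W)))).
  apply: ler_wpM2l => //; apply: ler_sum => i _.
  by have [_] := CP i; rewrite Nh EW.
rewrite big_split/= mulrDr; apply: lerD.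
  apply: ler_wpM2l => //; rewrite -mulr_sumr; apply: ler_wpM2l; first by rewrite divr_ge0// ltW.
  by rewrite pair_bigA.
rewrite -mulr_suml -mulr_sumr -/S mulrA; apply: ler_wpM2r => //; exact: small.
Qed.
End cubes.

(** * Local compactness *)

Section precompactness.
Context {R : realType} {n : nat}.
Local Notation mu := (lebesgue_rV R n).
Local Notation fct := ('rV[R]_n -> R).
Implicit Types (U : set_system nat) (c : nat -> R) (f : nat -> fct).

(** Bounded sequences converge along an ultrafilter by compactness of the segment. *)
Lemma ultra_cauchy U c (B e : R) : UltraFilter U -> (forall k, `|c k| <= B) -> 0 < e ->
  exists2 A, U A & forall k l, A k -> A l -> `|c k - c l| <= e.
Proof.
move=> UU cB e0.
have [p [_ /= cl]] : [set` `[- B, B]] `&` cluster (c @ U) !=set0.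
  apply: (@segment_compact R (- B) B); rewrite /fmap /=.
  by apply: filterS filterT => k _; rewrite /= in_itv/= -ler_norml.
pose A := c @^-1` ball p (e / 2).
have [UA|UA] := in_ultra_setVsetC A UU; last first.
  have [x [/= Cx bx]] := cl (~` ball p (e / 2)) (ball p (e / 2)) UA (nbhsx_ballx p _ (divr_gt0 e0 (ltr0n R 2))).
  by [].
exists A => // k l; rewrite /A /ball /= => h1 h2.
have -> : c k - c l = (p - c l) - (p - c k) by ring.
by apply: (le_trans (ler_normB _ _)); lra.
Qed.

Lemma cube_wgt p (r : R) : 0 <= p -> 0 < r -> exists2 M : R, 0 <= M &
  forall x : 'rV[R]_n, cube r x <= M * wgt (- p) x.
Proof.
move=> p0 r0; exists ((1 + n%:R * r ^+ 2) `^ (p / 2)) => [|x]; first exact: powR_ge0.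
have w := wgt_ge0 (- p) x; have /andP[c0 c1] := cube_01 r x.
have [z|nz] := eqVneq (cube r x) 0; first by rewrite z mulr_ge0// powR_ge0.
apply: (le_trans c1); rewrite -[leLHS](wgt0 x) -(subrr p) wgtD; apply: ler_wpM2r => //.
have h : jap2 x <= 1 + n%:R * r ^+ 2.
  rewrite lerD2l /dotp (@le_trans _ _ (\sum_(i < n) r ^+ 2))//; last first.
    by rewrite sumr_const card_ord mulr_natl.
  apply: ler_sum => i _.
  move: nz; rewrite /cube prodf_seq_neq0 => /allP/(_ i (mem_index_enum i)).
  rewrite /= /iv pnatr_eq0 eqb0 negbK => /andP[h1 h2].
  move: (x 0 i) h1 h2 => t h1 h2.
  have p1 : 0 <= r - t by lra.
  have p2 : 0 <= r + t by lra.
  by have := mulr_ge0 p1 p2; rewrite expr2; lra.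
have d2 : 0 <= p / 2 by rewrite divr_ge0.
have j0 := ltW (jap2_gt0 x).
by apply: (ge0_ler_powR d2); rewrite ?nnegrE// (le_trans j0 h).
Qed.

Lemma tail_wgt eta (r : R) (x : 'rV[R]_n) : 0 <= eta -> 0 < r ->
  r `^ eta * (1 - cube r x) <= wgt eta x.
Proof.
move=> e0 r0; have w := wgt_ge0 eta x; have /andP[c0 c1] := cube_01 r x.
have [c1'|c1'] := eqVneq (cube r x) 1; first by rewrite c1' subrr mulr0.
have z : cube r x = 0.
  by have := cube_sqr r x; move: (cube r x) c1' => z z1 h; have /eqP := h;
     rewrite -subr_eq0 expr2 -{3}[z]mulr1 -mulrBr mulf_eq0 subr_eq0 (negbTE z1) orbF => /eqP.
rewrite z subr0 mulr1 -wgt_powR.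
have /eqP := z; rewrite /cube prodf_seq_eq0 => /hasP[i _].
rewrite /= /iv pnatr_eq0 eqb0 => h.
have ri : r <= `|x 0 i|.
  rewrite leNgt; apply: contra h; rewrite ltr_norml => /andP[h1 h2].
  by rewrite (ltW h1)//=; lra.
by apply: (ge0_ler_powR e0); rewrite ?nnegrE ?(ltW r0) ?wgt_ge0// (le_trans ri)// coord_le_wgt.
Qed.

Lemma Rint_sqr_diff (w f g : fct) (K : R) : smooth w -> (forall x, 0 <= w x) -> csmooth1 f -> csmooth1 g ->
  \int[mu]_x (w x * f x ^+ 2) <= K -> \int[mu]_x (w x * g x ^+ 2) <= K ->
  \int[mu]_x (w x * (f x - g x) ^+ 2) <= 4 * K.
Proof.
move=> sw w0 cf cg hf hg.
have s (F : fct) : csmooth1 F -> Rsummable mu (fun x => w x * F x ^+ 2).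
  by move=> cF; have [sF _] := cF; exact: (csmooth1_Rsummable (csmooth1Ml sw (csmooth1Ml sF cF))).
apply: (@le_trans _ _ (\int[mu]_x (2 * (w x * f x ^+ 2 + w x * g x ^+ 2)))); last first.
  by rewrite (RintZ 2 (RsummableD (s f cf) (s g cg))) (RintD (s f cf) (s g cg)); lra.
apply: (Rint_le (s _ (csmooth1B cf cg)) (RsummableZ 2 (RsummableD (s f cf) (s g cg)))) => x.
rewrite -mulrDr [leRHS]mulrCA; apply: ler_wpM2l => //.
by have := sqr_ge0 (f x + g x); move: (f x) (g x) => a b; nra.
Qed.

(** The mass of a difference is split between the outside of a large cube, where the growing weight
    makes it small, and the cube, where up to a small multiple of the energy it is controlled by
    finitely many functionals; those are Cauchy along the ultrafilter. *)
Lemma ultra_L2_cauchy U f (eta p K e : R) : UltraFilter U -> 0 < eta -> 0 <= p ->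
  (forall k, csmooth1 (f k)) ->
  (forall k, \int[mu]_x (f k x ^+ 2) <= K) ->
  (forall k j, \int[mu]_x (wgt (- p) x * partial j (f k) x ^+ 2) <= K) ->
  (forall k, \int[mu]_x (wgt eta x * f k x ^+ 2) <= K) -> 0 < e ->
  exists2 A, U A & forall k l, A k -> A l -> \int[mu]_x ((f k x - f l x) ^+ 2) <= e.
Proof.
move=> UU eta0 p0 cf H1 H2 H3 e0.
have K0 : 0 <= K by apply: le_trans (H1 0%N); exact: (Rint_ge0 _ (fun x => sqr_ge0 (f 0%N x))).
(* The radius r, the small factor e1 and the tolerance del keep the contributions of the exterior,
   of the gradients and of the functionals below e / 3 each. *)
pose Q := 12 * K / e + 1.
have Q0 : 0 < Q by rewrite ltr_wpDl// divr_ge0 ?mulr_ge0// (ltW e0).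
pose r := Q `^ (eta^-1).
have r0 : 0 < r by exact: powR_gt0.
have rQ : r `^ eta = Q by rewrite -powRrM mulVf ?gt_eqF// powRr1// ltW.
have [M M0 HM] := cube_wgt p0 r0.
pose nK := n%:R * (4 * K).
have nK0 : 0 <= nK by rewrite !mulr_ge0.
pose e1 := e / (3 * (M * nK + 1)).
have d10 : 0 < 3 * (M * nK + 1) by rewrite mulr_gt0// ltr_wpDl// mulr_ge0.
have e10 : 0 < e1 by rewrite divr_gt0.
have e1M : e1 * (M * nK) <= e / 3.
  rewrite /e1 mulrAC ler_pdivrMr// ; have : 0 <= e by exact: ltW.
  by move: (M * nK) => z; nra.
have [I [chi [C [C0 bchi cchi HC]]]] := cube_poincare n r0 e10.
pose d2 := C * #|I|%:R + 1.
have d20 : 0 < d2 by rewrite ltr_wpDl// mulr_ge0.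
pose del := Num.min 1 (e / (3 * d2)).
have del0 : 0 < del by rewrite lt_min ltr01 divr_gt0// mulr_gt0.
have delC : C * (#|I|%:R * del ^+ 2) <= e / 3.
  have h1 : del <= 1 by rewrite ge_min lexx.
  have h2 : del * (3 * d2) <= e by rewrite -ler_pdivlMr ?mulr_gt0// ge_min lexx orbT.
  have h3 : 0 <= C * #|I|%:R by rewrite mulr_ge0.
  clearbody del; rewrite mulrA; move: h2; rewrite /d2; move: (C * #|I|%:R) h3 => z z0 h2.
  have : z * del ^+ 2 <= z * del by apply: ler_wpM2l => //; rewrite expr2; nra.
  by nra.
have ic k i : Rsummable mu (fun x => chi i x * f k x).
  have [mc _] := bchi i; have [B HB] := bms_bounded (bchi i).
  exact: (Rsummable_bms (bmsM mc HB (csmooth1_bms (cf k)))).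
pose c i k := \int[mu]_x (chi i x * f k x).
have cb i k : `|c i k| <= 1 + (\int[mu]_x (chi i x ^+ 2)) * K.
  have [mc _] := bchi i; have [B HB] := bms_bounded (bchi i).
  have i1 : Rsummable mu (fun x => chi i x ^+ 2) by exact: (Rsummable_bms (bmsM mc HB (bchi i))).
  have i2 : Rsummable mu (fun x => f k x ^+ 2) by exact: (Rsummable_bms (csmooth1_sqr_bms (cf k))).
  have [mf _] := csmooth1_bms (cf k).
  have [_ CS] := Rint_CS mc mf i1 i2.
  have : c i k ^+ 2 <= (\int[mu]_x (chi i x ^+ 2)) * K.
    apply: (le_trans CS); apply: ler_wpM2l; last exact: H1.
    exact: (Rint_ge0 _ (fun x => sqr_ge0 (chi i x))).
  rewrite -(real_normK (num_real (c i k))); move: (_ * K) (`|c i k|) (normr_ge0 (c i k)) => q z z0 h; nra.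
pose A i := projT1 (cid2 (ultra_cauchy UU (cb i) del0)).
have UA i : U (A i) by rewrite /A; case: cid2.
have HA i k l : A i k -> A i l -> `|c i k - c i l| <= del by rewrite /A; case: cid2 => B UB HB /= ? ?; exact: HB.
exists [set k | forall i, A i k]; first exact: (@filter_forall nat I A U _ UA).
move=> k l /= Ak Al.
pose D : fct := fun x => f k x - f l x.
have cD : csmooth1 D by exact: (csmooth1B (cf k) (cf l)).
have bDD := csmooth1_sqr_bms cD.
have iD := Rsummable_bms bDD.
have iC : Rsummable mu (fun x => cube r x * D x ^+ 2).
  exact: (Rsummable_bms (bmsM (measurable_cube r) (cube_norm r) bDD)).
have E : \int[mu]_x (D x ^+ 2) = \int[mu]_x (cube r x * D x ^+ 2) +
    (\int[mu]_x (D x ^+ 2) - \int[mu]_x (cube r x * D x ^+ 2)) by rewrite addrC subrK.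
have T1 : \int[mu]_x (D x ^+ 2) - \int[mu]_x (cube r x * D x ^+ 2) <= e / 3.
  have h : Q * (\int[mu]_x (D x ^+ 2) - \int[mu]_x (cube r x * D x ^+ 2)) <= 4 * K.
    rewrite -(RintB iD iC) -(RintZ Q (RsummableB iD iC)).
    apply: (@le_trans _ _ (\int[mu]_x (wgt eta x * D x ^+ 2))); last first.
      exact: (Rint_sqr_diff (smooth_wgt eta) (wgt_ge0 eta) (cf k) (cf l) (H3 k) (H3 l)).
    have [sD _] := cD.
    apply: (Rint_le (RsummableZ Q (RsummableB iD iC)) (csmooth1_Rsummable (csmooth1Ml (smooth_wgt eta) (csmooth1Ml sD cD)))) => x.
    have -> : Q * (D x ^+ 2 - cube r x * D x ^+ 2) = (r `^ eta * (1 - cube r x)) * D x ^+ 2.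
      by rewrite rQ; ring.
    by apply: ler_wpM2r; [exact: sqr_ge0|exact: (tail_wgt x (ltW eta0) r0)].
  rewrite -(ler_pM2l Q0); apply: (le_trans h).
  have -> : Q * (e / 3) = 4 * K + e / 3 by rewrite /Q; field; rewrite gt_eqF.
  by rewrite lerDl divr_ge0// ltW.
have T2 : \int[mu]_x (cube r x * D x ^+ 2) <= e / 3 + e / 3.
  apply: (le_trans (HC D cD)); apply: lerD.
    apply: le_trans delC; apply: ler_wpM2l => //.
    apply: (@le_trans _ _ (\sum_(i : I) del ^+ 2)); last by rewrite sumr_const mulr_natl.
    apply: ler_sum => i _.
    have -> : \int[mu]_x (chi i x * D x) = c i k - c i l.
      rewrite /c -(RintB (ic k i) (ic l i)); apply: eq_Rintegral => x _.
      by rewrite /D mulrBr.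
    rewrite -(real_normK (num_real (c i k - c i l))) lerXn2r ?nnegrE ?(ltW del0)//.
    exact: HA.
  apply: le_trans e1M; apply: ler_wpM2l; first exact: ltW.
  have -> : M * nK = \sum_(j < n) M * (4 * K).
    by rewrite sumr_const card_ord /nK -[RHS]mulr_natl; ring.
  apply: ler_sum => j _.
  have cj m := csmooth1_partial j (cf m).
  have cDj := csmooth1_partial j cD; have [sDj _] := cDj.
  have i1 := csmooth1_Rsummable (csmooth1Ml (smooth_wgt (- p)) (csmooth1Ml sDj cDj)).
  apply: (@le_trans _ _ (\int[mu]_x (M * (wgt (- p) x * partial j D x ^+ 2)))).
    apply: Rint_le.
    - exact: (Rsummable_bms (bmsM (measurable_cube r) (cube_norm r) (csmooth1_sqr_bms cDj))).
    - exact: (RsummableZ M i1).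
    - move=> x; rewrite mulrA; apply: ler_wpM2r; [exact: sqr_ge0|exact: HM].
  rewrite (RintZ M i1); apply: ler_wpM2l => //.
  have [sk _] := cf k; have [sl _] := cf l.
  rewrite (partialB j sk sl).
  exact: (Rint_sqr_diff (smooth_wgt (- p)) (wgt_ge0 (- p)) (cj k) (cj l) (H2 k j) (H2 l j)).
by rewrite -/(D _) E; apply: (le_trans (lerD T2 T1)); lra.
Qed.
End precompactness.

(** * Extraction and completeness *)

Lemma extraction (R : realType) (Q : nat -> nat -> R) (U : set_system nat) (e : nat -> R) :
  UltraFilter U -> \oo `<=` U -> (forall j, 0 < e j) ->
  (forall e, 0 < e -> exists2 A, U A & forall k l, A k -> A l -> Q k l <= e) ->
  exists2 s : nat -> nat, {homo s : i j / (i < j)%N} & forall j, Q (s j.+1) (s j) <= e j.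
Proof.
move=> UU Uoo e0 H.
have /choice[A HA] : forall j, exists A : set nat, U A /\ forall k l, A k -> A l -> Q k l <= e j.
  by move=> j; have [A UA HA] := H _ (e0 j); exists A.
(* The B j decrease, so that two consecutive terms of the subsequence both lie in A j. *)
pose B := fix B j := if j is i.+1 then B i `&` A j else A 0%N.
have UB j : U (B j).
  elim: j => [|j IH] /=; first by have [] := HA 0%N.
  by apply: filterI => //; have [] := HA j.+1.
have BA j : B j `<=` A j by case: j => [|j] x //= [].
have ex (j m : nat) : exists k, (m < k)%N /\ B j k.
  have Um : U [set k | (m < k)%N] by apply: Uoo; exact: nbhs_infty_gt.
  by have [k [h1 h2]] := filter_ex (filterI Um (UB j)); exists k.
have /choice[pk Hpk] : forall jm : nat * nat, exists k, (jm.2 < k)%N /\ B jm.1 k.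
  by move=> [j m]; exact: ex.
pose s := fix s j := if j is i.+1 then pk (j, s i) else pk (0%N, 0%N).
have sB j : B j (s j) by case: j => [|j]; [have [] := Hpk (0%N, 0%N)|have [] := Hpk (j.+1, s j)].
have sS k : (s k < s k.+1)%N by have [] := Hpk (k.+1, s k).
exists s => [|j]; first exact: (homo_ltn ltn_trans sS).
have [_ HQ] := HA j; apply: HQ; last exact: BA.
by apply: BA; have [] := sB j.+1.
Qed.

Section completeness.
Context d (T : measurableType d) (R : realType) (mu : {measure set T -> \bar R}).
Implicit Types (a : nat -> R) (f : nat -> T -> R).

Lemma dyadic_gt0 j : 0 < (2 : R) ^+ j. Proof. by rewrite exprn_gt0. Qed.

(** The Cauchy-Schwarz inequality with dyadic weights, organised as an induction. *)
Lemma dyadic_telescope a m q : (a (m + q)%N - a m) ^+ 2 <=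
  2 * 2 ^- m * \sum_(m <= j < m + q) 2 ^+ j * (a j.+1 - a j) ^+ 2.
Proof.
elim: q m => [|q IH] m; first by rewrite addn0 subrr big_geq// expr0n mulr0.
rewrite big_ltn; last by rewrite addnS ltnS leq_addr.
have -> : a (m + q.+1)%N - a m = (a (m.+1 + q)%N - a m.+1) + (a m.+1 - a m).
  by rewrite addSnnS addrA subrK.
have := IH m.+1; rewrite addSnnS; set S := \sum_(_ <= _ < _) _.
set X := a (m + q.+1)%N - _; set Y := a m.+1 - a m => h.
have E : 2 * 2 ^- m * (2 ^+ m * Y ^+ 2 + S) = 2 * Y ^+ 2 + 2 * (2 * 2 ^- m.+1 * S).
  have := dyadic_gt0 m; rewrite (exprS 2 m); move: (2 ^+ m) => z z0; field; rewrite gt_eqF//.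
rewrite E; apply: (@le_trans _ _ (2 * Y ^+ 2 + 2 * X ^+ 2)); last by lra.
by have := sqr_ge0 (X - Y); nra.
Qed.

Lemma dyadic_sum m : \sum_(0 <= j < m) (2 ^- j : R) <= 2.
Proof.
suff -> : \sum_(0 <= j < m) (2 ^- j : R) = 2 - 2 * 2 ^- m.
  by rewrite gerBl mulr_ge0// invr_ge0 ltW// dyadic_gt0.
elim: m => [|m IH]; first by rewrite big_geq// expr0 invr1 mulr1 subrr.
rewrite big_nat_recr//= IH (exprS 2 m); have := dyadic_gt0 m; move: (2 ^+ m) => z z0; field; rewrite gt_eqF//.
Qed.

Lemma dyadic_cvg a (g : R) : (forall m, \sum_(0 <= j < m) 2 ^+ j * (a j.+1 - a j) ^+ 2 <= g) ->
  exists2 l, a @ \oo --> l & forall m, (l - a m) ^+ 2 <= 2 * 2 ^- m * g.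
Proof.
move=> Hg; have : cvgn (series (fun j => a j.+1 - a j)).
  apply: normed_cvg; apply: nondecreasing_is_cvgn.
    apply: nondecreasing_series => j _ _; exact: normr_ge0.
  exists (2 + g) => _ [m _ <-]; rewrite /series /=.
  apply: (@le_trans _ _ (\sum_(0 <= j < m) (2 ^- j + 2 ^+ j * (a j.+1 - a j) ^+ 2))).
    apply: ler_sum => j _; rewrite -(real_normK (num_real (a j.+1 - a j))).
    have := dyadic_gt0 j; move: (2 ^+ j) `|_| (normr_ge0 (a j.+1 - a j)) => z t t0 z0.
    rewrite -(ler_pM2l z0) mulrDr divff ?gt_eqF//; nra.
  by rewrite big_split/= lerD// dyadic_sum.
move=> cS; have E : a = fun m => a 0%N + series (fun j => a j.+1 - a j) m.
  by apply/funext => m; rewrite /series /= telescope_sumr// addrC subrK.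
have ca : a @ \oo --> a 0%N + limn (series (fun j => a j.+1 - a j)).
  by rewrite {1}E; apply: cvgD; [exact: cvg_cst|exact: cS].
exists (a 0%N + limn (series (fun j => a j.+1 - a j))) => // m.
move: (_ + _) ca => l ca.
have c1 : (fun k => (a k - a m) ^+ 2) @ \oo --> (l - a m) ^+ 2.
  by rewrite expr2; under eq_fun do rewrite expr2; apply: cvgM; apply: cvgB => //; exact: cvg_cst.
apply: (ler_cvg_to c1 (cvg_cst (2 * 2 ^- m * g))).
exists m => // k /= mk; rewrite -(subnKC mk); apply: (le_trans (dyadic_telescope _ _ _)).
apply: ler_wpM2l; first by rewrite mulr_ge0// invr_ge0 ltW// dyadic_gt0.
apply: le_trans (Hg (m + (k - m))%N).
rewrite [leRHS](@big_cat_nat _ _ _ m)//= ?leq_addr// lerDr.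
by apply: sumr_ge0 => j _; rewrite mulr_ge0 ?sqr_ge0// ltW// dyadic_gt0.
Qed.

(** The function G below, the sum of 2^j |f_(j+1) - f_j|^2, has a finite integral.  Where it is
    finite the sequence converges, and the square of the error at step m is at most 2^(1-m) G;
    where it is infinite this bound is void, so no exceptional set has to be discussed. *)
Theorem rapidly_cauchy_cvg f : (forall j, measurable_fun setT (f j)) ->
  (forall j, (\int[mu]_x ((f j.+1 x - f j x) ^+ 2)%:E <= ((2 ^- j) ^+ 2)%:E)%E) ->
  exists2 v : T -> R, measurable_fun setT v &
    forall m, (\int[mu]_x ((v x - f m x) ^+ 2)%:E <= (4 * 2 ^- m)%:E)%E.
Proof.
move=> mf Hf; pose D j x := (2 ^+ j * (f j.+1 x - f j x) ^+ 2 : R).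
have D0 j x : 0 <= D j x by rewrite mulr_ge0 ?sqr_ge0// ltW// dyadic_gt0.
have mD j : measurable_fun setT (fun x => (D j x)%:E).
  apply/measurable_EFinP; apply: measurable_funM => //.
  by apply: measurable_funX; exact: measurable_funB.
pose G x := (\sum_(0 <= j <oo) (D j x)%:E)%E.
have G0 x : (0 <= G x)%E by apply: nneseries_ge0 => j _ _; rewrite lee_fin.
have mG : measurable_fun setT G by apply: ge0_emeasurable_sum => // j x _ _; rewrite lee_fin.
have IG : (\int[mu]_x G x <= 2%:E)%E.
  rewrite /G integral_nneseries//; last by move=> j x _; rewrite lee_fin.
  apply: lime_le; first by apply: is_cvg_nneseries => j _ _; apply: integral_ge0 => x _; rewrite lee_fin.
  apply: nearW => m; apply: (@le_trans _ _ (\sum_(0 <= j < m) (2 ^- j : R)%:E)%E).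
    apply: lee_sum => j _.
    have -> : (\int[mu]_x (D j x)%:E = (2 ^+ j)%:E * \int[mu]_x ((f j.+1 x - f j x) ^+ 2)%:E)%E.
      under eq_integral do rewrite EFinM.
      rewrite ge0_integralZl_EFin//.
      - by move=> x _; rewrite lee_fin sqr_ge0.
      - by apply/measurable_EFinP; apply: measurable_funX; exact: measurable_funB.
    apply: (@le_trans _ _ ((2 ^+ j)%:E * ((2 ^- j) ^+ 2)%:E)%E).
      by apply: lee_wpmul2l; [rewrite lee_fin ltW// dyadic_gt0|exact: Hf].
    rewrite -EFinM lee_fin; have := dyadic_gt0 j; move: (2 ^+ j) => z z0.
    by rewrite expr2 mulrA divff ?gt_eqF// mul1r.
  by rewrite sumEFin lee_fin dyadic_sum.
have fin x : (G x < +oo)%E -> forall m, \sum_(0 <= j < m) D j x <= fine (G x).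
  move=> Gx m; rewrite -lee_fin fineK ?ge0_fin_numE// -sumEFin.
  by apply: nneseries_lim_ge => j _ _; rewrite lee_fin.
pose Z := [set x | (G x < +oo)%E].
have mZ : measurable Z.
  by rewrite -[Z]setTI; exact: (measurable_lte measurableT mG (measurable_cst _)).
have lx x : exists l : R, (fun m => f m x * \1_Z x) @ \oo --> l /\
    forall m, (((l - f m x) ^+ 2)%:E <= (2 * 2 ^- m)%:E * G x)%E.
  have [Gx|Gx] := boolP (G x < +oo)%E.
    have [l cl Hl] := dyadic_cvg (fin x Gx); exists l; split.
      by rewrite indicE mem_set//; under eq_fun do rewrite mulr1.
    move=> m; rewrite -(@fineK _ (G x)) ?ge0_fin_numE//.
    by rewrite -EFinM lee_fin; exact: Hl.
  have Goo : G x = +oo%E by move: Gx; rewrite ltey negbK => /eqP.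
  exists 0; split.
    rewrite indicE memNset => [|]; last by rewrite /Z /= Goo ltxx.
    by under eq_fun do rewrite mulr0; exact: cvg_cst.
  move=> m; rewrite Goo gt0_muley ?leey// lte_fin mulr_gt0// invr_gt0; exact: dyadic_gt0.
have /choice[v Hv] := lx.
have c0 m : 0 <= 2 * 2 ^- m :> R by rewrite mulr_ge0// invr_ge0 ltW// dyadic_gt0.
have mv : measurable_fun setT v.
  have mh m : measurable_fun setT (fun x => f m x * \1_Z x).
    by apply: measurable_funM => //; exact: measurable_indic.
  exact: (measurable_fun_cvg mh (fun x _ => (Hv x).1)).
exists v => // m; apply: (@le_trans _ _ (\int[mu]_x ((2 * 2 ^- m)%:E * G x))%E).
  apply: ge0_le_integral => //.
  - by move=> x _; rewrite lee_fin sqr_ge0.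
  - apply/measurable_EFinP; apply: measurable_funX; exact: measurable_funB.
  - exact: measurable_funeM.
  - by move=> x _; exact: (Hv x).2.
rewrite ge0_integralZl_EFin//.
apply: (@le_trans _ _ ((2 * 2 ^- m)%:E * 2%:E)%E).
  by apply: lee_wpmul2l => //; rewrite lee_fin.
by rewrite -EFinM lee_fin; have := c0 m; lra.
Qed.
End completeness.

(** * The L2 norm as an energy *)

Section L2_facts.
Context {R : realType} {n : nat}.
Local Notation mu := (lebesgue_rV R n).
Local Notation cfct := ('rV[R]_n -> R[i]).
Implicit Types (u v w : cfct) (c : R).

Definition cmass u : 'rV[R]_n -> R :=
  mass (fun x => complex.Re (u x)) (fun x => complex.Im (u x)).
Definition energy u : \bar R := (\int[mu]_x (cmass u x)%:E)%E.
Definition cmeasurable u := measurable_fun setT (fun x => complex.Re (u x)) /\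
  measurable_fun setT (fun x => complex.Im (u x)).

Lemma energy_ge0 u : (0 <= energy u)%E.
Proof. by apply: integral_ge0 => x _; rewrite lee_fin mass_ge0. Qed.

Lemma L2normE u : L2norm u = (energy u `^ 2^-1)%E.
Proof.
rewrite /L2norm unlock /energy; congr (_ `^ _)%E; apply: eq_integral => x _ /=.
rewrite powR_mulrn ?normr_ge0// real_normK ?num_real// /cmass /mass.
by case: (u x) => a b /=; rewrite sqr_sqrtr// addr_ge0 ?sqr_ge0.
Qed.

Lemma L2norm_le u c : 0 <= c -> (L2norm u <= c%:E)%E = (energy u <= (c ^+ 2)%:E)%E.
Proof.
move=> c0; rewrite L2normE; have e0 := energy_ge0 u.
have h2 : 0 <= 2^-1 :> R by rewrite invr_ge0.
apply/idP/idP => [h|h].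
  have -> : energy u = ((energy u `^ 2^-1) `^ 2)%E by rewrite -poweRrM mulVf// poweRe1.
  have -> : (c ^+ 2)%:E = (c%:E `^ 2)%E by rewrite poweR_EFin powR_mulrn.
  by apply: gt0_ler_poweR; rewrite // in_itv/= ?leey ?andbT ?poweR_ge0 ?lee_fin.
have -> : c%:E = ((c ^+ 2)%:E `^ 2^-1)%E.
  by rewrite poweR_EFin powR12_sqrt ?sqr_ge0// sqrtr_sqr ger0_norm.
by apply: gt0_ler_poweR; rewrite // in_itv/= ?leey ?andbT ?lee_fin ?sqr_ge0.
Qed.

Lemma L2P u : L2 u <-> cmeasurable u /\ (energy u < +oo)%E.
Proof.
have E : (L2norm u < +oo)%E <-> (energy u < +oo)%E.
  rewrite L2normE; split; last exact: poweR_lty.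
  by apply: lty_poweRy; rewrite invr_eq0.
by split=> [[m1 m2 /E h]|[[m1 m2] /E h]].
Qed.

Lemma ReB (z w : R[i]) : complex.Re (z - w) = complex.Re z - complex.Re w.
Proof. by case: z w => a b [c d]. Qed.
Lemma ImB (z w : R[i]) : complex.Im (z - w) = complex.Im z - complex.Im w.
Proof. by case: z w => a b [c d]. Qed.

Lemma cmeasurableB u v : cmeasurable u -> cmeasurable v -> cmeasurable (fun x => u x - v x).
Proof.
move=> [m1 m2] [m3 m4]; split.
  by rewrite (_ : (fun x => _) = (fun x => complex.Re (u x) - complex.Re (v x)));
    [exact: measurable_funB|apply/funext => x; exact: ReB].
by rewrite (_ : (fun x => _) = (fun x => complex.Im (u x) - complex.Im (v x)));
  [exact: measurable_funB|apply/funext => x; exact: ImB].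
Qed.

Lemma measurable_cmass u : cmeasurable u -> measurable_fun setT (cmass u).
Proof. by move=> [m1 m2]; apply: measurable_funD; exact: measurable_funX. Qed.

(** The energy is used in place of the norm because this weak triangle inequality is pointwise. *)
Lemma energy_parallelogram u v w : cmeasurable u -> cmeasurable v -> cmeasurable w ->
  (energy (fun x => (u x - w x)%R) <=
   2%:E * energy (fun x => (u x - v x)%R) + 2%:E * energy (fun x => (v x - w x)%R))%E.
Proof.
move=> mu_ mv mw; have m1 := measurable_cmass (cmeasurableB mu_ mv).
have m2 := measurable_cmass (cmeasurableB mv mw).
have m3 := measurable_cmass (cmeasurableB mu_ mw).
rewrite /energy -!ge0_integralZl_EFin//; try (by move=> x _; rewrite lee_fin mass_ge0);
  try exact/measurable_EFinP.
rewrite -ge0_integralD//; try (by move=> x _; rewrite mule_ge0// lee_fin mass_ge0);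
  try (by apply: measurable_funeM; exact/measurable_EFinP).
apply: ge0_le_integral => //.
- by move=> x _; rewrite lee_fin mass_ge0.
- exact/measurable_EFinP.
- by apply: emeasurable_funD; apply: measurable_funeM; exact/measurable_EFinP.
move=> x _; rewrite -!EFinM -EFinD lee_fin /cmass /mass !ReB !ImB.
move: (u x) (v x) (w x) => [a a'] [b b'] [c c'] /=.
have := sqr_ge0 ((a - b) - (b - c)); have := sqr_ge0 ((a' - b') - (b' - c')); nra.
Qed.
End L2_facts.

(** * Compactness of the inclusion *)

Section L2_limits.
Context {R : realType} {n : nat}.
Local Notation mu := (lebesgue_rV R n).
Local Notation cfct := ('rV[R]_n -> R[i]).
Implicit Types (u v w : cfct) (us : nat -> cfct).

Lemma L2_cvg_near us u (e : R) : L2_cvg us u -> 0 < e ->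
  \forall k \near \oo, (L2norm (fun x => (us k x - u x)%R) <= e%:E)%E.
Proof.
move=> /fine_cvgP[fn] /cvgr0_norm_le H e0; have := H _ e0.
apply: filterS2 fn => k fk h; rewrite -(fineK fk) lee_fin; apply: le_trans h.
exact: ler_norm.
Qed.

Lemma L2_cvg_squeeze us u (c : nat -> R) : c @ \oo --> 0 ->
  (forall k, (L2norm (fun x => (us k x - u x)%R) <= (c k)%:E)%E) -> L2_cvg us u.
Proof.
move=> c0 H; have c1 : (fun k => (c k)%:E) @ \oo --> (0 : \bar R)%E.
  by apply: cvg_EFin => //; exact: nearW.
have c2 : (fun=> 0%E : \bar R) @ \oo --> (0 : \bar R)%E by exact: cvg_cst.
rewrite /L2_cvg; apply: (squeeze_cvge _ c2 c1); apply: nearW => k.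
by rewrite H andbT L2normE poweR_ge0.
Qed.

Lemma energy_cst_cplx (f g : 'rV[R]_n -> R) : csmooth1 f -> csmooth1 g ->
  energy (fun x => f x +i* g x) = (\int[mu]_x mass f g x)%:E.
Proof. by move=> cf cg; rewrite /energy -(Rint_fine (csmooth1_Rsummable (csmooth1_mass cf cg))). Qed.

Lemma dyadic_sqrt_cvg (K : R) : (fun j => Num.sqrt (K * 2 ^- j)) @ \oo --> 0.
Proof.
have h : (fun j => K * 2 ^- j) @ \oo --> (0 : R).
  have -> : (fun j => K * 2 ^- j) = geometric K 2^-1.
    by apply/funext => j; rewrite /geometric /= exprVn.
  by apply: cvg_geometric; rewrite ger0_norm ?invr_ge0// invf_lt1// ltr1n.
rewrite -[X in _ --> X]sqrtr0.
exact: (continuous_cvg _ (@sqrt_continuous R 0) h).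
Qed.
End L2_limits.

Section compactness.
Context {R : realType} {n : nat}.
Local Notation mu := (lebesgue_rV R n).
Local Notation fct := ('rV[R]_n -> R).
Implicit Types (f g : nat -> fct) (u v w : 'rV[R]_n -> R[i]).

Lemma energy_le u v : cmeasurable u -> cmeasurable v ->
  (energy u <= 2%:E * energy (fun x => (u x - v x)%R) + 2%:E * energy v)%E.
Proof.
move=> mu_ mv; have m0 : cmeasurable (fun _ : 'rV[R]_n => 0 : R[i]).
  by split; exact: measurable_cst.
have E w : (fun x => w x - 0) = w by apply/funext => x; rewrite subr0.
by have := energy_parallelogram mu_ mv m0; rewrite !E.
Qed.

Lemma energyC u v : energy (fun x => (u x - v x)%R) = energy (fun x => (v x - u x)%R).
Proof.
rewrite /energy; apply: eq_integral => x _; congr EFin.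
rewrite /cmass /mass !ReB !ImB; move: (u x) (v x) => [p q] [p' q'] /=; ring.
Qed.

Theorem compact_subsequence f g (eta p K : R) : 0 < eta -> 0 <= p ->
  (forall k, csmooth1 (f k)) -> (forall k, csmooth1 (g k)) ->
  (forall k, \int[mu]_x mass (f k) (g k) x <= K) ->
  (forall k, \int[mu]_x (wgt (- p) x * grad2 (f k) (g k) x) <= K) ->
  (forall k, \int[mu]_x (wgt eta x * mass (f k) (g k) x) <= K) ->
  exists2 s : nat -> nat, {homo s : i j / (i < j)%N} &
  exists2 v : 'rV[R]_n -> R[i], cmeasurable v &
  forall j, (energy (fun x => (v x - (f (s j) x +i* g (s j) x))%R) <= (8 * 2 ^- j)%:E)%E.
Proof.
move=> eta0 p0 cf cg H1 H2 H3.
have sq (h : fct) m : csmooth1 h -> Rsummable mu (fun x => wgt m x * h x ^+ 2).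
  by move=> ch; have [sh _] := ch; exact: (csmooth1_Rsummable (csmooth1Ml (smooth_wgt m) (csmooth1Ml sh ch))).
have sqm m k : Rsummable mu (fun x => wgt m x * mass (f k) (g k) x).
  exact: (csmooth1_Rsummable (csmooth1Ml (smooth_wgt m) (csmooth1_mass (cf k) (cg k)))).
have sqg k : Rsummable mu (fun x => wgt (- p) x * grad2 (f k) (g k) x).
  exact: (csmooth1_Rsummable (csmooth1Ml (smooth_wgt (- p)) (csmooth1_grad2 (cf k) (cg k)))).
have le1 m k (h : fct) : csmooth1 h -> (forall x, h x ^+ 2 <= mass (f k) (g k) x) ->
    \int[mu]_x (wgt m x * h x ^+ 2) <= \int[mu]_x (wgt m x * mass (f k) (g k) x).
  move=> ch hm; apply: (Rint_le (sq h m ch) (sqm m k)) => x.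
  by apply: ler_wpM2l; [exact: wgt_ge0|exact: hm].
have le2 k (h : fct) : csmooth1 h -> (forall x, h x ^+ 2 <= grad2 (f k) (g k) x) ->
    \int[mu]_x (wgt (- p) x * h x ^+ 2) <= K.
  move=> ch hm; apply: le_trans (H2 k); apply: (Rint_le (sq h (- p) ch) (sqg k)) => x.
  by apply: ler_wpM2l; [exact: wgt_ge0|exact: hm].
have fm k x : f k x ^+ 2 <= mass (f k) (g k) x by rewrite lerDl sqr_ge0.
have gm k x : g k x ^+ 2 <= mass (f k) (g k) x by rewrite lerDr sqr_ge0.
have w0 k (h : fct) : csmooth1 h -> (forall x, h x ^+ 2 <= mass (f k) (g k) x) ->
    \int[mu]_x (h x ^+ 2) <= K.
  move=> ch hm; apply: le_trans (H1 k).
  exact: (Rint_le (Rsummable_bms (csmooth1_sqr_bms ch)) (csmooth1_Rsummable (csmooth1_mass (cf k) (cg k))) hm).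
have [U [UU Uoo]] := ultraFilterLemma (eventually_filter : ProperFilter \oo).
have Cf (e : R) : 0 < e -> exists2 A, U A &
    forall k l, A k -> A l -> \int[mu]_x ((f k x - f l x) ^+ 2) <= e.
  apply: (ultra_L2_cauchy UU eta0 p0 cf).
  - by move=> k; exact: (w0 k _ (cf k) (fm k)).
  - move=> k j; apply: (le2 k _ (csmooth1_partial j (cf k))) => x.
    rewrite /grad2 (bigD1 j)//= -addrA lerDl addr_ge0 ?sqr_ge0//.
    by apply: sumr_ge0 => i _; rewrite addr_ge0 ?sqr_ge0.
  - by move=> k; apply: le_trans (H3 k); exact: (le1 eta k _ (cf k) (fm k)).
have Cg (e : R) : 0 < e -> exists2 A, U A &
    forall k l, A k -> A l -> \int[mu]_x ((g k x - g l x) ^+ 2) <= e.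
  apply: (ultra_L2_cauchy UU eta0 p0 cg).
  - by move=> k; exact: (w0 k _ (cg k) (gm k)).
  - move=> k j; apply: (le2 k _ (csmooth1_partial j (cg k))) => x.
    rewrite /grad2 (bigD1 j)//= addrC addrA lerDr addr_ge0 ?sqr_ge0//.
    by apply: sumr_ge0 => i _; rewrite addr_ge0 ?sqr_ge0.
  - by move=> k; apply: le_trans (H3 k); exact: (le1 eta k _ (cg k) (gm k)).
pose Q k l := \int[mu]_x ((f k x - f l x) ^+ 2) + \int[mu]_x ((g k x - g l x) ^+ 2).
have CQ (e : R) : 0 < e -> exists2 A, U A & forall k l, A k -> A l -> Q k l <= e.
  move=> e0; have e2 : 0 < e / 2 by rewrite divr_gt0.
  have [A UA HA] := Cf _ e2; have [B UB HB] := Cg _ e2.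
  exists (A `&` B); first exact: filterI.
  move=> k l [Ak Bk] [Al Bl]; rewrite /Q [e]splitr.
  by apply: lerD; [exact: HA|exact: HB].
have d0 j : 0 < (2 ^- j) ^+ 2 :> R by rewrite exprn_gt0// invr_gt0 dyadic_gt0.
have [s hs Hs] := extraction UU Uoo d0 CQ; exists s => //.
have lim (h : nat -> fct) : (forall k, csmooth1 (h k)) ->
    (forall j, \int[mu]_x ((h (s j.+1) x - h (s j) x) ^+ 2) <= (2 ^- j) ^+ 2) ->
    exists2 v : fct, measurable_fun setT v &
    forall m, (\int[mu]_x ((v x - h (s m) x) ^+ 2)%:E <= (4 * 2 ^- m)%:E)%E.
  move=> ch Hh; apply: (@rapidly_cauchy_cvg _ _ R mu (fun j => h (s j))).
    by move=> j; have [] := csmooth1_bms (ch (s j)).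
  move=> j.
  have i1 := Rsummable_bms (csmooth1_sqr_bms (csmooth1B (ch (s j.+1)) (ch (s j)))).
  by rewrite (Rint_fine i1) lee_fin.
have Q0 (h : nat -> fct) k l : 0 <= \int[mu]_x ((h k x - h l x) ^+ 2).
  exact: (Rint_ge0 _ (fun x => sqr_ge0 (h k x - h l x))).
have [vf mvf Hf] : exists2 v : fct, measurable_fun setT v &
    forall m, (\int[mu]_x ((v x - f (s m) x) ^+ 2)%:E <= (4 * 2 ^- m)%:E)%E.
  by apply: lim => // j; apply: le_trans (Hs j); rewrite /Q lerDl.
have [vg mvg Hg] : exists2 v : fct, measurable_fun setT v &
    forall m, (\int[mu]_x ((v x - g (s m) x) ^+ 2)%:E <= (4 * 2 ^- m)%:E)%E.
  by apply: lim => // j; apply: le_trans (Hs j); rewrite /Q lerDr.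
exists (fun x => vf x +i* vg x) => [|j]; first by split.
have mf j' : measurable_fun setT (f j') by have [] := csmooth1_bms (cf j').
have mg j' : measurable_fun setT (g j') by have [] := csmooth1_bms (cg j').
have -> : energy (fun x => ((vf x +i* vg x) - (f (s j) x +i* g (s j) x))%R) =
   (\int[mu]_x ((vf x - f (s j) x) ^+ 2)%:E + \int[mu]_x ((vg x - g (s j) x) ^+ 2)%:E)%E.
  rewrite -ge0_integralD//.
  - by move=> x _; rewrite lee_fin sqr_ge0.
  - by apply/measurable_EFinP; apply: measurable_funX; exact: measurable_funB.
  - by move=> x _; rewrite lee_fin sqr_ge0.
  - by apply/measurable_EFinP; apply: measurable_funX; exact: measurable_funB.
apply: (le_trans (leeD (Hf j) (Hg j))); rewrite -EFinD lee_fin; lra.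
Qed.
End compactness.

Section main.
Context {R : realType} {n : nat}.
Local Notation mu := (lebesgue_rV R n).
Local Notation cfct := ('rV[R]_n -> R[i]).
Variables (alpha : R) (V : 'rV[R]_n -> 'rV[R]_n -> R).

Lemma Dmin_approx (u : cfct) (e : R) : Dmin alpha V u -> 0 < e ->
  exists w : cfct, [/\ test_function w, (L2norm (fun x => (w x - u x)%R) <= e%:E)%E &
    (L2norm (fun x => (repulsive alpha V w x - repulsive_L2 alpha V u x)%R) <= e%:E)%E].
Proof.
move=> [_ _ [w_ [tw cw cPw]]] e0.
have [k [h1 h2]] := filter_ex (filterI (L2_cvg_near cw e0) (L2_cvg_near cPw e0)).
by exists (w_ k).
Qed.

Lemma Dmin_L2 (u : cfct) : Dmin alpha V u -> L2 u /\ L2 (repulsive_L2 alpha V u).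
Proof.
move=> [Lu [f Lf df] _]; split=> //.
have : exists g, [set g | L2 g /\ distr_repulsive alpha V u g] g by exists f.
by move/(xgetPex (fun=> 0)) => -[].
Qed.
End main.

Theorem theorem1p6 (R : realType) (n : nat) (hn : (1 <= n)%N)
    (alpha : R) (halpha : 1 < alpha) (mu : R) (hmu : 0 < mu < 2^-1)
    (a : 'I_n -> 'I_n -> 'rV[R]_n -> R)
    (b : 'I_n -> 'rV[R]_n -> R) (c : 'rV[R]_n -> R)
    (asym : forall j k x, a j k x = a k j x)
    (asmth : forall j k, smooth (a j k))
    (bsmth : forall j, smooth (b j))
    (csmth : smooth c)
    (abound : forall j k, symbol_bound (- mu) (a j k))
    (bbound : forall j, symbol_bound (alpha - mu) (b j))
    (cbound : symbol_bound (2 * alpha - mu) c)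
    (pelliptic : forall M : R, 0 < M ->
      exists C : R, 0 < C /\ exists R_M : R, 0 < R_M /\
      forall x xi : 'rV[R]_n, enorm x <= M -> R_M <= enorm xi ->
        C * japanese xi ^+ 2 <=
          `|repulsive_symbol alpha (perturbation a b c) x xi|) :
  compact_inclusion_L2 (Dmin alpha (perturbation a b c))
    (graph_norm alpha (perturbation a b c)).
Proof.
have /andP[mu0 _] := hmu.
set V := perturbation a b c; move=> u Du [M HM].
pose P := repulsive alpha V.
have HuM k : (L2norm (u k) <= M%:E)%E /\ (L2norm (repulsive_L2 alpha V (u k)) <= M%:E)%E.
  have p1 : (0 <= L2norm (u k))%E by rewrite L2normE poweR_ge0.
  have p2 : (0 <= L2norm (repulsive_L2 alpha V (u k)))%E by rewrite L2normE poweR_ge0.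
  by split; apply: le_trans (HM k); rewrite /graph_norm ?leeDl ?leeDr.
have M0 : 0 <= M by rewrite -lee_fin; apply: le_trans (HuM 0%N).1; rewrite L2normE poweR_ge0.
(* The test functions get closer to the u k, so that a limit of the former is one of the latter. *)
have /choice[w Hw] : forall k, exists w : 'rV[R]_n -> R[i], [/\ test_function w,
    (L2norm (fun x => (w x - u k x)%R) <= (2 ^- k)%:E)%E &
    (L2norm (fun x => (P w x - repulsive_L2 alpha V (u k) x)%R) <= (2 ^- k)%:E)%E].
  by move=> k; apply: Dmin_approx => //; rewrite invr_gt0 dyadic_gt0.
pose f k x := complex.Re (w k x); pose g k x := complex.Im (w k x).
have cf k : csmooth1 (f k) by have [tw _ _] := Hw k; exact: (test_function_csmooth1 tw).1.
have cg k : csmooth1 (g k) by have [tw _ _] := Hw k; exact: (test_function_csmooth1 tw).2.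
have wE k : w k = fun x => f k x +i* g k x.
  by apply/funext => x; rewrite /f /g; case: (w k x).
have [cPf cPg] : (forall k, csmooth1 (fun x => complex.Re (P (w k) x))) /\
    (forall k, csmooth1 (fun x => complex.Im (P (w k) x))).
  by split=> k; rewrite wE; [exact: (csmooth1_repulsive _ asym asmth bsmth csmth (cf k) (cg k)).1
    |exact: (csmooth1_repulsive _ asym asmth bsmth csmth (cf k) (cg k)).2].
have mw k : cmeasurable (w k).
  by split; [have [] := csmooth1_bms (cf k)|have [] := csmooth1_bms (cg k)].
have mPw k : cmeasurable (P (w k)).
  by split; [have [] := csmooth1_bms (cPf k)|have [] := csmooth1_bms (cPg k)].
have mu_ k : cmeasurable (u k) by have [/L2P[]] := Dmin_L2 (Du k).
have mPu k : cmeasurable (repulsive_L2 alpha V (u k)) by have [_ /L2P[]] := Dmin_L2 (Du k).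
have d01 k : 0 <= (2 ^- k : R) <= 1.
  by rewrite invr_ge0 exprn_ge0//= invf_le1 ?exprn_gt0// exprn_ege1// ler1n.
have bnd (p q : 'rV[R]_n -> R[i]) k : cmeasurable p -> cmeasurable q ->
    (L2norm (fun x => (p x - q x)%R) <= (2 ^- k)%:E)%E -> (L2norm q <= M%:E)%E ->
    (energy p <= (2 + 2 * M ^+ 2)%:E)%E.
  move=> mp mq; have /andP[k0 k1] := d01 k; rewrite (L2norm_le _ k0) (L2norm_le _ M0) => h1 h2.
  apply: (le_trans (energy_le mp mq)); rewrite [leRHS]EFinD; apply: leeD.
    rewrite -[leRHS]mule1; apply: lee_wpmul2l => //; apply: (le_trans h1).
    by rewrite lee_fin exprn_ile1.
  by rewrite EFinM; apply: lee_wpmul2l.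
pose K0 := 2 + 2 * M ^+ 2.
have Ew k : \int[lebesgue_rV R n]_x mass (f k) (g k) x <= K0.
  have [_ h _] := Hw k; rewrite -lee_fin -(energy_cst_cplx (cf k) (cg k)) -wE.
  exact: (bnd _ _ k (mw k) (mu_ k) h (HuM k).1).
have EPw k : \int[lebesgue_rV R n]_x mass (fun x => complex.Re (P (w k) x))
    (fun x => complex.Im (P (w k) x)) x <= K0.
  have [_ _ h] := Hw k; rewrite -lee_fin -(Rint_fine (csmooth1_Rsummable (csmooth1_mass (cPf k) (cPg k)))).
  exact: (bnd _ _ k (mPw k) (mPu k) h (HuM k).2).
have [eta eta0 [C C0 HC]] := a_priori hn halpha mu0 asym asmth bsmth csmth abound bbound cbound pelliptic.
pose K := K0 + C * (K0 + K0).
have K00 : 0 <= K0 by rewrite addr_ge0// mulr_ge0// sqr_ge0.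
have KK : C * (K0 + K0) <= K by rewrite lerDr.
have le_K k : C * (\int[lebesgue_rV R n]_x mass (f k) (g k) x +
    \int[lebesgue_rV R n]_x mass (fun x => complex.Re (P (w k) x)) (fun x => complex.Im (P (w k) x)) x) <= K.
  by apply: le_trans KK; apply: ler_wpM2l => //; exact: lerD (Ew k) (EPw k).
have HC' k := HC _ _ (cf k) (cg k).
have al0 : 0 <= 2 * alpha by rewrite mulr_ge0// ltW// (lt_trans ltr01).
have [|||s hs [v mv Hv]] := @compact_subsequence R n f g eta (2 * alpha) K eta0 al0 cf cg.
- by move=> k; apply: (le_trans (Ew k)); rewrite lerDl mulr_ge0// addr_ge0.
- by move=> k; apply: le_trans (le_K k); have := (HC' k).1; rewrite /= -wE.
- by move=> k; apply: le_trans (le_K k); have := (HC' k).2; rewrite /= -wE.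
have wv j : (energy (fun x => (v x - w (s j) x)%R) <= (8 * 2 ^- j)%:E)%E by rewrite wE; exact: Hv.
exists s => //; exists v.
  apply/L2P; split=> //; apply: (le_lt_trans (energy_le mv (mw (s 0%N)))).
  have h1 := wv 0%N; have h2 : (energy (w (s 0%N)) <= K0%:E)%E.
    by rewrite wE (energy_cst_cplx (cf _) (cg _)) lee_fin; exact: Ew.
  apply: (@le_lt_trans _ _ (2%:E * (8 * 2 ^- 0)%:E + 2%:E * K0%:E)%E); last first.
    by rewrite -!EFinM -EFinD ltry.
  by apply: leeD; apply: lee_wpmul2l.
apply: (L2_cvg_squeeze (dyadic_sqrt_cvg 18)) => j.
have sj : (j <= s j)%N.
  by elim: j => // j IH; apply: (leq_ltn_trans IH); exact: hs.
rewrite (L2norm_le _ (sqrtr_ge0 _)) sqr_sqrtr; last by rewrite mulr_ge0// invr_ge0 ltW// dyadic_gt0.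
apply: (le_trans (energy_parallelogram (mu_ (s j)) (mw (s j)) mv)).
have -> : (18 * 2 ^- j)%:E = (2%:E * (2 ^- j)%:E + 2%:E * (8 * 2 ^- j)%:E)%E :> \bar R.
  by rewrite -!EFinM -EFinD; congr EFin; ring.
apply: leeD; apply: lee_wpmul2l => //; last by rewrite energyC; exact: wv.
have [_ h _] := Hw (s j); move: h; have /andP[k0 k1] := d01 (s j).
rewrite energyC (L2norm_le _ k0) => h; apply: (le_trans h); rewrite lee_fin.
apply: (@le_trans _ _ (2 ^- s j)); first by rewrite expr2 ler_piMr.
by rewrite lef_pV2 ?posrE ?dyadic_gt0// ler_weXn2l// ler1n.
Qed.
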